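(* Let $(M^{2n},\omega)$ be a symplectic manifold and let $f=(f_1,\dots,f_n):M^{2n}\to B$ be a fiber bundle over a connected open subset $B$ of $\mathbb R^n$. Suppose that \begin{itemize} \item $H^2(B;\mathbb R)=0$; \item each fiber of $f$ is a simply connected Lagrangian submanifold; and \item the Hamiltonian vector fields $\mathbb X_{f_1},\dots,\mathbb X_{f_n}$ are linearly independent at each point of $M$ and complete. \end{itemize} Then there is a function $g=(g_1,\dots,g_n):M\to\mathbb R^n$ such that $(f_1,\dots,f_n,g_1,\dots,g_n)$ is a global Darboux coordinate system.
   Context: The Hamiltonian vector field $\mathbb X_f$ of a smooth function $f$ is defined by $\omega(\mathbb X_f,Y)=df(Y)$ for all vector fields $Y$. Everything is smooth; simply connected includes connected. A global Darboux coordinate system on $(M^{2n},\omega)$ is a tuple of smooth functions $(f_1,\dots,f_n,g_1,\dots,g_n)$ giving a global coordinate system (a diffeomorphism from $M$ onto an open subset of $\mathbb R^{2n}$) with $\omega=\sum_{i=1}^n df_i\wedge dg_i$. *)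

(* Defs.v *)
From mathcomp Require Import all_boot all_order all_algebra.
From mathcomp Require Import all_classical all_reals all_analysis.

Set Implicit Arguments.
Unset Strict Implicit.
Unset Printing Implicit Defensive.

Import Order.TTheory GRing.Theory Num.Theory.
Import numFieldNormedType.Exports.

Local Open Scope classical_set_scope.
Local Open Scope ring_scope.

(** * Smooth functions on open sets of normed spaces *)

(* C^oo on an open set U: every iterated directional derivative
   D_{v_1} ... D_{v_k} f (k >= 0) exists and is continuous on U.  For
   finite-dimensional V (the only case used) it is equivalent to let the v_i
   range over a basis. *)
Definition smooth_on (R : realType) (V W : normedModType R) (U : set V)
    (f : V -> W) : Prop :=
  forall s : seq V, let g := foldr (fun v h x => 'D_v h x) f s in
    forall x, U x -> {for x, continuous g} /\ forall v, derivable g x v.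

(** * Smooth manifolds *)

(* [chart_inv] is only meaningful on the open set [chart_img c]. *)
Record chart (R : realType) (M : topologicalType) (m : nat) := Chart {
  chart_dom : set M;
  chart_fun :> M -> 'rV[R]_m;
  chart_inv : 'rV[R]_m -> M;
  chart_dom_open : open chart_dom;
  chart_img_open : open (chart_fun @` chart_dom);
  chart_funK : forall p, chart_dom p -> chart_inv (chart_fun p) = p;
  chart_continuous : forall p, chart_dom p -> {for p, continuous chart_fun};
  chart_inv_continuous : forall p, chart_dom p ->
    {for chart_fun p, continuous chart_inv} }.

Definition chart_img (R : realType) (M : topologicalType) (m : nat)
  (c : chart R M m) : set 'rV[R]_m := c @` chart_dom c.

Definition smooth_transition (R : realType) (M : topologicalType) (m : nat)
    (c d : chart R M m) : Prop :=
  smooth_on (c @` (chart_dom c `&` chart_dom d)) (d \o chart_inv c).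

(* [chart_at p] is a preferred chart around p.  It is used to represent
   T_p M by 'rV[R]_m: the row u stands for the tangent vector at p whose
   components in the chart [chart_at p] are u. *)
Record manifold (R : realType) (m : nat) := Manifold {
  carrier :> topologicalType;
  atlas : set (chart R carrier m);
  chart_at : carrier -> chart R carrier m;
  chart_at_atlas : forall p, atlas (chart_at p);
  mem_chart_at : forall p, chart_dom (chart_at p) p;
  atlas_compatible : forall c d, atlas c -> atlas d -> smooth_transition c d;
  manifold_hausdorff : hausdorff_space carrier;
  manifold_second_countable : @second_countable carrier }.

Definition in_maximal_atlas (R : realType) (m : nat) (M : manifold R m)
    (c : chart R M m) : Prop :=
  forall d, atlas d -> smooth_transition c d /\ smooth_transition d c.

(* In the next three definitions, U is meant to be open. *)

Definition smooth_fun (R : realType) (m : nat) (M : manifold R m)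
    (W : normedModType R) (U : set M) (h : M -> W) : Prop :=
  forall c : chart R M m, atlas c ->
    smooth_on (c @` (chart_dom c `&` U)) (h \o chart_inv c).

Definition smooth_into (R : realType) (m : nat) (M : manifold R m)
    (V : normedModType R) (U : set V) (g : V -> M) : Prop :=
  (forall x, U x -> {for x, continuous g}) /\
  forall c : chart R M m, atlas c ->
    smooth_on (U `&` g @^-1` chart_dom c) (c \o g).

Definition smooth_map (R : realType) (m k : nat) (M : manifold R m)
    (N : manifold R k) (U : set M) (h : M -> N) : Prop :=
  (forall p, U p -> {for p, continuous h}) /\
  forall d : chart R N k, atlas d ->
    smooth_fun (U `&` h @^-1` chart_dom d) (d \o h).

(** * Tangent vectors, vector fields, flows *)

(* The differential dh_p(u) of h at p along the tangent vector u. *)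
Definition dfun (R : realType) (m : nat) (M : manifold R m)
    (W : normedModType R) (p : M) (h : M -> W) (u : 'rV[R]_m) : W :=
  'D_u (h \o chart_inv (chart_at p)) (chart_at p p).

(* A vector field X is smooth if so are its components x |-> dc(X) in each
   chart c of the atlas. *)
Definition vector_field (R : realType) (m : nat) (M : manifold R m)
    (X : M -> 'rV[R]_m) : Prop :=
  forall c : chart R M m, atlas c ->
    smooth_on (chart_img c)
      (fun x => let p := chart_inv c x in dfun p c (X p)).

Definition integral_curve (R : realType) (m : nat) (M : manifold R m)
    (X : M -> 'rV[R]_m) (gamma : R -> M) : Prop :=
  continuous gamma /\
  forall t : R, is_derive t 1 (chart_at (gamma t) \o gamma) (X (gamma t)).

Definition complete_field (R : realType) (m : nat) (M : manifold R m)
    (X : M -> 'rV[R]_m) : Prop :=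
  forall p : M, exists gamma : R -> M, gamma 0 = p /\ integral_curve X gamma.

(** * Differential 2-forms *)

(* The bilinear form with matrix A. *)
Definition form_eval (R : realType) (m : nat) (A : 'M[R]_m) (u v : 'rV[R]_m) : R :=
  (u *m A *m v^T) 0 0.

Definition std_basis (R : realType) (m : nat) (i : 'I_m) : 'rV[R]_m :=
  delta_mx 0 i.

(* A 2-form on an open set U of R^m: eta x i j is its value at x on the
   coordinate vectors e_i, e_j. *)
Definition form2_on (R : realType) (m : nat) (U : set 'rV[R]_m)
    (eta : 'rV[R]_m -> 'M[R]_m) : Prop :=
  smooth_on U eta /\ forall x, U x -> (eta x)^T = - eta x.

(* d eta = 0 *)
Definition closed2_on (R : realType) (m : nat) (U : set 'rV[R]_m)
    (eta : 'rV[R]_m -> 'M[R]_m) : Prop :=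
  forall x, U x -> forall i j k : 'I_m,
    'D_(std_basis R i) (fun y => eta y j k) x +
    'D_(std_basis R j) (fun y => eta y k i) x +
    'D_(std_basis R k) (fun y => eta y i j) x = 0.

(* eta = d alpha for the smooth 1-form alpha = sum_j alpha_j dx_j *)
Definition exact2_on (R : realType) (m : nat) (U : set 'rV[R]_m)
    (eta : 'rV[R]_m -> 'M[R]_m) : Prop :=
  exists alpha : 'rV[R]_m -> 'rV[R]_m, smooth_on U alpha /\
    forall x, U x -> forall i j : 'I_m,
      eta x i j = 'D_(std_basis R i) (fun y => alpha y 0 j) x
                - 'D_(std_basis R j) (fun y => alpha y 0 i) x.

(* H^2(U; R) = 0, in de Rham cohomology *)
Definition H2_zero (R : realType) (m : nat) (U : set 'rV[R]_m) : Prop :=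
  forall eta, form2_on U eta -> closed2_on U eta -> exact2_on U eta.

(* The coordinate vector d/dx_i at p of the chart c, as an element of T_p M. *)
Definition coord_vector (R : realType) (m : nat) (M : manifold R m)
    (c : chart R M m) (p : M) (i : 'I_m) : 'rV[R]_m :=
  'D_(std_basis R i) (chart_at p \o chart_inv c) (c p).

(* A field of bilinear forms on the T_p M is w : M -> 'M_m, with
   w_p(u, v) = form_eval (w p) u v; this is its expression in the chart c. *)
Definition local_form (R : realType) (m : nat) (M : manifold R m)
    (w : M -> 'M[R]_m) (c : chart R M m) (x : 'rV[R]_m) : 'M[R]_m :=
  let p := chart_inv c x in
  \matrix_(i, j) form_eval (w p) (coord_vector c p i) (coord_vector c p j).

Definition symplectic (R : realType) (m : nat) (M : manifold R m)
    (w : M -> 'M[R]_m) : Prop :=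
  [/\ forall p u, form_eval (w p) u u = 0,
      forall c : chart R M m, atlas c ->
        form2_on (chart_img c) (local_form w c) /\
        closed2_on (chart_img c) (local_form w c)
    & forall p u, (forall v, form_eval (w p) u v = 0) -> u = 0].

Definition hamiltonian_field (R : realType) (m : nat) (M : manifold R m)
    (w : M -> 'M[R]_m) (h : M -> R) (X : M -> 'rV[R]_m) : Prop :=
  vector_field X /\
  forall Y : M -> 'rV[R]_m, vector_field Y ->
    forall p : M, form_eval (w p) (X p) (Y p) = dfun p h (Y p).

(** * Lagrangian submanifolds *)

(* L is an embedded submanifold of dimension k and codimension l. *)
Definition embedded_submanifold (R : realType) (k l : nat)
    (M : manifold R (k + l)) (L : set M) : Prop :=
  forall p, L p -> exists c : chart R M (k + l),
    [/\ in_maximal_atlas c, chart_dom c p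
      & forall q, chart_dom c q -> (L q <-> rsubmx (c q) = 0)].

(* T_p L, as the set of velocities of smooth curves lying in L. *)
Definition tangent_to (R : realType) (m : nat) (M : manifold R m) (L : set M)
    (p : M) (u : 'rV[R]_m) : Prop :=
  exists gamma : R -> M,
    [/\ smooth_into [set: R] gamma, forall t, L (gamma t), gamma 0 = p
      & is_derive (0 : R) 1 (chart_at p \o gamma) u].

Definition lagrangian (R : realType) (n : nat) (M : manifold R (n + n))
    (w : M -> 'M[R]_(n + n)) (L : set M) : Prop :=
  embedded_submanifold L /\
  forall p u v, L p -> tangent_to L p u -> tangent_to L p v ->
    form_eval (w p) u v = 0.

(** * Simply connected subsets *)

Definition path_in (R : realType) (T : topologicalType) (A : set T)
    (gamma : R -> T) : Prop :=
  {within `[0, 1], continuous gamma} /\ forall t, `[0, 1]%classic t -> A (gamma t).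

Definition path_connected (R : realType) (T : topologicalType) (A : set T) : Prop :=
  A !=set0 /\
  forall x y, A x -> A y ->
    exists gamma : R -> T, [/\ path_in A gamma, gamma 0 = x & gamma 1 = y].

Definition null_homotopic_loop (R : realType) (T : topologicalType) (A : set T)
    (gamma : R -> T) : Prop :=
  exists H : R * R -> T,
    [/\ {within `[0, 1] `*` `[0, 1], continuous H},
        forall z, (`[0, 1] `*` `[0, 1])%classic z -> A (H z),
        forall t, `[0, 1]%classic t -> H (0, t) = gamma t,
        forall t, `[0, 1]%classic t -> H (1, t) = gamma 0
      & forall s, `[0, 1]%classic s -> H (s, 0) = gamma 0 /\ H (s, 1) = gamma 0].

Definition simply_connected (R : realType) (T : topologicalType) (A : set T) : Prop :=
  path_connected R A /\
  forall gamma : R -> T, path_in A gamma -> gamma 0 = gamma 1 ->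
    null_homotopic_loop A gamma.

(** * Fiber bundles over an open subset of R^n *)

(* (f, Phi) : f^-1(U) -> U x F is a diffeomorphism with inverse Psi. The
   smoothness of Psi is tested in the charts of the manifold F. *)
Definition local_trivialization (R : realType) (m n k : nat) (M : manifold R m)
    (F : manifold R k) (f : M -> 'rV[R]_n) (U : set 'rV[R]_n)
    (Phi : M -> F) (Psi : 'rV[R]_n -> F -> M) : Prop :=
  [/\ smooth_map (f @^-1` U) Phi,
      forall d : chart R F k, atlas d ->
        smooth_into (U `*` chart_img d) (fun z => Psi z.1 (chart_inv d z.2)),
      forall p, U (f p) -> Psi (f p) (Phi p) = p
    & forall x y, U x -> f (Psi x y) = x /\ Phi (Psi x y) = y].

Definition fiber_bundle (R : realType) (m n : nat) (M : manifold R m)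
    (B : set 'rV[R]_n) (f : M -> 'rV[R]_n) : Prop :=
  [/\ smooth_fun setT f, range f = B
    & exists (k : nat) (F : manifold R k), forall b, B b ->
        exists (U : set 'rV[R]_n) (Phi : M -> F) (Psi : 'rV[R]_n -> F -> M),
          [/\ open U, U b, U `<=` B & local_trivialization f U Phi Psi]].

(** * Global Darboux coordinates *)

(* F is a diffeomorphism of M onto an open subset of R^m.  The inverse is the
   restriction to [range F] of any left inverse G of F; quantifying over all G
   only serves to allow M to be empty, when no total function 'rV_m -> M
   exists (otherwise left inverses of an injective F exist, and any two of
   them agree on [range F]). *)
Definition global_coordinates (R : realType) (m : nat) (M : manifold R m)
    (F : M -> 'rV[R]_m) : Prop :=
  [/\ smooth_fun setT F, injective F, open (range F)
    & forall G : 'rV[R]_m -> M, cancel F G -> smooth_into (range F) G].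

Definition global_darboux (R : realType) (n : nat) (M : manifold R (n + n))
    (w : M -> 'M[R]_(n + n)) (f g : M -> 'rV[R]_n) : Prop :=
  global_coordinates (fun p => row_mx (f p) (g p)) /\
  forall p u v, form_eval (w p) u v =
    \sum_(i < n) (dfun p (fun q => f q 0 i) u * dfun p (fun q => g q 0 i) v
                - dfun p (fun q => f q 0 i) v * dfun p (fun q => g q 0 i) u).

(* Main.v *)
(* Call [g] good on an open set [W] if [dg(X_i) = -e_i] there, i.e. if [(f, g)]
   are local coordinates in which [X_i] is minus the i-th vertical coordinate
   field.  Since ker df is spanned by the [X_i], two good functions differ
   locally by a function of [f].  Good functions exist locally: in coordinates
   adapted to [f], the components of [w] mixing a base direction with the fibre
   directions form closed 1-forms along the fibres, and [g] collects their
   primitives.  They can be continued along the simply connected fibres; the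
   continuations, normalised on a local section of [f], are good over small
   balls of [B], and a partition of unity of [B] glues them into a good [g] on
   all of [M].  The map [(f, g)] is etale, and injective: if it takes the same
   value at [p] and [q], a path from [p] to [q] in their fibre is slid by the
   flows of the [X_i], which translate [(f, g)], to a path on which [(f, g)] is
   constant, hence to a constant path, without moving its endpoints.  In the
   coordinates [(x, y) = (f, g)] one finds [w = sum_i dx_i dy_i + beta(x)] with
   [beta] a closed 2-form on [B].  As H^2(B) = 0, [beta = d alpha], and
   [(f, g - alpha o f)] are Darboux coordinates. *)
From HB Require Import structures.
Require Import Defs.
From mathcomp Require Import all_boot all_order all_algebra.
From mathcomp Require Import all_classical all_reals all_analysis.
From mathcomp Require Import ring lra.

Set Implicit Arguments.
Unset Strict Implicit.
Unset Printing Implicit Defensive.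

Import Order.TTheory GRing.Theory Num.Theory.
Import numFieldNormedType.Exports.

Local Open Scope classical_set_scope.
Local Open Scope ring_scope.

(** * Smooth functions on normed spaces *)

(** Completeness supplies one integral curve through each point, with no continuity in the starting
    point, and the primitives on a fibre are a priori known only along single paths. Both gaps are
    closed by the same device, [homotopy_lifting]: a map on the plane that is a lift along every
    vertical line and along the bottom line is a local lift everywhere. It yields the monodromy
    theorem for primitives on a fibre, and the continuity of a path slid by a flow, the latter
    because (f, g) is etale and the flow translates it. The minus sign in dg(X_i) = -e_i is forced
    by omega(X_i, .) = df_i together with omega = sum df_i dg_i. All weights and corrections added
    to g are functions of f, hence are killed by the X_i, so that goodness survives gluing and the
    final correction. Smoothness is stated through directional derivatives, which is why Frechet
    differentiability, symmetry of second derivatives and the inverse function theorem are derived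
    from them beforehand. *)

Section Ck.
Variables (R : realType) (V W : normedModType R).

(** The graded form of [smooth_on], made for induction on the order: arguments such as the Leibniz
    rule or the chain rule gain one derivative at a time. *)
Fixpoint Ck (k : nat) (U : set V) (f : V -> W) : Prop :=
  (forall x, U x -> {for x, continuous f}) /\
  if k is k'.+1 then
    forall v, (forall x, U x -> derivable f x v) /\ Ck k' U ('D_v f)
  else True.

Lemma CkS k U f : Ck k.+1 U f <-> (forall x, U x -> {for x, continuous f}) /\
  forall v, (forall x, U x -> derivable f x v) /\ Ck k U ('D_v f).
Proof. by []. Qed.

Lemma Ck_continuous k U f : Ck k U f -> forall x, U x -> {for x, continuous f}.
Proof. by case: k => [|k] []. Qed.

Lemma CkSW k U f : Ck k.+1 U f -> Ck k U f.
Proof.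
elim: k f => [|k IHk] f; first by case=> cf _; split.
by move=> /CkS[cf df]; apply/CkS; split=> // v; have [? /IHk] := df v.
Qed.

Lemma Ck_leq j k U f : (j <= k)%N -> Ck k U f -> Ck j U f.
Proof.
move=> /subnK <-; elim: (k - j)%N => // i IHi; rewrite addSn => /CkSW; exact: IHi.
Qed.

Lemma Ck_subset k (U U' : set V) f : U `<=` U' -> Ck k U' f -> Ck k U f.
Proof.
move=> UU'; elim: k f => [|k IHk] f.
  by case=> cf _; split=> // x /UU'; exact: cf.
move=> /CkS[cf df]; apply/CkS; split=> [x /UU'|v]; first exact: cf.
by have [dv /IHk] := df v; split=> // x /UU'; exact: dv.
Qed.

(** [smooth_on] adds derivatives on the outside and [Ck] removes them from the inside, so both
    directions are proved for all iterated derivatives [g s] at once. *)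
Lemma smooth_onP U f : smooth_on U f <-> forall k, Ck k U f.
Proof.
pose g s := foldr (fun v (h : V -> W) x => 'D_v h x) f s.
split=> [fS k|fC s /= x Ux].
  suff: forall s, Ck k U (g s) by move=> /(_ [::]).
  elim: k => [|k IHk] s; first by split=> // x Ux; have [] := fS s x Ux.
  apply/CkS; split=> [x Ux|v]; first by have [] := fS s x Ux.
  by split=> [x Ux|]; [have [_] := fS s x Ux | exact: (IHk (v :: s))].
suff gC k : Ck k U (g s).
  by have /CkS[+ d] := gC 1%N => /(_ x Ux); split=> // v; have [/(_ x Ux)] := d v.
elim: s k {x Ux} => [|v s IHs] k /=; first exact: fC.
by have /CkS[_ /(_ v) []] := IHs k.+1.
Qed.

Lemma eq_Ck k (U : set V) f g : open U -> (forall x, U x -> f x = g x) ->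
  Ck k U f -> Ck k U g.
Proof.
move=> oU; elim: k f g => [|k IHk] f g fg.
  case=> cf _; split=> // x Ux; have := cf x Ux.
  rewrite /prop_for /continuous_at (fg _ Ux); apply: cvg_trans; apply: near_eq_cvg.
  by apply: filterS fg _; exact: open_nbhs_nbhs.
have nfg x : U x -> \forall y \near x, f y = g y.
  by move=> Ux; apply: filterS fg _; exact: open_nbhs_nbhs.
move=> /CkS[cf df]; apply/CkS; split=> [x Ux|v].
  have := cf x Ux; rewrite /prop_for /continuous_at (fg _ Ux); apply: cvg_trans.
  exact/near_eq_cvg/nfg.
have [dv Dv] := df v; split=> [x Ux|].
  exact: near_eq_derivable (nfg _ Ux) (dv _ Ux).
by apply: IHk Dv => x Ux; exact: near_eq_derive (nfg _ Ux).
Qed.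

Lemma Ck_local k (U : set V) f :
  (forall x, U x -> exists2 N, nbhs x N & Ck k N f) -> Ck k U f.
Proof.
elim: k f => [|k IHk] f H.
  split=> // x Ux; have [N xN fN] := H x Ux.
  by apply: (Ck_continuous fN); exact: nbhs_singleton xN.
apply/CkS; split=> [x Ux|v].
  have [N xN fN] := H x Ux.
  by apply: (Ck_continuous fN); exact: nbhs_singleton xN.
split=> [x Ux|].
  have [N xN /CkS[_ /(_ v)[+ _]]] := H x Ux; apply; exact: nbhs_singleton xN.
by apply: IHk => x Ux; have [N xN /CkS[_ /(_ v)[_ ?]]] := H x Ux; exists N.
Qed.

Lemma Ck_cst k U (c : W) : Ck k U (cst c).
Proof.
elim: k c => [|k IHk] c; first by split=> // x _; exact: cst_continuous.
apply/CkS; split=> [x _|v]; first exact: cst_continuous.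
split=> [x _|]; first exact: derivable_cst.
by have -> : 'D_v (cst c) = cst 0 by apply/funext=> x; exact: derive_cst.
Qed.

Lemma Ck_add k (U : set V) f g : open U -> Ck k U f -> Ck k U g ->
  Ck k U (fun x => f x + g x).
Proof.
move=> oU; elim: k f g => [|k IHk] f g.
  by move=> [cf _] [cg _]; split=> // x Ux; apply: continuousD; [exact: cf|exact: cg].
move=> /CkS[cf df] /CkS[cg dg]; apply/CkS; split=> [x Ux|v].
  by apply: continuousD; [exact: cf|exact: cg].
have [dfv Dfv] := df v; have [dgv Dgv] := dg v; split=> [x Ux|].
  by apply: derivableD; [exact: dfv|exact: dgv].
apply: eq_Ck oU _ (IHk _ _ Dfv Dgv) => x Ux.
by rewrite -deriveD //; [exact: dfv|exact: dgv].
Qed.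

Lemma Ck_scale k (U : set V) (c : R) f : open U -> Ck k U f ->
  Ck k U (fun x => c *: f x).
Proof.
move=> oU; elim: k f => [|k IHk] f.
  by move=> [cf _]; split=> // x Ux; apply: continuousZl_tmp; exact: cf.
move=> /CkS[cf df]; apply/CkS; split=> [x Ux|v].
  by apply: continuousZl_tmp; exact: cf.
have [dfv Dfv] := df v; split=> [x Ux|].
  by apply: derivableZ; exact: dfv.
apply: eq_Ck oU _ (IHk _ Dfv) => x Ux.
by rewrite -deriveZ //; exact: dfv.
Qed.

Lemma Ck_opp k (U : set V) f : open U -> Ck k U f -> Ck k U (fun x => - f x).
Proof.
move=> oU /(Ck_scale (-1) oU); apply: eq_Ck => // x _.
by rewrite scaleN1r.
Qed.

Lemma Ck_sub k (U : set V) f g : open U -> Ck k U f -> Ck k U g ->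
  Ck k U (fun x => f x - g x).
Proof. by move=> oU fC gC; apply: Ck_add => //; exact: Ck_opp. Qed.

Lemma Ck_sum k (U : set V) I (r : seq I) (P : pred I) (F : I -> V -> W) :
  open U -> (forall i, P i -> Ck k U (F i)) ->
  Ck k U (fun x => \sum_(i <- r | P i) F i x).
Proof.
move=> oU FC; elim: r => [|i r IHr].
  have -> : (fun x => \sum_(i <- [::] | P i) F i x) = cst 0.
    by apply/funext => x; rewrite big_nil.
  exact: Ck_cst.
have [Pi|nPi] := boolP (P i).
  apply: eq_Ck oU _ (Ck_add oU (FC i Pi) IHr) => x _.
  by rewrite big_cons Pi.
by apply: eq_Ck oU _ IHr => x _; rewrite big_cons (negbTE nPi).
Qed.

End Ck.

Section CkR.
Variables (R : realType) (V : normedModType R).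
Implicit Types (U : set V) (f g : V -> R).

Lemma Ck_mul k U f g : open U -> Ck k U f -> Ck k U g ->
  Ck k U (fun x => f x * g x).
Proof.
move=> oU; elim: k f g => [|k IHk] f g.
  by move=> [cf _] [cg _]; split=> // x Ux; apply: continuousM; [exact: cf|exact: cg].
move=> fC gC; have fC' := CkSW fC; have gC' := CkSW gC.
move: fC gC => /CkS[cf df] /CkS[cg dg]; apply/CkS; split=> [x Ux|v].
  by apply: continuousM; [exact: cf|exact: cg].
have [dfv Dfv] := df v; have [dgv Dgv] := dg v; split=> [x Ux|].
  by apply: derivableM; [exact: dfv|exact: dgv].
apply: eq_Ck oU _ (Ck_add oU (IHk _ _ fC' Dgv) (IHk _ _ gC' Dfv)) => x Ux.
by rewrite (_ : (fun _ => _) = f * g) // deriveM //; [exact: dfv|exact: dgv].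
Qed.

Lemma Ck_prod k U I (r : seq I) (P : pred I) (F : I -> V -> R) :
  open U -> (forall i, P i -> Ck k U (F i)) ->
  Ck k U (fun x => \prod_(i <- r | P i) F i x).
Proof.
move=> oU FC; elim: r => [|i r IHr].
  have -> : (fun x => \prod_(i <- [::] | P i) F i x) = cst 1.
    by apply/funext => x; rewrite big_nil.
  exact: Ck_cst.
have [Pi|nPi] := boolP (P i).
  apply: eq_Ck oU _ (Ck_mul oU (FC i Pi) IHr) => x _.
  by rewrite big_cons Pi.
by apply: eq_Ck oU _ IHr => x _; rewrite big_cons (negbTE nPi).
Qed.

Lemma Ck_inv k U f : open U -> (forall x, U x -> f x != 0) -> Ck k U f ->
  Ck k U (fun x => (f x)^-1).
Proof.
move=> oU f0; elim: k => [|k IHk].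
  by move=> [cf _]; split=> // x Ux; apply: continuousV; [exact: f0|exact: cf].
move=> fC; have fC' := IHk (CkSW fC); move: fC => /CkS[cf df].
apply/CkS; split=> [x Ux|v].
  by apply: continuousV; [exact: f0|exact: cf].
have [dfv Dfv] := df v; split=> [x Ux|].
  by apply: derivableV; [exact: f0|exact: dfv].
apply: eq_Ck oU _ (Ck_opp oU (Ck_mul oU (Ck_mul oU fC' fC') Dfv)) => x Ux.
rewrite deriveV; [|exact: f0|exact: dfv].
by rewrite scaleNr -exprVn expr2.
Qed.

End CkR.

Section Ck_linear.
Variables (R : realType) (V W : normedModType R).

Lemma is_derive_linear (f : {linear V -> W}) x v : continuous f ->
  is_derive x v f (f v).
Proof.
move=> cf; have df : differentiable f x by exact: linear_differentiable.
split; first exact: diff_derivable.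
by rewrite deriveE // diff_lin.
Qed.

Lemma Ck_linear k U (f : {linear V -> W}) : continuous f -> Ck k U f.
Proof.
move=> cf; case: k => [|k]; first by split=> // x _; exact: cf.
apply/CkS; split=> [x _|v]; first exact: cf.
split=> [x _|]; first by have [] := is_derive_linear x v cf.
rewrite (_ : 'D_v f = cst (f v)); first exact: Ck_cst.
by apply/funext => x; have [] := is_derive_linear x v cf.
Qed.

End Ck_linear.

Lemma Ck_id (R : realType) (V : normedModType R) k (U : set V) : Ck k U id.
Proof. by apply: (@Ck_linear R V V k U idfun) => x; exact: cvg_id. Qed.

Section Ck_matrix.
Variables (R : realType) (V : normedModType R) (m n : nat).
Implicit Types (f : V -> 'M[R]_(m, n)).

Lemma continuous_mxP f x :
  {for x, continuous f} <-> forall i j, {for x, continuous (fun y => f y i j)}.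
Proof.
split=> [cf i j|cf].
  apply: (continuous_comp cf (g := fun M : 'M[R]_(m, n) => M i j : R)).
  exact: coord_continuous.
apply/cvgrPdist_le => e e0; near=> y.
rewrite /Num.Def.normr/= mx_normrE (bigmax_le _ (ltW e0))//= => -[i j] _.
rewrite !mxE /=.
move: i j; near: y.
have : \forall y \near x, forall ij : 'I_m * 'I_n, `|f x ij.1 ij.2 - f y ij.1 ij.2| <= e.
  apply: filter_forall => -[i j] /=.
  exact: ((cvgrPdist_le _ _).1 (cf i j) e e0).
by apply: filterS => y H i j; exact: (H (i, j)).
Unshelve. all: by end_near. Qed.

Lemma derive_coord f x v i j : derivable f x v ->
  'D_v (fun y => f y i j) x = 'D_v f x i j.
Proof. by move=> df; rewrite derive_mx // mxE. Qed.

Lemma Ck_mxP k U f : open U ->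
  Ck k U f <-> forall i j, Ck k U (fun x => f x i j).
Proof.
move=> oU; elim: k f => [|k IHk] f.
  split=> [[cf _] i j|H].
    by split=> // x Ux; exact: (proj1 (continuous_mxP _ _) (cf x Ux) i j).
  by split=> // x Ux; apply/continuous_mxP => i j; exact: (Ck_continuous (H i j)).
split=> [/CkS[cf df] i j|H].
  apply/CkS; split=> [x Ux|v]; first by exact: (proj1 (continuous_mxP _ _) (cf x Ux) i j).
  have [dv /IHk /(_ i j) Dv] := df v; split=> [x Ux|].
    by exact: (proj1 (derivable_mxP _ _ _) (dv x Ux) i j).
  by apply: eq_Ck oU _ Dv => x Ux; rewrite derive_coord //; exact: dv.
apply/CkS; split=> [x Ux|v].
  by apply/continuous_mxP => i j; exact: (Ck_continuous (H i j)).
have dv x : U x -> derivable f x v.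
  move=> Ux; apply/derivable_mxP => i j.
  by have /CkS[_ /(_ v) [+ _]] := H i j; apply.
split=> //; apply/IHk => i j.
have /CkS[_ /(_ v) [_ Dv]] := H i j.
by apply: eq_Ck oU _ Dv => x Ux; rewrite derive_coord //; exact: dv.
Qed.

End Ck_matrix.

(** * Directional derivatives, Frechet derivatives and the chain rule *)

Section directional.
Variables (R : realType) (V W : normedModType R).

Lemma is_derive_line (f : V -> W) (x v : V) (t : R) :
  derivable f (x + t *: v) v ->
  is_derive t 1 (fun s : R => f (x + s *: v)) ('D_v f (x + t *: v)).
Proof.
rewrite /derivable /derive => df.
have E : (fun h : R => h^-1 *: (((fun s : R => f (x + s *: v)) \o shift t) (h *: (1:R)) -
    f (x + t *: v))) =
  (fun h => h^-1 *: ((f \o shift (x + t *: v)) (h *: v) - f (x + t *: v))).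
  apply/funext => h /=.
  congr (_ *: (f _ - _)).
  by rewrite [_ *: 1]mulr1 scalerDl addrCA.
by split; rewrite /derivable /derive E.
Qed.

(** Homogeneity in the direction needs no differentiability of [f]: it is the one-variable chain
    rule for [s |-> s * c] followed by [f] on the line through [x]. *)
Lemma is_derive_scaledir (f : V -> W) (x v : V) (c : R) :
  derivable f x v -> is_derive x (c *: v) f (c *: 'D_v f x).
Proof.
have [->|c0] := eqVneq c 0; first by move=> _; rewrite !scale0r; exact: is_derive0.
move=> df.
have df0 : is_derive (0 : R) 1 (fun s : R => f (x + s *: v)) ('D_v f x).
  have := @is_derive_line f x v 0; rewrite scale0r addr0; exact.
have dg : differentiable (fun s : R => f (x + s *: v)) 0.
  by apply/derivable1_diffP; case: df0.
have dm : differentiable (fun s : R => s * c) 0.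
  by apply/derivable1_diffP; apply: derivableM.
have dgm : differentiable ((fun s : R => f (x + s *: v)) \o (fun s : R => s * c)) 0.
  by apply: differentiable_comp => //; rewrite mul0r.
have cE : ((fun s : R => f (x + s *: v)) \o (fun s : R => s * c)) =
  (fun h : R => f (h *: (c *: v) + x)).
  by apply/funext => s /=; rewrite scalerA addrC.
have dfc : derivable f x (c *: v).
  by apply/derivable1P; rewrite -cE; exact/derivable1_diffP.
split=> //.
have <- : 'D_1 (fun s : R => f (x + s *: (c *: v))) 0 = 'D_(c *: v) f x.
  have := @is_derive_line f x (c *: v) 0; rewrite scale0r addr0 => /(_ dfc).
  by case.
have -> : (fun s : R => f (x + s *: (c *: v))) =
  ((fun s : R => f (x + s *: v)) \o (fun s : R => s * c)).
  by apply/funext => s /=; rewrite scalerA.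
rewrite deriveE // diff_comp //; last by rewrite mul0r.
have D1 : 'd (fun s : R => s * c) (0 : R) (1 : R) = c.
  have H : is_derive (0 : R) 1 (fun s : R => s * c) c.
    by apply: is_derive_eq; rewrite scaler0 add0r [_ *: _]mulr1.
  by rewrite -deriveE // derive_val.
rewrite /= mul0r D1.
set G := fun s : R => f (x + s *: v).
transitivity ('d G 0 (c *: (1 : R^o))); first by rewrite [c *: _]mulr1.
by rewrite linearZ /= -deriveE //; case: df0 => _ ->.
Qed.

Lemma nbhs_normE (A : set V) x :
  nbhs x A <-> exists2 d, 0 < d & forall y, `|y - x| < d -> A y.
Proof.
split=> [/nbhs_ballP[d /= d0 H]|[d d0 H]].
  by exists d => // y yx; apply: H; rewrite -ball_normE /= distrC.
by apply/nbhs_ballP; exists d => //= y; rewrite -ball_normE /= distrC; exact: H.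
Qed.

Lemma open_norm (U : set V) x : open U -> U x ->
  exists2 d, 0 < d & forall y, `|y - x| < d -> U y.
Proof. by move=> oU Ux; apply/nbhs_normE; exact: open_nbhs_nbhs. Qed.

Lemma continuous_norm (I : finType) (f : I -> V -> W) x :
  (forall i, {for x, continuous (f i)}) -> forall e, 0 < e ->
  exists2 d, 0 < d & forall y, `|y - x| < d -> forall i, `|f i y - f i x| <= e.
Proof.
move=> cf e e0; apply/nbhs_normE; apply: filter_forall => i.
near=> y; rewrite distrC; near: y.
exact: ((cvgrPdist_le _ _).1 (cf i) _ e0).
Unshelve. all: by end_near. Qed.

(** The epsilon-delta criterion through which all Frechet derivatives below are obtained: of C^1
    maps, of the local inverse, and of integrals with a parameter. *)
Lemma is_diff_approx (f : V -> W) (df : {linear V -> W}) x :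
  continuous df ->
  (forall e, 0 < e -> exists2 d, 0 < d & forall h, `|h| < d ->
    `|f (x + h) - f x - df h| <= e * `|h|) ->
  differentiable f x /\ 'd f x = df :> (V -> W).
Proof.
move=> dfc H.
suff dE : f \o shift x = cst (f x) + df +o_ 0 id.
  split; last exact: diff_unique dE.
  by apply/diff_locallyP; rewrite (diff_unique dfc dE).
apply/eqaddoP => e e0; apply/nbhs_normE; have [d d0 Hd] := H e e0.
exists d => // h; rewrite subr0 => /Hd; rewrite [x + h]addrC.
by rewrite -![(_ + _ : _ -> _) _]/(_ + _) -![(- _ : _ -> _) _]/(- _) /= opprD addrA.
Qed.

End directional.

Section C1.
Variables (R : realType) (m : nat).

Lemma rV_coord_norm (x : 'rV[R]_m) i : `|x 0 i| <= `|x|.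
Proof.
rewrite [leRHS]/Num.Def.normr/= mx_normrE.
exact: (le_bigmax _ (fun ij : 'I_1 * 'I_m => `|x ij.1 ij.2|) (0, i)).
Qed.

Lemma rV_norm_le (x : 'rV[R]_m) (e : R) : 0 <= e ->
  (forall i, `|x 0 i| <= e) -> `|x| <= e.
Proof.
move=> e0 H; rewrite [leLHS]/Num.Def.normr/= mx_normrE bigmax_le //= => -[i j] _ /=.
by rewrite ord1.
Qed.

(** Continuous partial derivatives give a Frechet derivative: [x] is joined to [x + h] by a polygon
    with one edge per coordinate, and the mean value theorem is applied on each edge. *)
Lemma C1_differentiable (U : set 'rV[R]_m) (f : 'rV[R]_m -> R) x :
  open U -> U x -> Ck 1 U f -> differentiable f x.
Proof.
move=> oU Ux /CkS[cf Df].
pose D i := 'D_(std_basis R i) f.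
pose dfx (h : 'rV[R]_m) : R^o := \sum_i h 0 i * D i x.
have lin : linear dfx.
  move=> a u v; rewrite /dfx /= scaler_sumr -big_split /=; apply: eq_bigr => i _.
  by rewrite !mxE mulrDl -mulrA.
pose dfM := GRing.isLinear.Build _ _ _ _ _ lin.
pose dfL : {linear 'rV[R]_m -> R^o} := HB.pack dfx dfM.
have dfc : continuous dfL.
  move=> h; suff: Ck 0 setT (fun h : 'rV[R]_m => \sum_i h 0 i * D i x).
    by case=> /(_ h Logic.I).
  have oT := @openT 'rV[R]_m.
  apply: Ck_sum => // i _; apply: Ck_mul => //; last exact: Ck_cst.
  by move/(Ck_mxP _ _ oT): (@Ck_id R 'rV[R]_m 0 setT); apply.
suff [] : differentiable f x /\ 'd f x = dfL :> (_ -> _) by [].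
apply: (is_diff_approx dfc) => _/posnumP[e] /=.
(* Each of the [m] edges may contribute this much; the successor covers [m = 0]. *)
have m1 : 0 < e%:num / m.+1%:R by rewrite divr_gt0.
have [d1 d10 H1] := open_norm oU Ux.
have [d2 d20 H2] : exists2 d, 0 < d &
    forall y, `|y - x| < d -> forall i, `|D i y - D i x| <= e%:num / m.+1%:R.
  apply: continuous_norm => // i.
  by have [_ [cD _]] := Df (std_basis R i); exact: cD.
pose d := Num.min d1 d2.
have Hd' y : `|y - x| < d -> U y /\ forall i, `|D i y - D i x| <= e%:num / m.+1%:R.
  by rewrite lt_min => /andP[/H1 ? /H2].
exists d => [|h hd]; first by rewrite lt_min d10.
(* The vertices of the polygon: [hk k] keeps the first [k] coordinates of [h]. In the maximum norm,
   all points of its edges stay within [|h|] of [x]. *)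
pose hk k := \row_j (if (j < k)%N then h 0 j else 0) : 'rV[R]_m.
have bnd k (t : R) (j : 'I_m) : 0 <= t <= 1 -> k = j :> nat ->
    `|hk k + (t * h 0 j) *: std_basis R j| < d.
  move=> t01 kj; apply: le_lt_trans hd; apply: rV_norm_le => // i.
  rewrite !mxE eqxx /= kj; have [ij|ij|ij] := ltngtP i j.
  - rewrite -(inj_eq val_inj) /= ltn_eqF // mulr0 addr0; exact: rV_coord_norm.
  - by rewrite -(inj_eq val_inj) /= gtn_eqF // mulr0 addr0 normr0.
  - have -> : i = j by exact: val_inj.
    rewrite eqxx mulr1 add0r normrM.
    have /andP[t0 t1] := t01; rewrite (ger0_norm t0).
    apply: le_trans (rV_coord_norm h j); exact: ler_piMl.
have step k : (k <= m)%N ->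
    `|f (x + hk k) - f x - \sum_(i < m | (i < k)%N) h 0 i * D i x| <=
    k%:R * (e%:num / m.+1%:R * `|h|).
  elim: k => [_|k IHk km].
    rewrite (_ : hk 0%N = 0); last by apply/rowP => j; rewrite !mxE.
    by rewrite addr0 subrr big_pred0 // subrr normr0 mul0r.
  pose j := Ordinal km.
  have hkS : hk k.+1 = hk k + h 0 j *: std_basis R j.
    apply/rowP => i; rewrite !mxE eqxx /= ltnS.
    have [ij|ij|ij] := ltngtP i k.
    - by rewrite -(inj_eq val_inj) /= ltn_eqF // mulr0 addr0.
    - by rewrite -(inj_eq val_inj) /= gtn_eqF // mulr0 addr0.
    - have -> : i = j by exact: val_inj.
      by rewrite eqxx mulr1 add0r.
  have isd (t : R) : 0 <= t <= 1 ->
     is_derive t 1 (fun s : R => f (x + hk k + s *: (h 0 j *: std_basis R j)))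
      (h 0 j * D j (x + hk k + (t * h 0 j) *: std_basis R j)).
    move=> t01.
    have [Uy _] := Hd' (x + hk k + (t * h 0 j) *: std_basis R j) ltac:(
      by rewrite addrAC (addrC x) addrK; exact: bnd).
    have [dj _] := Df (std_basis R j).
    have [dh1 dh2] := is_derive_scaledir (h 0 j) (dj _ Uy).
    apply: is_derive_eq; first by apply: is_derive_line; rewrite scalerA.
    by rewrite scalerA dh2.
  have [t t01 E] : exists2 t : R, 0 <= t <= 1 & f (x + hk k.+1) - f (x + hk k) =
     h 0 j * D j (x + hk k + (t * h 0 j) *: std_basis R j).
    have [||t tin] := @MVT_segment R
      (fun s : R => f (x + hk k + s *: (h 0 j *: std_basis R j)))
      (fun t => h 0 j * D j (x + hk k + (t * h 0 j) *: std_basis R j)) 0 1 ler01.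
    - by move=> t; rewrite in_itv /= => /andP[t0 t1]; apply: isd; rewrite !ltW.
    - apply: derivable_within_continuous => t; rewrite in_itv /= => t01.
      by have [] := isd t t01.
    move=> E; exists t; first by move: tin; rewrite in_itv.
    by move: E; rewrite scale1r scale0r addr0 subr0 mulr1 hkS addrA.
  have [_ /(_ j) De] := Hd' (x + hk k + (t * h 0 j) *: std_basis R j) ltac:(
      by rewrite addrAC (addrC x) addrK; exact: bnd).
  have -> : \sum_(i < m | (i < k.+1)%N) h 0 i * D i x =
     h 0 j * D j x + \sum_(i < m | (i < k)%N) h 0 i * D i x.
    rewrite (bigD1 j) /=; last by rewrite ltnS.
    congr (_ + _); apply: eq_bigl => i.
    rewrite ltnS -(inj_eq val_inj) /= ltn_neqAle andbC //.
  set y := x + hk k + _ in E De.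
  have -> : f (x + hk k.+1) - f x - (h 0 j * D j x + \sum_(i < m | (i < k)%N) h 0 i * D i x)
    = (f (x + hk k) - f x - \sum_(i < m | (i < k)%N) h 0 i * D i x) + h 0 j * (D j y - D j x).
    by rewrite mulrBr -E; ring.
  apply: (le_trans (ler_normD _ _)).
  rewrite -[k.+1]addn1 natrD mulrDl lerD ?IHk ?(ltnW km)// mul1r normrM mulrC.
  by apply: ler_pM => //; exact: rV_coord_norm.
have := step m (leqnn m).
have -> : hk m = h by apply/rowP => i; rewrite !mxE ltn_ord.
rewrite (eq_bigl predT) => [H|i]; last by rewrite ltn_ord.
apply: le_trans H _.
rewrite mulrA ler_wpM2r // mulrCA -[leRHS]mulr1 ler_pM2l //.
by rewrite ler_pdivrMr // mul1r ler_nat.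
Qed.

Lemma deriveE_sum (f : 'rV[R]_m -> R) (x v : 'rV[R]_m) : differentiable f x ->
  'D_v f x = \sum_i v 0 i * 'D_(std_basis R i) f x.
Proof.
move=> df; rewrite deriveE // {1}(row_sum_delta v) linear_sum.
by apply: eq_bigr => i _; rewrite linearZ /= deriveE.
Qed.

End C1.

Section chain.
Variables (R : realType) (V V' W : normedModType R).

(** The inner map is only differentiated along [v], so it suffices to restrict it to the line
    through [x] in that direction; the outer map has to be Frechet differentiable. *)
Lemma is_derive_comp (f : V' -> W) (g : V -> V') x v :
  derivable g x v -> differentiable f (g x) ->
  is_derive x v (f \o g) ('D_('D_v g x) f (g x)).
Proof.
move=> dg df.
have dg0 : is_derive (0 : R) 1 (fun s : R => g (x + s *: v)) ('D_v g x).
  have := @is_derive_line _ _ _ g x v 0; rewrite scale0r addr0; exact.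
have dg1 : differentiable (fun s : R => g (x + s *: v)) 0.
  by apply/derivable1_diffP; case: dg0.
have dfg : differentiable (f \o (fun s : R => g (x + s *: v))) 0.
  by apply: differentiable_comp => //=; rewrite scale0r addr0.
have dfgx : derivable (f \o g) x v.
  apply/derivable1P.
  rewrite (_ : (fun h : R => _) = f \o (fun s : R => g (x + s *: v))); last first.
    by apply/funext => s /=; rewrite addrC.
  exact/derivable1_diffP.
split=> //.
have := @is_derive_line _ _ _ (f \o g) x v 0; rewrite scale0r addr0 => /(_ dfgx).
move=> /@derive_val <-.
rewrite (_ : (fun s : R => (f \o g) _) = f \o (fun s : R => g (x + s *: v))) //.
rewrite deriveE // diff_comp //=; last by rewrite scale0r addr0.
rewrite scale0r addr0 [RHS]deriveE //; congr ('d f (g x) _).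
by rewrite -deriveE //; rewrite derive_val.
Qed.

End chain.

Section Ck_comp.
Variables (R : realType) (V : normedModType R) (m : nat).

(** The intermediate space is finite dimensional, so the chain rule expands into products of
    components of ['D_v g] with partial derivatives of [f] composed with [g], to which induction
    applies. *)
Lemma Ck_comp k (U : set V) (U' : set 'rV[R]_m) (f : 'rV[R]_m -> R)
    (g : V -> 'rV[R]_m) :
  open U -> open U' -> (forall x, U x -> U' (g x)) ->
  Ck k U' f -> Ck k U g -> Ck k U (f \o g).
Proof.
move=> oU oU' gU; elim: k f => [|k IHk] f.
  move=> [cf _] [cg _]; split=> // x Ux.
  by apply: continuous_comp; [exact: cg|exact/cf/gU].
move=> fC gC; have gC' := CkSW gC.
have f1 : Ck 1 U' f by apply: Ck_leq fC.
move: fC gC => /CkS[cf df] /CkS[cg dg]; apply/CkS; split=> [x Ux|v].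
  by apply: continuous_comp; [exact: cg|exact/cf/gU].
have dfg x : U x -> is_derive x v (f \o g) ('D_('D_v g x) f (g x)).
  move=> Ux; apply: is_derive_comp; first by have [+ _] := dg v; apply.
  exact: C1_differentiable (gU _ Ux) f1.
split=> [x /dfg[]//|].
apply: (@eq_Ck _ _ _ _ _ (fun x => \sum_i 'D_v g x 0 i * 'D_(std_basis R i) f (g x))) => //.
  move=> x Ux; have [_ ->] := dfg x Ux.
  by rewrite -deriveE_sum //; exact: C1_differentiable (gU _ Ux) f1.
apply: Ck_sum => // i _; apply: Ck_mul => //.
  have [_ gv] := dg v.
  by move/(Ck_mxP _ _ oU): gv; apply.
exact: (IHk _ (proj2 (df (std_basis R i))) gC').
Qed.

Lemma Ck_comp_mx k p q (U : set V) (U' : set 'rV[R]_m)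
    (f : 'rV[R]_m -> 'M[R]_(p, q)) (g : V -> 'rV[R]_m) :
  open U -> open U' -> (forall x, U x -> U' (g x)) ->
  Ck k U' f -> Ck k U g -> Ck k U (f \o g).
Proof.
move=> oU oU' gU /(Ck_mxP _ _ oU') fC gC; apply/(Ck_mxP _ _ oU) => i j.
exact: (Ck_comp oU oU' gU (fC i j) gC).
Qed.

End Ck_comp.

(** * Symmetry of second derivatives *)

Section second_derivatives.
Variables (R : realType) (V : normedModType R).
Implicit Types (f : V -> R) (x u v : V).

Lemma is_derive_translate (W : normedModType R) (f : V -> W) x v c :
  derivable f (x + c) v -> is_derive x v (fun y => f (y + c)) ('D_v f (x + c)).
Proof.
have E : (fun h : R => h^-1 *: (((fun y => f (y + c)) \o shift x) (h *: v) - f (x + c)))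
   = (fun h => h^-1 *: ((f \o shift (x + c)) (h *: v) - f (x + c))).
  by apply/funext => h /=; rewrite addrA.
by rewrite /derivable /derive => df; split; rewrite /derivable /derive E.
Qed.

Lemma is_derive_bigsum (W : normedModType R) I (r : seq I) (P : pred I)
    (F : I -> V -> W) x v :
  (forall i, P i -> derivable (F i) x v) ->
  is_derive x v (fun y => \sum_(i <- r | P i) F i y)
    (\sum_(i <- r | P i) 'D_v (F i) x).
Proof.
move=> dF; elim: r => [|i r IHr].
  rewrite big_nil (_ : (fun _ => _) = cst 0); first exact: is_derive_cst.
  by apply/funext => y; rewrite big_nil.
rewrite big_cons; case: ifPn => [Pi|nPi].
  rewrite (_ : (fun _ => _) = F i + (fun y => \sum_(i <- r | P i) F i y)).
    by apply: is_deriveD; apply: derivableP; exact: dF.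
  by apply/funext => y; rewrite big_cons Pi.
rewrite (_ : (fun _ => _) = (fun y => \sum_(i <- r | P i) F i y)) //.
by apply/funext => y; rewrite big_cons (negbTE nPi).
Qed.

Lemma MVT_line f x v (h : R) : 0 < h ->
  (forall t, 0 <= t <= h -> derivable f (x + t *: v) v) ->
  exists2 t, 0 <= t <= h & f (x + h *: v) - f x = h * 'D_v f (x + t *: v).
Proof.
move=> h0 df.
have isd t : 0 <= t <= h -> is_derive t 1 (fun s => f (x + s *: v)) ('D_v f (x + t *: v)).
  by move=> /df; exact: is_derive_line.
have [||t] := @MVT_segment R (fun s : R => f (x + s *: v))
    (fun t => 'D_v f (x + t *: v)) 0 h (ltW h0).
- by move=> t; rewrite in_itv /= => /andP[t0 t1]; apply: isd; rewrite !ltW.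
- apply: derivable_within_continuous => t; rewrite in_itv /= => t01.
  by have [] := isd t t01.
rewrite in_itv /= subr0 scale0r addr0 mulrC => t01 E.
by exists t.
Qed.

(** The mean value theorem is used twice, first along [u] for [F y = f (y + h *: v) - f y], then
    along [v] for ['D_u f]. *)
Lemma second_difference f x u v (U : set V) (h : R) : 0 < h -> Ck 2 U f ->
  (forall s t, 0 <= s <= h -> 0 <= t <= h -> U (x + s *: u + t *: v)) ->
  exists s t, [/\ 0 <= s <= h, 0 <= t <= h &
   f (x + h *: u + h *: v) - f (x + h *: u) - (f (x + h *: v) - f x) =
   h * (h * 'D_v ('D_u f) (x + s *: u + t *: v))].
Proof.
move=> h0 /CkS[_ Df] HU.
have hh : 0 <= h <= h by rewrite lexx ltW.
have h00 : 0 <= (0 : R) <= h by rewrite lexx ltW.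
have [du /CkS[_ /(_ v)[duv _]]] := Df u.
pose F y := f (y + h *: v) - f y.
have isF t : 0 <= t <= h -> is_derive (x + t *: u) u F
    ('D_u f (x + t *: u + h *: v) - 'D_u f (x + t *: u)).
  move=> th; apply: is_deriveB.
    by apply: is_derive_translate; apply: du; exact: HU.
  by apply: derivableP; apply: du; have := HU t 0 th h00; rewrite scale0r addr0.
have [s sh Es] : exists2 t, 0 <= t <= h & F (x + h *: u) - F x = h * 'D_u F (x + t *: u).
  apply: (@MVT_line F x u h h0) => t th; have [dF _] := isF t th; exact: dF.
have [t th Et] : exists2 t, 0 <= t <= h &
   'D_u f (x + s *: u + h *: v) - 'D_u f (x + s *: u) =
     h * 'D_v ('D_u f) (x + s *: u + t *: v).
  by apply: (@MVT_line ('D_u f) (x + s *: u) v h h0) => t th; apply: duv; exact: HU.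
exists s, t; split=> //.
by rewrite -Et; have [_ <-] := isF s sh; rewrite -Es /F addrAC.
Qed.

(** The second difference is symmetric in [u] and [v], so it equals [h * h] times each mixed
    derivative at some point of a small parallelogram; continuity at [x] concludes. *)
Lemma derive_comm (U : set V) f x u v : open U -> U x -> Ck 2 U f ->
  'D_v ('D_u f) x = 'D_u ('D_v f) x.
Proof.
move=> oU Ux fC; apply/eqP; rewrite -subr_eq0; apply/eqP/normr0_eq0/eqP.
rewrite eq_le normr_ge0 andbT; apply/ler_addgt0Pl => e e0; rewrite addr0.
have e2 : 0 < e / 2 by rewrite divr_gt0.
have [_ D] := (CkS _ _ _).1 fC.
have [d1 d10 H1] := open_norm oU Ux.
have cuv (w w' : V) : exists2 d, 0 < d &
    forall y, `|y - x| < d -> `|'D_w ('D_w' f) y - 'D_w ('D_w' f) x| <= e / 2.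
  have [|d d0 Hd] := @continuous_norm R V R 'I_1 (fun=> 'D_w ('D_w' f)) x _ _ e2.
    by move=> _; have [_ /CkS[_ /(_ w)[_ [+ _]]]] := D w'; apply.
  by exists d => // y /Hd /(_ ord0).
have [d2 d20 H2] := cuv v u; have [d3 d30 H3] := cuv u v.
pose d := Num.min d1 (Num.min d2 d3).
have d0 : 0 < d by rewrite !lt_min d10 d20.
have dd1 : d <= d1 by rewrite ge_min lexx.
have dd2 : d <= d2 by rewrite !ge_min lexx orbT.
have dd3 : d <= d3 by rewrite !ge_min lexx !orbT.
(* With [h = d / c] the parallelogram lies within [d] of [x]; adding 1 keeps [c] positive when both
   vectors vanish. *)
pose c := `|u| + `|v| + 1; have c0 : 0 < c by rewrite ltr_wpDl ?addr_ge0.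
pose h := d / c; have h0 : 0 < h by rewrite divr_gt0.
have Hh s t : 0 <= s <= h -> 0 <= t <= h -> `|x + s *: u + t *: v - x| < d.
  move=> /andP[s0 sh] /andP[t0 th].
  rewrite -[x + _ + _]addrA [x + _]addrC addrK; apply: le_lt_trans (ler_normD _ _) _.
  rewrite !normrZ !ger0_norm //.
  apply: (@le_lt_trans _ _ (h * (`|u| + `|v|))).
    by rewrite mulrDr lerD // ler_wpM2r.
  by rewrite /h mulrAC ltr_pdivrMr // ltr_pM2l // ltrDl.
have [s [t [sh th E1]]] := @second_difference f x u v U h h0 fC (fun s t sh th =>
   H1 _ (lt_le_trans (Hh s t sh th) dd1)).
have Hh' s' t' : 0 <= s' <= h -> 0 <= t' <= h -> `|x + s' *: v + t' *: u - x| < d.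
  by move=> ? ?; rewrite [x + _ + _]addrAC; exact: Hh.
have [s' [t' [sh' th' E2]]] := @second_difference f x v u U h h0 fC (fun s t sh th =>
   H1 _ (lt_le_trans (Hh' s t sh th) dd1)).
have E : 'D_v ('D_u f) (x + s *: u + t *: v) = 'D_u ('D_v f) (x + s' *: v + t' *: u).
  apply: (mulfI (lt0r_neq0 h0)); apply: (mulfI (lt0r_neq0 h0)).
  have key (p q r z k l : R) : p - q - (r - z) = k -> p - r - (q - z) = l -> k = l.
    by move=> <- <-; ring.
  apply: (key _ _ _ _ _ _ E1); rewrite -[RHS]E2.
  by congr (f _ - _ - _); rewrite addrAC.
have L2 := H2 _ (lt_le_trans (Hh _ _ sh th) dd2).
have L3 := H3 _ (lt_le_trans (Hh' _ _ sh' th') dd3).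
rewrite (splitr e); set a := 'D_v _ x; set b := 'D_u _ x.
have -> : a - b = ('D_u ('D_v f) (x + s' *: v + t' *: u) - b) -
   ('D_v ('D_u f) (x + s *: u + t *: v) - a).
  have aux (p q r : R) : p - q = (r - q) - (r - p) by ring.
  rewrite E; exact: aux.
apply: (le_trans (ler_normB _ _)); exact: lerD L3 L2.
Qed.

End second_derivatives.

(** * The inverse function theorem *)

Lemma ball_convex (R : realType) (V : normedModType R) (x y z : V) (d t : R) :
  0 <= t <= 1 -> `|y - x| < d -> `|z - x| < d -> `|y + t *: (z - y) - x| < d.
Proof.
move=> /andP[t0 t1] yd zd.
have -> : y + t *: (z - y) - x = (1 - t) *: (y - x) + t *: (z - x).
  rewrite scalerBl scale1r -[RHS]addrA [- _ + _]addrC -scalerBr opprB addrA subrK.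
  by rewrite addrAC.
apply: (le_lt_trans (ler_normD _ _)); rewrite !normrZ.
rewrite (ger0_norm t0) ger0_norm ?subr_ge0 //.
have [->|tn0] := eqVneq t 0; first by rewrite subr0 mul1r mul0r addr0.
have tp : 0 < t by rewrite lt_neqAle eq_sym tn0.
rewrite -[ltRHS]mul1r -[in ltRHS](subrK t 1) [ltRHS]mulrDl.
apply: ler_ltD; last by rewrite ltr_pM2l.
by rewrite ler_wpM2l ?subr_ge0 // ltW.
Qed.

Section jacobian.
Variables (R : realType) (m p : nat).

(** The transpose of the usual Jacobian: vectors are rows, and the differential is
    [v |-> v *m jac F x]. *)
Definition jac (F : 'rV[R]_m -> 'rV[R]_p) (x : 'rV[R]_m) : 'M[R]_(m, p) :=
  \matrix_(i, j) 'D_(std_basis R i) (fun y => F y 0 j) x.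

Lemma MVT_rV (f : 'rV[R]_m -> R) (U : set 'rV[R]_m) y z : open U -> Ck 1 U f ->
  (forall t, 0 <= t <= 1 -> U (y + t *: (z - y))) ->
  exists2 t, 0 <= t <= 1 & f z - f y =
    \sum_i (z - y) 0 i * 'D_(std_basis R i) f (y + t *: (z - y)).
Proof.
move=> oU fC HU; have [_ /(_ (z - y)) [df _]] := (CkS _ _ _).1 fC.
have [t t01 E] : exists2 t, 0 <= t <= 1 & f (y + 1 *: (z - y)) - f y =
    1 * 'D_(z - y) f (y + t *: (z - y)).
  by apply: (@MVT_line R _ f y (z - y) 1 ltr01) => t /HU; exact: df.
exists t => //; rewrite -deriveE_sum; last exact: C1_differentiable (HU t t01) fC.
by move: E; rewrite mul1r scale1r [y + (z - y)]addrC subrK.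
Qed.

(** The estimate is uniform in both points near [x]. This makes [id - F A] a contraction in the
    inverse function theorem. *)
Lemma strict_diff (F : 'rV[R]_m -> 'rV[R]_p) (U : set 'rV[R]_m) x e :
  open U -> U x -> Ck 1 U F -> 0 < e ->
  exists2 d, 0 < d & forall y z, `|y - x| < d -> `|z - x| < d ->
    `|F z - F y - (z - y) *m jac F x| <= e * `|z - y|.
Proof.
move=> oU Ux FC e0.
have FjC j : Ck 1 U (fun y => F y 0 j) by move/(Ck_mxP _ _ oU): FC; apply.
pose D (ij : 'I_m * 'I_p) := 'D_(std_basis R ij.1) (fun y => F y 0 ij.2).
have m1 : 0 < e / m.+1%:R by rewrite divr_gt0.
have [d1 d10 H1] := open_norm oU Ux.
have [d2 d20 H2] : exists2 d, 0 < d &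
    forall y, `|y - x| < d -> forall ij, `|D ij y - D ij x| <= e / m.+1%:R.
  apply: continuous_norm => // -[i j].
  have [_ /(_ (std_basis R i)) [_ [+ _]]] := (CkS _ _ _).1 (FjC j).
  by apply.
exists (Num.min d1 d2) => [|y z]; first by rewrite lt_min d10.
rewrite !lt_min => /andP[y1 y2] /andP[z1 z2].
apply: rV_norm_le => [|j]; first by rewrite mulr_ge0 // ltW.
have [t t01 E] := MVT_rV oU (FjC j) (fun t t01 => H1 _ (ball_convex t01 y1 z1)).
have De := H2 _ (ball_convex t01 y2 z2).
have -> : (F z - F y - (z - y) *m jac F x) 0 j =
    \sum_i (z - y) 0 i * (D (i, j) (y + t *: (z - y)) - D (i, j) x).
  have aux (a b c : 'rV[R]_p) : (a - b - c) 0 j = a 0 j - b 0 j - c 0 j.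
    by rewrite !mxE.
  rewrite aux E mxE -sumrB; apply: eq_bigr => i _.
  by rewrite mulrBr [jac _ _ _ _]mxE.
apply: (le_trans (ler_norm_sum _ _ _)).
apply: (@le_trans _ _ (\sum_(i < m) e / m.+1%:R * `|z - y|)).
  apply: ler_sum => i _; rewrite normrM [leLHS]mulrC.
  by apply: ler_pM => //; exact: rV_coord_norm.
rewrite sumr_const card_ord -[_ *+ m]mulr_natl mulrA ler_wpM2r //.
rewrite mulrCA -[leRHS]mulr1 ler_pM2l // ler_pdivrMr // mul1r ler_nat //.
Qed.

Lemma mulmx_bound (A : 'M[R]_(m, p)) :
  exists2 K, 0 < K & forall z : 'rV[R]_m, `|z *m A| <= K * `|z|.
Proof.
exists (\sum_j \sum_i `|A i j| + 1).
  by rewrite ltr_wpDl // sumr_ge0 // => j _; rewrite sumr_ge0.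
move=> z; apply: rV_norm_le => [|j].
  by rewrite mulr_ge0 // addr_ge0 // sumr_ge0 // => j _; rewrite sumr_ge0.
rewrite mxE; apply: (le_trans (ler_norm_sum _ _ _)).
apply: (@le_trans _ _ (\sum_i `|A i j| * `|z|)).
  apply: ler_sum => i _; rewrite normrM mulrC ler_wpM2l //.
  exact: rV_coord_norm.
rewrite -mulr_suml ler_wpM2r //.
apply: ler_wpDr => //; rewrite [leRHS](bigD1 j) //=.
apply: ler_wpDr => //; apply: sumr_ge0 => k _; exact: sumr_ge0.
Qed.

Lemma mulmxr_continuous (A : 'M[R]_(m, p)) : continuous (fun z : 'rV[R]_m => z *m A).
Proof.
have oT := @openT 'rV[R]_m.
suff [H _] : Ck 0 setT (fun z : 'rV[R]_m => z *m A) by move=> z; exact: H.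
apply/(Ck_mxP _ _ oT) => i j.
apply: (@eq_Ck _ _ _ _ _ (fun z : 'rV[R]_m => \sum_k z i k * A k j)) => //.
  by move=> z _; rewrite mxE.
apply: Ck_sum => // k _; apply: Ck_mul => //; last exact: Ck_cst.
by move/(Ck_mxP _ _ oT): (@Ck_id R 'rV[R]_m 0 setT); apply.
Qed.

Lemma Ck_mulmxr k U (A : 'M[R]_(m, p)) : Ck k U (fun z : 'rV[R]_m => z *m A).
Proof. exact: (Ck_linear k U (f := mulmxr A) (mulmxr_continuous (A := A))). Qed.

Lemma derive_jac (F : 'rV[R]_m -> 'rV[R]_p) (U : set 'rV[R]_m) x v :
  open U -> U x -> Ck 1 U F -> 'D_v F x = v *m jac F x.
Proof.
move=> oU Ux FC; apply/rowP => j.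
have FjC : Ck 1 U (fun y => F y 0 j) by move/(Ck_mxP _ _ oU): FC; apply.
rewrite -derive_coord; last by have [_ /(_ v) [+ _]] := (CkS _ _ _).1 FC; apply.
rewrite deriveE_sum; last exact: C1_differentiable Ux FjC.
by rewrite !mxE; apply: eq_bigr => i _; rewrite mxE.
Qed.

Lemma C1_differentiable_mx (F : 'rV[R]_m -> 'rV[R]_p) (U : set 'rV[R]_m) x :
  open U -> U x -> Ck 1 U F -> differentiable F x.
Proof.
move=> oU Ux FC.
suff [] : differentiable F x /\ 'd F x = mulmxr (jac F x) :> (_ -> _) by [].
apply: is_diff_approx => [|e e0].
  exact: mulmxr_continuous.
have [d d0 Hd] := strict_diff oU Ux FC e0.
exists d => // h hd; have := Hd x (x + h); rewrite subrr normr0 => /(_ d0).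
by rewrite [x + h - x]addrC addKr; exact.
Qed.

End jacobian.

Section Ck_inverse_matrix.
Variables (R : realType) (V : normedModType R).

Lemma Ck_det k (U : set V) n (A : V -> 'M[R]_n) : open U ->
  (forall i j, Ck k U (fun x => A x i j)) -> Ck k U (fun x => \det (A x)).
Proof.
move=> oU AC.
apply: Ck_sum => // s _; apply: Ck_mul => //; first exact: Ck_cst.
exact: Ck_prod.
Qed.

(** By the adjugate formula, the entries of the inverse are minors, polynomial in the entries of the
    matrix, divided by the determinant. *)
Lemma Ck_invmx k (U : set V) n (A : V -> 'M[R]_n) : open U ->
  (forall x, U x -> A x \in unitmx) ->
  (forall i j, Ck k U (fun x => A x i j)) ->
  forall i j, Ck k U (fun x => invmx (A x) i j).
Proof.
move=> oU Au AC i j.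
apply: (@eq_Ck _ _ _ _ _
   (fun x => (\det (A x))^-1 * ((-1) ^+ (j + i) * \det (row' j (col' i (A x)))))) => //.
  by move=> x Ux; rewrite /invmx Au // !mxE.
apply: Ck_mul => //.
  apply: Ck_inv => //; last exact: Ck_det.
  by move=> x Ux; have := Au x Ux; rewrite unitmxE unitfE.
apply: Ck_mul => //; first exact: Ck_cst.
apply: Ck_det => // a b.
by apply: eq_Ck oU _ (AC (lift j a) (lift i b)) => x _; rewrite !mxE.
Qed.

End Ck_inverse_matrix.

Section inverse_function_theorem.
Variables (R : realType) (m : nat).

Lemma banach_ball (T : 'rV[R]_m -> 'rV[R]_m) (x0 : 'rV[R]_m) (r : R) : 0 < r ->
  (forall x, `|x - x0| <= r -> `|T x - x0| <= r) ->
  (forall x y, `|x - x0| <= r -> `|y - x0| <= r -> `|T x - T y| <= 2^-1 * `|x - y|) ->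
  exists2 x, `|x - x0| <= r & x = T x.
Proof.
move=> r0 Tr Tl.
pose Bc := closed_ball_ (fun x : 'rV[R]_m => `|x|) x0 r.
have BE x : Bc x <-> `|x - x0| <= r by rewrite /Bc /closed_ball_ /= distrC.
have Tfun : isFun _ _ Bc Bc T by constructor => x /BE /Tr /BE.
pose TF : {fun Bc >-> Bc} := HB.pack T Tfun.
have Tc : is_contraction TF.
  have half0 : (0 : R) <= 2^-1 by rewrite invr_ge0.
  exists (NngNum half0); split => /=; first by rewrite invf_lt1 // ltr1n.
  move=> [x y] [/= /BE Bx /BE By]; exact: Tl.
pose X : completeNormedModType R := HB.pack 'rV[R]_m (Complete.on 'rV[R]_m).
have [|x /BE xB xE] := @banach_fixed_point R X Bc TF Tc (@closed_closed_ball_ _ X x0 r).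
  by exists x0; apply/BE; rewrite subrr normr0 ltW.
by exists x.
Qed.

(** The equation [F x = y] is solved as a fixed point of the Newton map with frozen Jacobian,
    [x |-> x - (F x - y) *m A]. Smoothness of the inverse then follows from the formula for its
    derivative. *)
Theorem inverse_function (U : set 'rV[R]_m) (F : 'rV[R]_m -> 'rV[R]_m) (x0 : 'rV[R]_m) :
  open U -> U x0 -> smooth_on U F -> (forall u, 'D_u F x0 = 0 -> u = 0) ->
  exists (r : R) (G : 'rV[R]_m -> 'rV[R]_m),
    [/\ 0 < r, smooth_on (ball (F x0) r) G,
        forall y, ball (F x0) r y -> U (G y) /\ F (G y) = y, G (F x0) = x0
      & \forall x \near x0, ball (F x0) r (F x) /\ G (F x) = x].
Proof.
move=> oU Ux0 /smooth_onP FS inj.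
have FC1 := FS 1%N.
have Jx0u : jac F x0 \in unitmx.
  rewrite -row_free_unit -kermx_eq0; apply/eqP/row_matrixP => i; rewrite row0.
  apply: inj; rewrite (derive_jac _ oU Ux0 FC1).
  by apply/sub_kermxP; exact: row_sub.
pose A := invmx (jac F x0).
have [K K0 HK] := mulmx_bound A.
(* With this precision in [strict_diff], multiplication by [A], which is bounded by [K], leaves the
   contraction factor 1/2. *)
have K2 : 0 < (2 * K)^-1 by rewrite invr_gt0 mulr_gt0.
have JC k i j : Ck k U (fun x => jac F x i j).
  have /CkS[_ /(_ (std_basis R i)) [_ H]] : Ck k.+1 U (fun x => F x 0 j).
    by move/(Ck_mxP _ _ oU): (FS k.+1); apply.
  by apply: eq_Ck oU _ H => x _; rewrite mxE.
have [d1 d10 H1] := open_norm oU Ux0.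
have [d2 d20 H2] := strict_diff oU Ux0 FC1 K2.
have [d3 d30 H3] : exists2 d, 0 < d &
    forall x, `|x - x0| < d -> jac F x \in unitmx.
  apply/nbhs_normE.
  have detC : {for x0, continuous (fun x => \det (jac F x))}.
    by have [+ _] := Ck_det oU (JC 0%N); apply.
  have det0 : \det (jac F x0) != 0 by move: Jx0u; rewrite unitmxE unitfE.
  have N : nbhs (\det (jac F x0)) [set y : R | y != 0].
    by apply: open_nbhs_nbhs; split=> //; exact: open_neq.
  apply: (@filterS _ (nbhs x0) (nbhs_filter x0) _ _ _ (detC _ N)) => x /= dx.
  by rewrite unitmxE unitfE.
pose d := Num.min d1 (Num.min d2 d3); have d0 : 0 < d by rewrite !lt_min d10 d20.
pose U' := ball x0 d.
have oU' : open U' by exact: ball_open.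
have U'E x : U' x <-> `|x - x0| < d by rewrite /U' -ball_normE /= distrC.
have U'U x : U' x -> U x.
  by move/U'E => xd; apply: H1; rewrite (lt_le_trans xd) // ge_min lexx.
have U'J x : U' x -> jac F x \in unitmx.
  by move/U'E => xd; apply: H3; rewrite (lt_le_trans xd) // !ge_min lexx !orbT.
(* [id - F A], with [A] the inverse Jacobian at [x0], is a contraction near [x0] *)
have phiL x y : U' x -> U' y ->
    `|(x - y) - (F x - F y) *m A| <= 2^-1 * `|x - y|.
  move=> /U'E xd /U'E yd.
  have xd2 : `|x - x0| < d2 by rewrite (lt_le_trans xd) // !ge_min lexx !orbT.
  have yd2 : `|y - x0| < d2 by rewrite (lt_le_trans yd) // !ge_min lexx !orbT.
  have -> : (x - y) - (F x - F y) *m A = - ((F x - F y - (x - y) *m jac F x0) *m A).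
    by rewrite [in RHS]mulmxBl /A mulmxK // opprB.
  rewrite normrN; apply: (le_trans (HK _)).
  apply: (@le_trans _ _ (K * ((2 * K)^-1 * `|x - y|))).
    by rewrite ler_pM2l //; exact: H2.
  by rewrite invfM mulrA mulrCA divff ?mulr1 ?lt0r_neq0.
(* The contraction estimate bounds increments of [F] from below, which gives injectivity on [U'] and
   the Lipschitz constant [2 * K] of [G]. *)
have expand x y : U' x -> U' y -> `|x - y| <= 2 * K * `|F x - F y|.
  move=> Ux Uy; have L := phiL x y Ux Uy.
  have L2 : `|x - y| <= 2^-1 * `|x - y| + K * `|F x - F y|.
    have -> : x - y = (x - y - (F x - F y) *m A) + (F x - F y) *m A by rewrite subrK.
    apply: (le_trans (ler_normD _ _)); rewrite subrK; exact: lerD.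
  lra.
have Finj x y : U' x -> U' y -> F x = F y -> x = y.
  move=> Ux Uy Fxy; apply/eqP; rewrite -subr_eq0 -normr_le0.
  by have := expand x y Ux Uy; rewrite Fxy subrr normr0 mulr0.
pose rho := d / 2; have rho0 : 0 < rho by rewrite divr_gt0.
have rhod : rho < d by rewrite /rho ltr_pdivrMr // ltr_pMr // ltr1n.
(* A target within [r] displaces the centre by at most [K * r = rho / 2], and the contraction adds
   at most [rho / 2]: the closed [rho]-ball is preserved. *)
pose r := rho / (2 * K); have r0 : 0 < r by rewrite divr_gt0 ?mulr_gt0.
have rhoU' x : `|x - x0| <= rho -> U' x.
  by move=> xr; apply/U'E; exact: le_lt_trans rhod.
have Ux0' : U' x0 by apply: rhoU'; rewrite subrr normr0 ltW.
have solve y : exists x, ball (F x0) r y -> `|x - x0| <= rho /\ F x = y.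
  have [yB|] := pselect (ball (F x0) r y); last by exists x0.
  have yr : `|y - F x0| < r by move: yB; rewrite -ball_normE /= distrC.
  have [|z w zr wr|x xr xE] := @banach_ball (fun x => x - (F x - y) *m A) x0 rho rho0.
  - move=> x xr; have L := phiL x x0 (rhoU' _ xr) Ux0'.
    have -> : x - (F x - y) *m A - x0 =
       (x - x0 - (F x - F x0) *m A) + (y - F x0) *m A.
      by rewrite !mulmxBl; apply/rowP => i; rewrite !mxE; ring.
    apply: (le_trans (ler_normD _ _)).
    have L2 : `|(y - F x0) *m A| <= K * r.
      by apply: (le_trans (HK _)); rewrite ler_pM2l // ltW.
    have L3 : K * r = rho / 2.
      by rewrite /r; field; exact: lt0r_neq0.
    rewrite L3 in L2; lra.
  - have -> : z - (F z - y) *m A - (w - (F w - y) *m A) =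
       z - w - (F z - F w) *m A.
      by rewrite !mulmxBl; apply/rowP => i; rewrite !mxE; ring.
    by apply: phiL; exact: rhoU'.
  - exists x => _; split=> //.
    have /(congr1 (fun z => z *m jac F x0)) : (F x - y) *m A = 0.
      by apply: (addIr (- (F x - y) *m A)); rewrite mulNmx subrr add0r -{1}[- _](addKr x) -xE addNr.
    by rewrite mulmxKV // mul0mx => /eqP; rewrite subr_eq0 => /eqP.
have /choice[G HG] := solve.
have GE y : ball (F x0) r y -> U' (G y) /\ F (G y) = y.
  by move=> /HG [/rhoU'].
have B0 : ball (F x0) r (F x0) by exact: ballxx.
have oB : open (ball (F x0) r) by exact: ball_open.
have GL y z : ball (F x0) r y -> ball (F x0) r z -> `|G y - G z| <= 2 * K * `|y - z|.
  move=> /GE[Uy Ey] /GE[Uz Ez]; rewrite -{2}Ey -{2}Ez; exact: expand.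
have Gdiff y : ball (F x0) r y -> differentiable G y /\
    'd G y = mulmxr (invmx (jac F (G y))) :> (_ -> _).
  move=> yB; have [Uy Ey] := GE y yB.
  set Bm := invmx (jac F (G y)).
  have [L L0 HL] := mulmx_bound Bm.
  have cB : continuous (mulmxr Bm : 'rV[R]_m -> 'rV[R]_m) by exact: mulmxr_continuous.
  have app e : 0 < e -> exists2 d, 0 < d & forall h, `|h| < d ->
    `|G (y + h) - G y - mulmxr Bm h| <= e * `|h|.
    (* The denominator absorbs the bound [L] of the inverse Jacobian at [G y] and the Lipschitz
       constant [2 * K] of [G]. *)
    move=> e0; have e1 : 0 < e / (L * (2 * K)) by rewrite divr_gt0 ?mulr_gt0.
    have [d4 d40 H4] := strict_diff oU (U'U _ Uy) FC1 e1.
    have [d5 d50 H5] := open_norm oB yB.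
    exists (Num.min d5 (d4 / (2 * K))) => [|h].
      by rewrite lt_min d50 divr_gt0 // mulr_gt0.
    rewrite lt_min => /andP[h5 h4].
    have yhB : ball (F x0) r (y + h) by apply: H5; rewrite addrC addrA addNr add0r.
    have [Uyh Eyh] := GE _ yhB.
    have kL : `|G (y + h) - G y| <= 2 * K * `|h|.
      by have := GL _ _ yhB yB; rewrite [y + h - y]addrC addKr.
    have k4 : `|G (y + h) - G y| < d4.
      apply: (le_lt_trans kL); rewrite mulrC -ltr_pdivlMr ?mulr_gt0 //.
    have := H4 (G y) (G (y + h)); rewrite subrr normr0 => /(_ d40 k4).
    rewrite Ey Eyh [y + h - y]addrC addKr => H.
    have -> : G (y + h) - G y - mulmxr Bm h =
       - ((h - (G (y + h) - G y) *m jac F (G y)) *m Bm).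
      by rewrite [in RHS]mulmxBl /Bm mulmxK ?U'J // opprB.
    rewrite normrN; apply: (le_trans (HL _)).
    apply: (@le_trans _ _ (L * (e / (L * (2 * K)) * (2 * K * `|h|)))).
      rewrite ler_pM2l //; apply: (le_trans H); rewrite ler_pM2l //.
    have -> // : L * (e / (L * (2 * K)) * (2 * K * `|h|)) = e * `|h|.
    by field; rewrite !lt0r_neq0.
  exact: is_diff_approx cB app.
(* Bootstrapping: ['D_v G] is [v] times the inverse Jacobian at [G y], which involves [G]
   undifferentiated, so C^k implies C^(k+1). *)
have GC k : Ck k (ball (F x0) r) G.
  elim: k => [|k IHk].
    split=> // y yB; apply: (@differentiable_continuous R _ _ y G).
    by have [] := Gdiff y yB.
  apply/CkS; split=> [y yB|v].
    apply: (@differentiable_continuous R _ _ y G); by have [] := Gdiff y yB.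
  split=> [y yB|].
    by apply: (@diff_derivable R _ _ G y v); have [] := Gdiff y yB.
  apply: (@eq_Ck _ _ _ _ _ (fun y => v *m invmx (jac F (G y)))) => //.
    move=> y yB; have [dG E] := Gdiff y yB.
    by rewrite deriveE // E.
  apply/(Ck_mxP _ _ oB) => i j.
  apply: (@eq_Ck _ _ _ _ _ (fun y => \sum_l v i l * invmx (jac F (G y)) l j)) => //.
    by move=> y _; rewrite mxE.
  apply: Ck_sum => // l _; apply: Ck_mul => //; first exact: Ck_cst.
  have JiC := Ck_invmx oU' U'J (fun a b => Ck_subset U'U (JC k a b)).
  by apply: (Ck_comp oB oU' _ (JiC l j) IHk) => y /GE[].
exists r, G; split=> //.
- exact/smooth_onP.
- by move=> y /GE[/U'U].
- by apply: Finj => //; have [] := GE _ B0.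
have cF : {for x0, continuous F} by exact: (Ck_continuous FC1).
near=> x.
have FxB : ball (F x0) r (F x).
  near: x; apply: cF; exact: open_nbhs_nbhs.
split=> //; have [UG EG] := GE _ FxB.
apply: Finj => //; near: x; exact: open_nbhs_nbhs.
Unshelve. all: by end_near. Qed.

End inverse_function_theorem.

(** * Primitives of closed 1-forms along fibres *)

Section unit_interval_integral.
Variable R : realType.
Local Notation mu := (@lebesgue_measure R).

Definition int01 (f : R -> R) : R := \int[mu]_(t in `[0, 1]) f t.

(** Continuity is two-sided at 0 and 1 as well; the integrands below are defined beyond the
    interval. *)
Definition cont01 (f : R -> R) := forall t : R, 0 <= t <= 1 -> {for t, continuous f}.

Lemma cont01_within f : cont01 f -> {within `[0, 1], continuous f}.
Proof.
move=> cf; apply: continuous_in_subspaceT => t; rewrite inE /= in_itv /=; exact: cf.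
Qed.

Lemma int01_integrable f : cont01 f -> mu.-integrable `[0, 1] (EFin \o f).
Proof.
move=> /cont01_within cf; apply: continuous_compact_integrable => //.
exact: segment_compact.
Qed.

Lemma int01D f g : cont01 f -> cont01 g ->
  int01 (fun t => f t + g t) = int01 f + int01 g.
Proof. by move=> cf cg; rewrite /int01 RintegralD //; exact: int01_integrable. Qed.

Lemma int01Z c f : cont01 f -> int01 (fun t => c * f t) = c * int01 f.
Proof. by move=> cf; rewrite /int01 RintegralZl //; exact: int01_integrable. Qed.

Lemma int01_ext f g : (forall t : R, 0 <= t <= 1 -> f t = g t) -> int01 f = int01 g.
Proof.
move=> fg; apply: eq_Rintegral => t; rewrite inE /= in_itv /=; exact: fg.
Qed.

Lemma cont01_sum I (r : seq I) (P : pred I) (F : I -> R -> R) :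
  (forall i, P i -> cont01 (F i)) -> cont01 (fun t => \sum_(i <- r | P i) F i t).
Proof.
move=> cF; elim: r => [|i r IHr] t t01.
  have -> : (fun t => \sum_(i <- [::] | P i) F i t) = cst 0.
    by apply/funext => x; rewrite big_nil.
  exact: cst_continuous.
have [Pi|nPi] := boolP (P i).
  have -> : (fun t => \sum_(i <- i :: r | P i) F i t) =
     F i + (fun t => \sum_(i <- r | P i) F i t).
    by apply/funext => x; rewrite big_cons Pi.
  by apply: continuousD; [exact: cF|exact: IHr].
have -> : (fun t => \sum_(i <- i :: r | P i) F i t) =
     (fun t => \sum_(i <- r | P i) F i t).
  by apply/funext => x; rewrite big_cons (negbTE nPi).
exact: IHr.
Qed.

Lemma int01_sum I (r : seq I) (P : pred I) (F : I -> R -> R) :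
  (forall i, P i -> cont01 (F i)) ->
  int01 (fun t => \sum_(i <- r | P i) F i t) = \sum_(i <- r | P i) int01 (F i).
Proof.
move=> cF; elim: r => [|i r IHr].
  rewrite big_nil (@int01_ext _ (fun t => 0 * 0)) => [|t _]; last first.
    by rewrite big_nil mulr0.
  rewrite int01Z ?mul0r // => t _; exact: cst_continuous.
rewrite big_cons; case: ifPn => [Pi|nPi]; last first.
  by rewrite -IHr; apply: int01_ext => t _; rewrite big_cons (negbTE nPi).
rewrite -IHr -int01D; [|exact: cF|exact: cont01_sum].
by apply: int01_ext => t _; rewrite big_cons Pi.
Qed.

Lemma int01_bound f (C : R) : cont01 f -> (forall t : R, 0 <= t <= 1 -> `|f t| <= C) ->
  `|int01 f| <= C.
Proof.
move=> cf fC.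
have cn : cont01 (fun t => `|f t|).
  move=> t t01; apply: continuous_comp; [exact: cf|exact: norm_continuous].
have m01 : measurable (`[0, 1] : set (measurableTypeR R)) by exact: measurable_itv.
apply: (le_trans (le_normr_Rintegral m01 (int01_integrable cf))).
apply: (@le_trans _ _ (int01 (fun=> C))).
  apply: le_Rintegral => //.
  - exact: int01_integrable.
  - apply: int01_integrable => t _; exact: cst_continuous.
have := @lebesgue_measure_itv R `[0, 1]%R.
rewrite /= lte_fin ltr01 oppr0 adde0 => E.
by rewrite /int01 Rintegral_cst // [X in fine X]E /= mulr1.
Qed.

Lemma int01_FTC f (F : R -> R) : cont01 f ->
  (forall t : R, 0 <= t <= 1 -> is_derive t 1 F (f t)) -> int01 f = F 1 - F 0.
Proof.
move=> cf dF; rewrite /int01 /Rintegral (@continuous_FTC2 R f F 0 1) //.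
- exact: cont01_within.
- have cF (t : R) : 0 <= t <= 1 -> {for t, continuous F}.
    move=> t01; apply/differentiable_continuous/derivable1_diffP.
    by have [] := dF t t01.
  split.
  + move=> t; rewrite in_itv /= => /andP[t0 t1].
    by have [|] := dF t; first by rewrite !ltW.
  + by apply: cvg_at_right_filter; apply: cF; rewrite lexx ler01.
  + by apply: cvg_at_left_filter; apply: cF; rewrite lexx ler01.
- move=> t; rewrite in_itv /= => /andP[t0 t1]; rewrite derive1E.
  by have [|_ ->] := dF t; first by rewrite !ltW.
Qed.

End unit_interval_integral.

Section fibrewise_poincare.
Variables (R : realType) (m : nat) (S : pred 'I_m) (z0 : 'rV[R]_m) (r : R).
Local Notation B := (ball z0 r).

(* [cone t] contracts the [S]-coordinates towards those of [z0] and leaves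
   the other coordinates unchanged *)
Definition dil (t : R) (v : 'rV[R]_m) : 'rV[R]_m := \row_i (t ^+ (S i) * v 0 i).
Definition cone (t : R) (z : 'rV[R]_m) : 'rV[R]_m := z0 + dil t (z - z0).

Let oB : open B. Proof. exact: ball_open. Qed.
Let BE z : B z <-> `|z - z0| < r.
Proof. by rewrite -ball_normE /= distrC. Qed.

Lemma dil_norm (t : R) (v : 'rV[R]_m) : 0 <= t <= 1 -> `|dil t v| <= `|v|.
Proof.
move=> /andP[t0 t1]; apply: rV_norm_le => // i; rewrite mxE normrM normrX.
apply: le_trans (rV_coord_norm v i); rewrite ler_piMl // exprn_ile1 //.
by rewrite ger0_norm.
Qed.

Lemma cone_ball (t : R) (z : 'rV[R]_m) : 0 <= t <= 1 -> B z -> B (cone t z).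
Proof.
move=> t01 /BE zr; apply/BE; rewrite /cone addrC addKr.
exact: le_lt_trans (dil_norm _ t01) zr.
Qed.

Lemma coneD t z v : cone t (z + v) = cone t z + dil t v.
Proof. by apply/rowP => i; rewrite !mxE; ring. Qed.

Lemma cone1 z : cone 1 z = z.
Proof. by apply/rowP => i; rewrite !mxE expr1n; ring. Qed.

Lemma coneE t z : cone t z =
  (\row_i (if S i then z0 0 i else z 0 i)) +
  t *: (\row_i (if S i then (z - z0) 0 i else 0)).
Proof. by apply/rowP => i; rewrite !mxE; case: (S i) => /=; ring. Qed.

Lemma cone_continuous z : continuous (cone ^~ z : R -> 'rV[R]_m).
Proof.
move=> t; rewrite (_ : cone ^~ z = fun t => (\row_i (if S i then z0 0 i else z 0 i)) +
  t *: (\row_i (if S i then (z - z0) 0 i else 0))); last first.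
  by apply/funext => ?; exact: coneE.
apply: cvgD; first exact: cvg_cst.
exact: scalel_continuous.
Qed.

(** Here the derivative is taken at the moving point [y], not at the centre as in [strict_diff]. The
    factor 2 in the constants pays for comparing the mean value point and [y] through [x]. *)
Lemma uniform_diff (U : set 'rV[R]_m) (f : 'rV[R]_m -> R) (x : 'rV[R]_m) e :
  open U -> U x -> Ck 1 U f -> 0 < e ->
  exists2 d, 0 < d & forall y z, `|y - x| < d -> `|z - x| < d ->
    `|f z - f y - \sum_i (z - y) 0 i * 'D_(std_basis R i) f y| <= e * `|z - y|.
Proof.
move=> oU Ux fC e0.
pose D i := 'D_(std_basis R i) f.
have m1 : 0 < e / (2 * m.+1%:R) by rewrite divr_gt0 // mulr_gt0.
have [d1 d10 H1] := open_norm oU Ux.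
have [d2 d20 H2] : exists2 d, 0 < d &
    forall y, `|y - x| < d -> forall i, `|D i y - D i x| <= e / (2 * m.+1%:R).
  apply: continuous_norm => // i.
  have [_ /(_ (std_basis R i)) [_ [+ _]]] := (CkS _ _ _).1 fC.
  by apply.
exists (Num.min d1 d2) => [|y z]; first by rewrite lt_min d10.
rewrite !lt_min => /andP[y1 y2] /andP[z1 z2].
have [t t01 E] := MVT_rV oU fC (fun t t01 => H1 _ (ball_convex t01 y1 z1)).
have De := H2 _ (ball_convex t01 y2 z2); have Dy := H2 _ y2.
rewrite E -sumrB; apply: (le_trans (ler_norm_sum _ _ _)).
apply: (@le_trans _ _ (\sum_(i < m) e / m.+1%:R * `|z - y|)).
  apply: ler_sum => i _; rewrite -mulrBr normrM [leLHS]mulrC.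
  apply: ler_pM => //; last exact: rV_coord_norm.
  have aux (p q c : R) : p - q = (p - c) - (q - c) by ring.
  rewrite (aux _ _ (D i x)); apply: (le_trans (ler_normB _ _)).
  have half (M : R) : M != 0 -> e / M = e / (2 * M) + e / (2 * M) by move=> ?; field.
  rewrite (half m.+1%:R) ?pnatr_eq0 //.
  apply: lerD; [exact: De|exact: Dy].
rewrite sumr_const card_ord -[_ *+ m]mulr_natl mulrA ler_wpM2r //.
rewrite mulrCA -[leRHS]mulr1 ler_pM2l // ler_pdivrMr // mul1r ler_nat //.
Qed.

(** These weighted integrals along the contraction are closed under differentiation: a derivative in
    an [S]-direction raises [k] by one, any other derivative keeps it. *)
Definition moment (k : nat) (h : 'rV[R]_m -> R) (z : 'rV[R]_m) : R :=
  int01 (fun t => t ^+ k * h (cone t z)).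

Lemma cont01_moment k h z : B z -> Ck 0 B h ->
  cont01 (fun t => t ^+ k * h (cone t z)).
Proof.
move=> Bz [ch _] t t01; apply: continuousM; first exact: exprn_continuous.
apply: (@continuous_comp _ _ _ (cone ^~ z) h); first exact: cone_continuous.
by apply: ch; exact: cone_ball.
Qed.

Arguments cont01_moment k {h z}.

(** Compactness of [0, 1] makes [d] independent of [t], since [uniform_diff] at [cone t z] serves
    all nearby parameters. *)
Lemma cone_uniform_diff h z e : B z -> Ck 1 B h -> 0 < e ->
  exists2 d, 0 < d & forall (t : R) (v : 'rV[R]_m), 0 <= t <= 1 -> `|v| < d ->
    `|h (cone t z + v) - h (cone t z) -
      \sum_i v 0 i * 'D_(std_basis R i) h (cone t z)| <= e * `|v|.
Proof.
move=> Bz hC e0.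
pose P (d : R) (t : R) := forall v, `|v| < d -> `|h (cone t z + v) - h (cone t z) -
      \sum_i v 0 i * 'D_(std_basis R i) h (cone t z)| <= e * `|v|.
have /compact_near_coveringP/(_ _ (nbhs (0 : R)) P _) K := @segment_compact R 0 1.
have : \forall d \near (0 : R), `[0, 1] `<=` P d.
  apply: K => t /=; rewrite in_itv /= => t01.
  have [d d0 Hd] := uniform_diff oB (cone_ball t01 Bz) hC e0.
  have d2 : 0 < d / 2 by rewrite divr_gt0.
  have c1 : \forall s \near t, `|cone s z - cone t z| < d / 2.
    near=> s; rewrite distrC; near: s.
    exact: (cvgrPdist_lt _ _).1 (cone_continuous (z := z) (x := t)) _ d2.
  have c2 : \forall d' \near (0 : R), d' < d / 2.
    apply: (open_nbhs_nbhs (conj (@open_lt R (d / 2)) _)) => //.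
  near=> s d' => v vd /=.
  have sd : `|cone s z - cone t z| < d / 2 by near: s.
  have d'd : d' < d / 2 by near: d'.
  have := Hd (cone s z) (cone s z + v); rewrite [cone s z + v - cone s z]addrC addKr; apply.
    by apply: lt_trans sd _; rewrite ltr_pdivrMr // ltr_pMr // ltr1n.
  rewrite addrAC (splitr d); apply: (le_lt_trans (ler_normD _ _)).
  by rewrite ltrD // (lt_trans vd).
move=> /nbhs_normE[d d0 Hd].
exists (d / 2) => [|t v t01 vd]; first by rewrite divr_gt0.
apply: (Hd (d / 2) _ t); [|by rewrite /= in_itv|exact: vd].
by rewrite subr0 ger0_norm ?divr_ge0 ?ltW // ltr_pdivrMr // ltr_pMr // ltr1n.
Unshelve. all: by end_near. Qed.

(** Differentiation under the integral sign. The exponent [S i] is the factor that [dil t] puts on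
    the i-th coordinate of an increment. *)
Lemma is_diff_moment k h z : B z -> Ck 1 B h ->
  differentiable (moment k h) z /\ forall v, 'D_v (moment k h) z =
    \sum_i v 0 i * moment (k + S i) ('D_(std_basis R i) h) z.
Proof.
move=> Bz hC.
pose Dm (v : 'rV[R]_m) : R^o :=
  \sum_i v 0 i * moment (k + S i) ('D_(std_basis R i) h) z.
have lin : linear Dm.
  move=> a u v; rewrite /Dm /= scaler_sumr -big_split /=; apply: eq_bigr => i _.
  by rewrite !mxE mulrDl -mulrA.
pose DM := GRing.isLinear.Build _ _ _ _ _ lin.
pose DL : {linear 'rV[R]_m -> R^o} := HB.pack Dm DM.
have Dc : continuous DL.
  move=> v; suff: Ck 0 setT Dm by case=> /(_ v Logic.I).
  have oT := @openT 'rV[R]_m.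
  apply: Ck_sum => // i _; apply: Ck_mul => //; last exact: Ck_cst.
  by move/(Ck_mxP _ _ oT): (@Ck_id R 'rV[R]_m 0 setT); apply.
have hC0 := CkSW hC.
have DC i : Ck 0 B ('D_(std_basis R i) h).
  by have [_ /(_ (std_basis R i)) []] := (CkS _ _ _).1 hC.
suff [dm DE] : differentiable (moment k h) z /\ 'd (moment k h) z = DL :> (_ -> _).
  by split=> // v; rewrite deriveE // DE.
apply: (is_diff_approx Dc) => e e0.
have [d1 d10 H1] := open_norm oB Bz.
have [d2 d20 H2] := cone_uniform_diff Bz hC e0.
exists (Num.min d1 d2) => [|v]; first by rewrite lt_min d10.
rewrite lt_min => /andP[v1 v2].
have Bzv : B (z + v) by apply: H1; rewrite addrC addKr.
have c1 := cont01_moment k Bzv hC0; have c2 := cont01_moment k Bz hC0.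
have c3 i : cont01 (fun t => v 0 i * (t ^+ (k + S i) *
    'D_(std_basis R i) h (cone t z))).
  move=> t t01; apply: continuousM; first exact: cst_continuous.
  exact: (cont01_moment _ Bz (DC i)).
have c2' : cont01 (fun t => -1 * (t ^+ k * h (cone t z))).
  by move=> t t01; apply: continuousM; [exact: cst_continuous|exact: c2].
have c3' : cont01 (fun t => \sum_i v 0 i * (t ^+ (k + S i) *
    'D_(std_basis R i) h (cone t z))) by exact: cont01_sum.
have c3'' : cont01 (fun t => -1 * \sum_i v 0 i * (t ^+ (k + S i) *
    'D_(std_basis R i) h (cone t z))).
  by move=> t t01; apply: continuousM; [exact: cst_continuous|exact: c3'].
have c12 : cont01 (fun t => t ^+ k * h (cone t (z + v)) + -1 * (t ^+ k * h (cone t z))).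
  by move=> t t01; apply: continuousD; [exact: c1|exact: c2'].
have -> : moment k h (z + v) - moment k h z - DL v = int01 (fun t =>
   t ^+ k * h (cone t (z + v)) + -1 * (t ^+ k * h (cone t z)) +
   -1 * \sum_i v 0 i * (t ^+ (k + S i) * 'D_(std_basis R i) h (cone t z))).
  rewrite int01D // int01D // int01Z // int01Z // int01_sum // !mulN1r.
  congr (_ - _); rewrite /= /Dm; apply: eq_bigr => i _.
  by rewrite int01Z //; exact: (cont01_moment _ Bz (DC i)).
apply: int01_bound => [t t01|t t01].
  by apply: continuousD; [exact: c12|exact: c3''].
have -> : t ^+ k * h (cone t (z + v)) + -1 * (t ^+ k * h (cone t z)) +
   -1 * (\sum_i v 0 i * (t ^+ (k + S i) * 'D_(std_basis R i) h (cone t z))) =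
   t ^+ k * (h (cone t z + dil t v) - h (cone t z) -
      \sum_i dil t v 0 i * 'D_(std_basis R i) h (cone t z)).
  rewrite coneD !mulrBr !mulN1r; congr (_ - _ - _).
  rewrite mulr_sumr; apply: eq_bigr => i _.
  by rewrite mxE exprD; ring.
have dv := dil_norm v t01.
have L := H2 t (dil t v) t01 (le_lt_trans dv v2).
rewrite normrM -[leRHS]mul1r; apply: ler_pM => //.
  by have /andP[t0 t1] := t01; rewrite normrX exprn_ile1 // ger0_norm.
by apply: le_trans L _; rewrite ler_pM2l.
Qed.

Arguments is_diff_moment k {h z}.

Lemma Ck_moment k j h : (forall k, Ck k B h) -> Ck k B (moment j h).
Proof.
have cm j' h' (z : 'rV[R]_m) : Ck 1 B h' -> B z -> {for z, continuous (moment j' h')}.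
  move=> hC Bz; apply: differentiable_continuous.
  by have [] := is_diff_moment j' Bz hC.
elim: k j h => [|k IHk] j h hC; first by split=> // z; exact: cm.
apply/CkS; split=> [z|v]; first exact: cm.
split=> [z Bz|].
  by have [dm _] := is_diff_moment j Bz (hC 1%N); exact: diff_derivable.
apply: (@eq_Ck _ _ _ _ _
  (fun z => \sum_i v 0 i * moment (j + S i) ('D_(std_basis R i) h) z)) => //.
  by move=> z Bz; have [_ ->] := is_diff_moment j Bz (hC 1%N).
apply: Ck_sum => // i _; apply: Ck_mul => //; first exact: Ck_cst.
apply: IHk => k'.
by have [_ /(_ (std_basis R i)) []] := (CkS _ _ _).1 (hC k'.+1).
Qed.

(** The homotopy operator of the Poincare lemma in the [S]-coordinates, the others being parameters:
    [gamma z] is the sum over [S] of [(z - z0) 0 i] times the integral of [eta i (cone t z)] over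
    [0, 1]. *)
Lemma fibrewise_primitive (eta : 'I_m -> 'rV[R]_m -> R) :
  (forall i, smooth_on B (eta i)) ->
  (forall i j z, S i -> S j -> B z ->
    'D_(std_basis R i) (eta j) z = 'D_(std_basis R j) (eta i) z) ->
  exists2 gamma : 'rV[R]_m -> R, smooth_on B gamma &
    forall j z, S j -> B z -> 'D_(std_basis R j) gamma z = eta j z.
Proof.
move=> etaS closed.
have etaC i k : Ck k B (eta i) by move/smooth_onP: (etaS i); apply.
have oT := @openT 'rV[R]_m.
have coordC k i : Ck k B (fun z : 'rV[R]_m => (z - z0) 0 i).
  apply: (@eq_Ck _ _ _ _ _ (fun z : 'rV[R]_m => z 0 i - z0 0 i)) => //.
    by move=> z _; rewrite !mxE.
  apply: Ck_sub => //; last exact: Ck_cst.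
  by move/(Ck_mxP _ _ oB): (@Ck_id R 'rV[R]_m k B); apply.
pose term i z := (z - z0) 0 i * moment 0 (eta i) z.
have termC k i : Ck k B (term i).
  apply: Ck_mul => //; exact: Ck_moment.
exists (fun z => \sum_(i | S i) term i z).
  by apply/smooth_onP => k; exact: Ck_sum.
move=> j z Sj Bz.
have Dterm i : 'D_(std_basis R j) (term i) z =
   (i == j)%:R * moment 0 (eta i) z +
   (z - z0) 0 i * moment 1 ('D_(std_basis R j) (eta i)) z.
  have [dm DE] := is_diff_moment 0 Bz (etaC i 1%N).
  have dc : is_derive z (std_basis R j) (fun z : 'rV[R]_m => (z - z0) 0 i) (i == j)%:R.
    have [db1 db2] : is_derive z (std_basis R j) (fun z : 'rV[R]_m => z - z0)
       (std_basis R j - 0).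
      exact: (is_deriveB (is_derive_id z (std_basis R j))
                (is_derive_cst z0 z (std_basis R j))).
    split; first by have [_ /(_ (std_basis R j)) [+ _]] := (CkS _ _ _).1 (coordC 1%N i); apply.
    by rewrite (@derive_coord _ _ _ _ (fun z : 'rV[R]_m => z - z0)) // db2 subr0 mxE eqxx.
  have dm' : derivable (moment 0 (eta i)) z (std_basis R j) by exact: diff_derivable.
  have [dc1 dc2] := dc.
  have -> : term i = (fun z : 'rV[R]_m => (z - z0) 0 i) * moment 0 (eta i) by [].
  rewrite (deriveM dc1 dm') dc2 addrC DE; congr (_ + _).
    by rewrite [LHS]mulrC.
  congr (_ * _); rewrite (bigD1 j) //= big1 => [|l lj].
    by rewrite mxE !eqxx mul1r Sj addr0.
  by rewrite mxE (negbTE lj) andbF mul0r.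
have -> : 'D_(std_basis R j) (fun z : 'rV[R]_m => \sum_(i | S i) term i z) z =
   \sum_(i | S i) 'D_(std_basis R j) (term i) z.
  have dt i : S i -> derivable (term i) z (std_basis R j).
    by have [_ /(_ (std_basis R j)) [+ _]] := (CkS _ _ _).1 (termC 1%N i) => /(_ z Bz).
  by have [_] := is_derive_bigsum (index_enum _) dt.
under eq_bigr do rewrite Dterm.
rewrite big_split /= [X in X + _](bigD1 j) //= big1 ?addr0; last first.
  by move=> i /andP[_ /negbTE ->]; rewrite mul0r.
rewrite eqxx mul1r.
have DC i k : Ck k B ('D_(std_basis R i) (eta j)).
  by have [_ /(_ (std_basis R i)) []] := (CkS _ _ _).1 (etaC j k.+1).
(* Closedness, used at every point of the segment [cone t z], exchanges the two indices. *)
have -> : \sum_(i | S i) (z - z0) 0 i * moment 1 ('D_(std_basis R j) (eta i)) z =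
   \sum_(i | S i) (z - z0) 0 i * moment 1 ('D_(std_basis R i) (eta j)) z.
  have mE i : S i -> moment 1 ('D_(std_basis R j) (eta i)) z =
      moment 1 ('D_(std_basis R i) (eta j)) z.
    move=> Si; apply: int01_ext => t t01.
    by rewrite (closed j i _ Sj Si (cone_ball t01 Bz)).
  by apply: eq_bigr => i /mE ->.
have cS : cont01 (fun t => \sum_(i | S i) (z - z0) 0 i *
    (t ^+ 1 * 'D_(std_basis R i) (eta j) (cone t z))).
  apply: cont01_sum => i _ t t01; apply: continuousM; first exact: cst_continuous.
  exact: (cont01_moment _ Bz (DC i 0%N)).
have -> : \sum_(i | S i) (z - z0) 0 i * moment 1 ('D_(std_basis R i) (eta j)) z =
   int01 (fun t => \sum_(i | S i) (z - z0) 0 i *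
    (t ^+ 1 * 'D_(std_basis R i) (eta j) (cone t z))).
  rewrite int01_sum; last first.
    move=> i _ t t01; apply: continuousM; first exact: cst_continuous.
    exact: (cont01_moment _ Bz (DC i 0%N)).
  by apply: eq_bigr => i _; rewrite int01Z //; exact: (cont01_moment _ Bz (DC i 0%N)).
have c0 := cont01_moment 0 Bz (etaC j 0%N).
rewrite -int01D //.
pose b : 'rV[R]_m := \row_i (if S i then (z - z0) 0 i else 0).
pose a : 'rV[R]_m := \row_i (if S i then z0 0 i else z 0 i).
(* Since [a + t *: b] is [cone t z], the integrand is now the derivative of [F], and [F 1 - F 0] is
   [eta j z]. *)
pose F t := t * eta j (a + t *: b).
transitivity (F 1 - F 0); last by rewrite /F mul1r mul0r subr0 -coneE cone1.
apply: int01_FTC => t t01.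
  by apply: continuousD; [exact: c0|exact: cS].
have Bt : B (a + t *: b) by rewrite -coneE; exact: cone_ball.
have de : derivable (eta j) (a + t *: b) b.
  by have [_ /(_ b) [+ _]] := (CkS _ _ _).1 (etaC j 1%N); apply.
have [dl1 dl2] := is_derive_line de.
have -> : F = id * (fun t => eta j (a + t *: b)) by [].
have did : derivable (id : R -> R) t 1 by exact: derivable_id.
split; first exact: (derivableM did dl1).
rewrite (deriveM did dl1) dl2 derive_id expr0 mul1r coneE -/a -/b.
rewrite addrC [_ *: 1]mulr1; congr (_ + _).
rewrite deriveE_sum; last exact: (C1_differentiable oB Bt (etaC j 1%N)).
rewrite [LHS]mulr_sumr [RHS]big_mkcond /=; apply: eq_bigr => i _.
rewrite expr1 /b [(\row_ _ _) 0 i]mxE; case: ifP => _; last by rewrite mul0r mulr0.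
by rewrite mulrCA.
Qed.

End fibrewise_poincare.

(** * Pullbacks of 2-forms, bump functions *)

Section pullback.
Variables (R : realType) (m p : nat).

(* [H i j c], [N c d], [Q e c d] and [P i c] stand for the second derivatives
   of the map, the coefficients of the form, their derivatives, and the
   jacobian of the map. *)
Lemma pullback_cyclic_sum (H : 'I_m -> 'I_m -> 'I_p -> R) (N : 'I_p -> 'I_p -> R)
    (Q : 'I_p -> 'I_p -> 'I_p -> R) (P : 'I_m -> 'I_p -> R) :
  (forall i j c, H i j c = H j i c) -> (forall c d, N c d = - N d c) ->
  (forall e c d, Q e c d + Q c d e + Q d e c = 0) ->
  let D i j k := \sum_c \sum_d (H i j c * N c d * P k d +
      P j c * (\sum_e P i e * Q e c d) * P k d + P j c * N c d * H i k d) in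
  forall i j k, D i j k + D j k i + D k i j = 0.
Proof.
move=> Hsym Nanti Qcyc D i j k.
(* [a] collects the terms with second derivatives. It is symmetric in its first two indices and
   enters with its last two antisymmetrised, so it cancels in the cyclic sum; [T] collects the rest,
   which cancels by the cyclic identity for [Q]. *)
pose a i j k := \sum_c \sum_d H i j c * N c d * P k d.
pose T i j k := \sum_e \sum_c \sum_d P i e * P j c * P k d * Q e c d.
have DE i' j' k' : D i' j' k' = a i' j' k' - a i' k' j' + T i' j' k'.
  have -> : a i' k' j' = - \sum_c \sum_d P j' c * N c d * H i' k' d.
    rewrite /a exchange_big -sumrN; apply: eq_bigr => c _.
    by rewrite -sumrN; apply: eq_bigr => d _; rewrite (Nanti d c); ring.
  have -> : T i' j' k' = \sum_c \sum_d P j' c * (\sum_e P i' e * Q e c d) * P k' d.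
    rewrite /T exchange_big; apply: eq_bigr => c _.
    rewrite exchange_big; apply: eq_bigr => d _.
    by rewrite mulr_sumr mulr_suml; apply: eq_bigr => e _; ring.
  rewrite opprK /a /D -!big_split /=; apply: eq_bigr => c _.
  by rewrite -!big_split /=; apply: eq_bigr => d _; ring.
have aS i' j' k' : a i' j' k' = a j' i' k'.
  by apply: eq_bigr => c _; apply: eq_bigr => d _; rewrite Hsym.
have T0 : T i j k + T j k i + T k i j = 0.
  have -> : T j k i = \sum_e \sum_c \sum_d P i e * P j c * P k d * Q c d e.
    rewrite [RHS]exchange_big; apply: eq_bigr => c _.
    rewrite [RHS]exchange_big; apply: eq_bigr => d _.
    by apply: eq_bigr => e _; ring.
  have -> : T k i j = \sum_e \sum_c \sum_d P i e * P j c * P k d * Q d e c.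
    rewrite /T exchange_big; apply: eq_bigr => e _.
    rewrite exchange_big; apply: eq_bigr => c _.
    by apply: eq_bigr => d _; ring.
  rewrite -!big_split /= big1 // => e _; rewrite -!big_split /= big1 // => c _.
  rewrite -!big_split /= big1 // => d _; by rewrite -!mulrDr Qcyc mulr0.
rewrite !DE (aS k i j) (aS j i k) (aS k j i).
have -> : forall x y z t1 t2 t3 : R,
  x - y + t1 + (z - x + t2) + (y - z + t3) = t1 + t2 + t3 by move=> *; ring.
exact: T0.
Qed.

Definition pull (Psi : 'rV[R]_m -> 'rV[R]_p) (eta : 'rV[R]_p -> 'M[R]_p)
  (z : 'rV[R]_m) : 'M[R]_m := jac Psi z *m eta (Psi z) *m (jac Psi z)^T.

Variables (U : set 'rV[R]_m) (V : set 'rV[R]_p).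
Variables (Psi : 'rV[R]_m -> 'rV[R]_p) (eta : 'rV[R]_p -> 'M[R]_p).
Hypotheses (oU : open U) (oV : open V) (PsiS : smooth_on U Psi).
Hypothesis (PsiV : forall z, U z -> V (Psi z)).

Let PsiC k : Ck k U Psi. Proof. by move/smooth_onP: PsiS; apply. Qed.
Let PsicC k c : Ck k U (fun z => Psi z 0 c).
Proof. by move/(Ck_mxP _ _ oU): (PsiC k); apply. Qed.

Lemma Ck_jac k i j : Ck k U (fun z => jac Psi z i j).
Proof.
have /CkS[_ /(_ (std_basis R i)) [_ H]] := PsicC k.+1 j.
by apply: eq_Ck oU _ H => z _; rewrite mxE.
Qed.

Lemma pullE z j k : pull Psi eta z j k =
  \sum_c \sum_d jac Psi z j c * eta (Psi z) c d * jac Psi z k d.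
Proof.
rewrite /pull mxE exchange_big; apply: eq_bigr => d _.
rewrite mxE mulr_suml; apply: eq_bigr => c _.
by rewrite [_^T _ _]mxE.
Qed.

Lemma form2_pull : form2_on V eta -> form2_on U (pull Psi eta).
Proof.
move=> [/smooth_onP etaS etaA]; split.
  apply/smooth_onP => k; apply/(Ck_mxP _ _ oU) => i j.
  apply: (@eq_Ck _ _ _ _ _ (fun z =>
    \sum_c \sum_d jac Psi z i c * eta (Psi z) c d * jac Psi z j d)) => //.
    by move=> z _; rewrite pullE.
  apply: Ck_sum => // c _; apply: Ck_sum => // d _.
  apply: Ck_mul => //; last exact: Ck_jac.
  apply: Ck_mul => //; first exact: Ck_jac.
  have ec : Ck k V (fun y => eta y c d) by move/(Ck_mxP _ _ oV): (etaS k); apply.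
  exact: (Ck_comp oU oV PsiV ec (PsiC k)).
move=> z Uz; rewrite /pull !trmx_mul trmxK etaA; last exact: PsiV.
by rewrite mulNmx mulmxN mulmxA.
Qed.

(** The product and chain rules bring each derivative into the shape handled by
    [pullback_cyclic_sum]. *)
Lemma closed2_pull : form2_on V eta -> closed2_on V eta ->
  closed2_on U (pull Psi eta).
Proof.
move=> [/smooth_onP etaS etaA] etaCl z Uz i j k.
have Vz := PsiV Uz.
have ec l c d : Ck l V (fun y => eta y c d) by move/(Ck_mxP _ _ oV): (etaS l); apply.
pose H i j c := 'D_(std_basis R i) ('D_(std_basis R j) (fun y => Psi y 0 c)) z.
pose N c d := eta (Psi z) c d.
pose Q e c d := 'D_(std_basis R e) (fun y => eta y c d) (Psi z).
pose P i c := jac Psi z i c.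
have DE i' j' k' : 'D_(std_basis R i') (fun y => pull Psi eta y j' k') z =
    \sum_c \sum_d (H i' j' c * N c d * P k' d +
      P j' c * (\sum_e P i' e * Q e c d) * P k' d + P j' c * N c d * H i' k' d).
  have -> : (fun y => pull Psi eta y j' k') = fun y =>
    \sum_c \sum_d jac Psi y j' c * eta (Psi y) c d * jac Psi y k' d.
    by apply/funext => y; exact: pullE.
  have dJ l c : is_derive z (std_basis R i') (fun y => jac Psi y l c) (H i' l c).
    have -> : (fun y => jac Psi y l c) = 'D_(std_basis R l) (fun y => Psi y 0 c).
      by apply/funext => y; rewrite mxE.
    apply: derivableP.
    have [_ /(_ (std_basis R l)) [_ H1]] := (CkS _ _ _).1 (PsicC 2%N c).
    by have [_ /(_ (std_basis R i')) [+ _]] := (CkS _ _ _).1 H1; apply.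
  have dN c d : is_derive z (std_basis R i') (fun y => eta (Psi y) c d)
      (\sum_e P i' e * Q e c d).
    have dP : derivable Psi z (std_basis R i').
      by have [_ /(_ (std_basis R i')) [+ _]] := (CkS _ _ _).1 (PsiC 1%N); apply.
    have dE : differentiable (fun y => eta y c d) (Psi z).
      exact: C1_differentiable oV Vz (ec 1%N c d).
    have [h1 h2] := is_derive_comp dP dE.
    split; first exact: h1.
    rewrite (_ : (fun y => eta (Psi y) c d) = (fun y => eta y c d) \o Psi) // h2.
    rewrite deriveE_sum //; apply: eq_bigr => e _.
    by congr (_ * _); rewrite /P mxE; exact/esym/derive_coord.
  have dT c d : is_derive z (std_basis R i')
     (fun y => jac Psi y j' c * eta (Psi y) c d * jac Psi y k' d)
     (H i' j' c * N c d * P k' d +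
      P j' c * (\sum_e P i' e * Q e c d) * P k' d + P j' c * N c d * H i' k' d).
    have D1 := is_deriveM (dJ j' c) (dN c d).
    have D2 := is_deriveM D1 (dJ k' d).
    apply: (is_derive_eq D2); rewrite /=.
    rewrite -[(_ * _ : _ -> _) z]/(jac Psi z j' c * eta (Psi z) c d).
    rewrite -![_ *: _]/(_ * _) -/(P j' c) -/(P k' d) -/(N c d).
    move: (H _ _ _) (H _ _ _) (\sum_e _) => u1 u2 u3; ring.
  have dS c : is_derive z (std_basis R i')
     (fun y => \sum_d jac Psi y j' c * eta (Psi y) c d * jac Psi y k' d)
     (\sum_d (H i' j' c * N c d * P k' d +
      P j' c * (\sum_e P i' e * Q e c d) * P k' d + P j' c * N c d * H i' k' d)).
    have dT' d : true -> derivable (fun y => jac Psi y j' c * eta (Psi y) c d * jac Psi y k' d)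
       z (std_basis R i') by move=> _; have [] := dT c d.
    apply: (is_derive_eq (is_derive_bigsum (index_enum _) dT')).
    by apply: eq_bigr => d _; have [] := dT c d.
  have dS' c : true -> derivable (fun y => \sum_d jac Psi y j' c * eta (Psi y) c d *
     jac Psi y k' d) z (std_basis R i') by move=> _; have [] := dS c.
  have [_ ->] := is_derive_bigsum (index_enum _) dS'.
  by apply: eq_bigr => c _; have [] := dS c.
rewrite !DE; apply: pullback_cyclic_sum.
- by move=> a b c; apply: (derive_comm _ _ oU Uz); exact: PsicC.
- by move=> c d; have /matrixP/(_ d c) := etaA _ Vz; rewrite !mxE.
- by move=> e c d; exact: etaCl.
Qed.

End pullback.

(** * Smooth bump functions *)

Section bump.
Variable R : realType.

(** The function [x^(-k) exp(-1/x)] extended by 0. The powers are included because the family,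
    unlike its member [k = 0] alone, is stable under differentiation up to linear combinations. *)
Definition flat (k : nat) (x : R) : R :=
  if 0 < x then (x^-1) ^+ k * expR (- x^-1) else 0.

Lemma flat_ge0 k x : 0 <= flat k x.
Proof.
rewrite /flat; case: ifP => // x0.
by rewrite mulr_ge0 ?expR_ge0 // exprn_ge0 // invr_ge0 ltW.
Qed.

Lemma flat_gt0 (x : R) : 0 < x -> 0 < flat 0 x.
Proof. by move=> x0; rewrite /flat x0 expr0 mul1r expR_gt0. Qed.

Lemma flat_eq0 k (x : R) : x <= 0 -> flat k x = 0.
Proof. by move=> x0; rewrite /flat ltNge x0. Qed.

(** For positive [n], raise [exp (y / n) >= y / n] to the power [n]. *)
Lemma expRN_bound n (y : R) : 0 < y -> y ^+ n * expR (- y) <= n%:R ^+ n.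
Proof.
move=> y0; case: n => [|n].
  rewrite !expr0 mul1r -expR0 ler_expR oppr_le0; exact: ltW.
have nS : (0 : R) < n.+1%:R by rewrite ltr0n.
rewrite expRN ler_pdivrMr ?expR_gt0 //.
have -> : expR y = expR (y / n.+1%:R) ^+ n.+1.
  by rewrite -expRM_natl -mulr_natl mulrC divfK // lt0r_neq0.
rewrite -exprMn lerXn2r ?nnegrE ?(ltW y0) ?mulr_ge0 ?expR_ge0 ?(ltW nS) //.
rewrite mulrC -ler_pdivrMr //; apply: le_trans (expR_ge1Dx _).
by rewrite lerDr.
Qed.

Lemma is_derive_flat (k : nat) (x : R) :
  is_derive x 1 (flat k) (flat k.+2 x - k%:R * flat k.+1 x).
Proof.
have [x0|x0|x0] := ltgtP x 0.
- have Dc : is_derive x 1 (cst 0 : R -> R) 0 by exact: is_derive_cst.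
  rewrite !flat_eq0 ?(ltW x0) // mulr0 subr0.
  apply: near_eq_is_derive Dc.
  have : nbhs x [set y | y < 0] by apply: open_nbhs_nbhs; split=> //; exact: open_lt.
  by apply: filterS => y /= y0; rewrite flat_eq0 ?ltW.
- have xn0 : x != 0 by rewrite gt_eqF.
  have dV : is_derive x 1 (fun y : R => y^-1) (- x ^- 2).
    have h : derivable (id : R -> R) x 1 by exact: derivable_id.
    split; first exact: derivableV.
    by rewrite (deriveV xn0 h) derive_id [_ *: _]mulr1.
  have dE : is_derive x 1 (fun y : R => expR (- y^-1)) (x ^- 2 * expR (- x^-1)).
    have dN : is_derive x 1 (fun y : R => - y^-1) (x ^- 2).
      by rewrite -[x ^- 2]opprK; exact: is_deriveN.
    have dexp : is_derive (- x^-1) 1 (@expR R) (expR (- x^-1)) by exact: is_derive_expR.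
    rewrite mulrC; exact: (@is_derive1_comp _ expR (fun y : R => - y^-1) _ _ _ dexp dN).
  have dX : is_derive x 1 (fun y : R => (y^-1) ^+ k) (- (k%:R * (x^-1) ^+ k.+1)).
    have -> : (fun y : R => y^-1 ^+ k) = (fun y : R => y^-1) ^+ k.
      by apply/funext => y; rewrite exprfctE.
    apply: (is_derive_eq (is_deriveX k dV)).
    transitivity (k%:R * x^-1 ^+ k.-1 * (- x ^- 2)) => //.
    case: k => [|k]; first by rewrite !mul0r oppr0.
    by rewrite mulrN -mulrA; congr (- (_ * _)); rewrite -exprVn -exprD addn2.
  have D := is_deriveM dX dE.
  apply: (@near_eq_is_derive _ _ _ ((fun y : R => (y^-1) ^+ k) * (fun y : R => expR (- y^-1)))).
    have : nbhs x [set y | 0 < y] by apply: open_nbhs_nbhs; split=> //; exact: open_gt.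
    by apply: filterS => y /= y0; rewrite /flat y0.
  apply: (is_derive_eq D); rewrite /flat x0 /=.
  rewrite -![_ *: _]/(_ * _) !exprS; field => //.
- rewrite x0 !flat_eq0 // mulr0 subr0.
  have L : (fun h : R => h^-1 *: ((flat k \o shift 0) (h *: (1 : R)) - flat k 0)) @ 0^' --> (0 : R).
    apply/cvgrPdist_le => e e0.
    pose C : R := k.+2%:R ^+ k.+2.
    have C0 : 0 <= C by rewrite exprn_ge0.
    near=> h.
    have hn0 : h != 0 by near: h; exact: nbhs_dnbhs_neq.
    have hC : `|h| <= e / (C + 1).
      near: h; apply: dnbhs0_le; rewrite divr_gt0 // ltr_wpDl //.
    rewrite sub0r normrN /= addr0 [h *: 1]mulr1 (flat_eq0 k (lexx 0)) subr0.
    rewrite normrM /flat; case: ifP => h0; last by rewrite normr0 mulr0 ltW.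
    have hV : 0 < h^-1 by rewrite invr_gt0.
    have B := expRN_bound k.+2 hV.
    rewrite (ger0_norm (ltW hV)) ger0_norm; last by rewrite mulr_ge0 ?expR_ge0 // exprn_ge0 // ltW.
    (* Two inverse powers are moved into the bounded factor, so the difference quotient at 0 is
       [O(h)]. *)
    have -> : h^-1 * (h^-1 ^+ k * expR (- h^-1)) = h * (h^-1 ^+ k.+2 * expR (- h^-1)).
      by rewrite !exprS; field.
    apply: (@le_trans _ _ (h * C)); first by rewrite ler_pM2l.
    rewrite (ger0_norm (ltW h0)) in hC.
    apply: (@le_trans _ _ (e / (C + 1) * C)); first by rewrite ler_wpM2r.
    rewrite mulrAC ler_pdivrMr ?ltr_wpDl // ler_pM2l // lerDl //.
  split; first by apply/cvg_ex; exists 0.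
  by apply: cvg_lim.
Unshelve. all: by end_near. Qed.

Lemma Ck_flat (V : normedModType R) n k (U : set V) (p : V -> R) :
  open U -> (forall j, Ck j U p) -> Ck n U (fun x => flat k (p x)).
Proof.
move=> oU pC.
have cf j y : {for y, continuous (flat j)}.
  apply/differentiable_continuous/derivable1_diffP.
  by have [] := is_derive_flat j y.
elim: n k => [|n IHn] k.
  split=> // x Ux; apply: (@continuous_comp _ _ _ p (flat k)); last exact: cf.
  exact: (Ck_continuous (pC 0%N)).
apply/CkS; split=> [x Ux|v].
  apply: (@continuous_comp _ _ _ p (flat k)); last exact: cf.
  exact: (Ck_continuous (pC 0%N)).
have [_ /(_ v) [dp Dp]] := (CkS _ _ _).1 (pC 1%N).
have D x : U x -> is_derive x v (fun x => flat k (p x))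
    ('D_v p x * (flat k.+2 (p x) - k%:R * flat k.+1 (p x))).
  move=> Ux.
  have [d1 d2] := is_derive_flat k (p x).
  have df : differentiable (flat k) (p x) by exact/derivable1_diffP.
  have [h1 h2] := is_derive_comp (dp x Ux) df.
  split; first exact: h1.
  rewrite (_ : (fun x => _) = flat k \o p) // h2.
  have [_ h4] := is_derive_scaledir ('D_v p x) d1.
  rewrite -d2; apply: etrans h4.
  by congr (derive _ _ _); rewrite [RHS]mulr1.
split=> [x /D[] //|].
apply: (@eq_Ck _ _ _ _ _ (fun x => 'D_v p x * (flat k.+2 (p x) - k%:R * flat k.+1 (p x)))) => //.
  by move=> x /D[_ ->].
have [_ /(_ v) [_ Dp']] := (CkS _ _ _).1 (pC n.+1).
apply: Ck_mul => //; apply: Ck_sub => //; apply: Ck_mul => //; exact: Ck_cst.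
Qed.

(** Balls of the maximum norm are cubes, so a product of one-coordinate plateaus suffices. In the
    squared coordinate [p], the quotient [u / (u + v)] is 1 for [p <= d * d] and 0 for
    [p >= 4 * (d * d)]. *)
Lemma smooth_bump m (q : 'rV[R]_m) (d : R) : 0 < d ->
  exists phi : 'rV[R]_m -> R, [/\ smooth_on setT phi,
    forall x, `|x - q| <= d -> phi x = 1
  & forall x, phi x != 0 -> `|x - q| <= 2 * d].
Proof.
move=> d0.
pose p i (x : 'rV[R]_m) := (x - q) 0 i * (x - q) 0 i.
pose u i x := flat 0 (4 * (d * d) - p i x).
pose v i x := flat 0 (p i x - d * d).
have oT := @openT 'rV[R]_m.
have dd0 : 0 < d * d by rewrite mulr_gt0.
have coordC k i : Ck k setT (fun z : 'rV[R]_m => (z - q) 0 i).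
  apply: (@eq_Ck _ _ _ _ _ (fun z : 'rV[R]_m => z 0 i - q 0 i)) => //.
    by move=> z _; rewrite !mxE.
  apply: Ck_sub => //; last exact: Ck_cst.
  by move/(Ck_mxP _ _ oT): (@Ck_id R 'rV[R]_m k setT); apply.
have pC i k : Ck k setT (p i) by apply: Ck_mul.
have uC i k : Ck k setT (u i).
  apply: Ck_flat => // j; apply: Ck_sub => //; exact: Ck_cst.
have vC i k : Ck k setT (v i).
  apply: Ck_flat => // j; apply: Ck_sub => //; exact: Ck_cst.
have uv0 i x : u i x + v i x != 0.
  rewrite gt_eqF //; have [h|h] := ltP (p i x) (4 * (d * d)).
    by rewrite ltr_wpDr ?flat_ge0 // flat_gt0 // subr_gt0.
  rewrite ltr_wpDl ?flat_ge0 // flat_gt0 // subr_gt0; lra.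
have pE i x : p i x = `|(x - q) 0 i| ^+ 2 by rewrite real_normK ?num_real // expr2.
exists (fun x => \prod_i (u i x / (u i x + v i x))); split.
- apply/smooth_onP => k; apply: Ck_prod => // i _; apply: Ck_mul => //.
  by apply: Ck_inv => //; exact: Ck_add.
- move=> x xd; apply: big1 => i _.
  have v0 : v i x = 0.
    rewrite /v flat_eq0 // subr_le0 pE -expr2.
    by rewrite lerXn2r ?nnegrE ?(ltW d0) // (le_trans (rV_coord_norm _ i)).
  by have := uv0 i x; rewrite v0 addr0 => u0; rewrite divff.
- move=> x phix; apply: rV_norm_le => [|i]; first by rewrite mulr_ge0 // ltW.
  rewrite leNgt; apply: contra phix => h.
  apply/prodf_eq0; exists i => //; rewrite /u flat_eq0 ?mul0r // subr_le0 pE.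
  have -> : 4 * (d * d) = (2 * d) ^+ 2 by ring.
  have d20 : 0 <= 2 * d by rewrite mulr_ge0 // ltW.
  by rewrite lerXn2r ?nnegrE ?d20 ?(ltW h).
Qed.

End bump.

(** * Smooth functions on manifolds *)

Section smooth_on_lemmas.
Variables (R : realType) (V : normedModType R).

Lemma smooth_on_subset (W : normedModType R) (U U' : set V) (f : V -> W) :
  U `<=` U' -> smooth_on U' f -> smooth_on U f.
Proof. by move=> UU' fS s g x /UU'; exact: fS. Qed.

Lemma smooth_on_eq (W : normedModType R) (U : set V) (f g : V -> W) : open U ->
  (forall x, U x -> f x = g x) -> smooth_on U f -> smooth_on U g.
Proof.
move=> oU fg /smooth_onP fS; apply/smooth_onP => k; exact: eq_Ck oU fg (fS k).
Qed.

Lemma smooth_on_local (W : normedModType R) (U : set V) (f : V -> W) :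
  (forall x, U x -> exists2 N, nbhs x N & smooth_on N f) -> smooth_on U f.
Proof.
move=> H; apply/smooth_onP => k; apply: Ck_local => x /H[N xN /smooth_onP fS].
by exists N.
Qed.

Lemma smooth_on_mxP p q (U : set V) (f : V -> 'M[R]_(p, q)) : open U ->
  smooth_on U f <-> forall i j, smooth_on U (fun x => f x i j).
Proof.
move=> oU; split=> [/smooth_onP fS i j|H].
  by apply/smooth_onP => k; move/(Ck_mxP _ _ oU): (fS k); apply.
apply/smooth_onP => k; apply/(Ck_mxP _ _ oU) => i j.
by move/smooth_onP: (H i j); apply.
Qed.

Lemma smooth_on_continuous (W : normedModType R) (U : set V) (f : V -> W) x :
  smooth_on U f -> U x -> {for x, continuous f}.
Proof. by move=> fS Ux; have [] := fS [::] x Ux. Qed.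

Lemma smooth_on_derivable (W : normedModType R) (U : set V) (f : V -> W) x v :
  smooth_on U f -> U x -> derivable f x v.
Proof. by move=> fS Ux; have [_] := fS [::] x Ux; apply. Qed.

End smooth_on_lemmas.

(* The two facts about smooth functions with values in [W] whose proofs need
   [W] to be finite dimensional. *)
Definition smooth_target (R : realType) (W : normedModType R) :=
  (forall m (V : normedModType R) (U : set V) (U' : set 'rV[R]_m)
     (f : 'rV[R]_m -> W) (g : V -> 'rV[R]_m),
   open U -> open U' -> (forall x, U x -> U' (g x)) ->
   smooth_on U' f -> smooth_on U g -> smooth_on U (f \o g)) /\
  (forall m (U : set 'rV[R]_m) (f : 'rV[R]_m -> W) x,
   open U -> smooth_on U f -> U x -> differentiable f x).

Lemma smooth_targetR (R : realType) : smooth_target R.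
Proof.
split=> [m V U U' f g oU oU' gU /smooth_onP fS /smooth_onP gS|m U f x oU /smooth_onP fS Ux].
  by apply/smooth_onP => k; exact: (Ck_comp oU oU' gU (fS k) (gS k)).
exact: C1_differentiable oU Ux (fS 1%N).
Qed.

Lemma smooth_on_comp (R : realType) (V : normedModType R) m p q (U : set V)
    (U' : set 'rV[R]_m) (f : 'rV[R]_m -> 'M[R]_(p, q)) (g : V -> 'rV[R]_m) :
  open U -> open U' -> (forall x, U x -> U' (g x)) ->
  smooth_on U' f -> smooth_on U g -> smooth_on U (f \o g).
Proof.
move=> oU oU' gU /smooth_onP fS /smooth_onP gS; apply/smooth_onP => k.
exact: (Ck_comp_mx oU oU' gU (fS k) (gS k)).
Qed.

Lemma smooth_target_rV (R : realType) p : smooth_target 'rV[R]_p.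
Proof.
split=> [m V U U' f g|m U f x oU /smooth_onP fS Ux]; first exact: smooth_on_comp.
exact: C1_differentiable_mx oU Ux (fS 1%N).
Qed.

Section form_eval.
Variable R : realType.

Lemma form_eval_mul m p (A : 'M[R]_p) (J : 'M[R]_(m, p)) u v :
  form_eval A (u *m J) (v *m J) = form_eval (J *m A *m J^T) u v.
Proof. by rewrite /form_eval trmx_mul !mulmxA. Qed.

Lemma form_eval_basis m (A : 'M[R]_m) i j :
  form_eval A (std_basis R i) (std_basis R j) = A i j.
Proof. by rewrite /form_eval /std_basis trmx_delta -rowE -colE !mxE. Qed.

End form_eval.

Lemma open_setI_preimage (T T' : topologicalType) (U : set T) (f : T -> T')
    (A : set T') : open U -> (forall x, U x -> {for x, continuous f}) ->
  open A -> open (U `&` f @^-1` A).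
Proof.
move=> oU cf oA; rewrite openE => x [Ux Ax]; apply: filterI.
  exact: open_nbhs_nbhs.
by apply: (cf x Ux); exact: open_nbhs_nbhs.
Qed.

Section charts.
Variables (R : realType) (m : nat) (M : manifold R m).
Implicit Types (c d : chart R M m) (p q : M).

Lemma chart_imgP c x : chart_img c x ->
  chart_dom c (chart_inv c x) /\ c (chart_inv c x) = x.
Proof. by move=> [p cp <-]; rewrite chart_funK. Qed.

Lemma chart_imgE c p : chart_dom c p -> chart_img c (c p).
Proof. by move=> cp; exists p. Qed.

Lemma chart_image_open c (W : set M) : open W ->
  open (c @` (chart_dom c `&` W)).
Proof.
move=> oW; rewrite openE => _ [p [cp Wp] <-].
have cimg : nbhs (c p) (chart_img c).
  by apply: open_nbhs_nbhs; split; [exact: chart_img_open|exact: chart_imgE].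
have cW : nbhs (c p) (chart_inv c @^-1` W).
  apply: (chart_inv_continuous cp); rewrite chart_funK //.
  exact: open_nbhs_nbhs.
apply: (@filterS _ (nbhs (c p)) (nbhs_filter _) _ _ _ (filterI cimg cW)).
move=> y [/chart_imgP[dy ye] Wy].
by exists (chart_inv c y).
Qed.

Lemma chart_preimage_open c (O : set 'rV[R]_m) : open O ->
  open (chart_dom c `&` c @^-1` O).
Proof.
move=> oO; rewrite openE => p [cp Op]; apply: filterI.
  by apply: open_nbhs_nbhs; split=> //; exact: chart_dom_open.
by apply: (chart_continuous cp); exact: open_nbhs_nbhs.
Qed.

Lemma atlas_at p : atlas (chart_at p). Proof. exact: chart_at_atlas. Qed.

(** One chart around each point is enough: transition maps carry smoothness to all other charts of
    the atlas. *)
Lemma smooth_fun_local (W : normedModType R) (U : set M) (h : M -> W) :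
  smooth_target W ->
  open U ->
  (forall p, U p -> exists2 c, atlas c & chart_dom c p /\
    exists2 O, open O /\ O (c p) & smooth_on O (h \o chart_inv c)) ->
  smooth_fun U h.
Proof.
move=> [comp _] oU H d ad; apply: smooth_on_local => _ [q [dq Uq] <-].
have [c ac [cq [ O [ oO Oq] hS]]] := H q Uq.
pose N := d @` (chart_dom d `&` (chart_dom c `&` c @^-1` O)).
have oN : open N by apply: chart_image_open; exact: chart_preimage_open.
exists N; first by apply: open_nbhs_nbhs; split=> //; exists q.
apply: (@smooth_on_eq _ _ _ _ ((h \o chart_inv c) \o (c \o chart_inv d))) => //.
  by move=> _ [p [dp [cp Op]] <-] /=; rewrite chart_funK // chart_funK.
apply: comp oN oO _ hS _.
  by move=> _ [p [dp [cp Op]] <-] /=; rewrite chart_funK.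
apply: smooth_on_subset (atlas_compatible ad ac).
by move=> _ [p [dp [cp Op]] <-]; exists p.
Qed.

Lemma smooth_fun_subset (W : normedModType R) (U U' : set M) (h : M -> W) :
  U `<=` U' -> smooth_fun U' h -> smooth_fun U h.
Proof.
move=> UU' hS c ac; apply: smooth_on_subset (hS c ac).
by move=> _ [p [cp /UU' Up] <-]; exists p.
Qed.

Lemma smooth_fun_chart c : atlas c -> smooth_fun (chart_dom c) c.
Proof. by move=> ac d ad; exact: (atlas_compatible ad ac). Qed.

Lemma smooth_fun_comp_chart (W : normedModType R) (U : set M) (h : M -> W) c p :
  open U -> smooth_fun U h -> atlas c -> chart_dom c p -> U p ->
  exists O : set 'rV[R]_m, [/\ open O, O (c p), smooth_on O (h \o chart_inv c)
    & forall x, O x -> [/\ chart_dom c (chart_inv c x), U (chart_inv c x)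
                           & c (chart_inv c x) = x]].
Proof.
move=> oU hS ac cp Up; exists (c @` (chart_dom c `&` U)); split.
- exact: chart_image_open.
- by exists p.
- exact: hS.
- by move=> _ [q [cq Uq] <-]; rewrite !chart_funK.
Qed.

Lemma near_chart c (P : set M) p : chart_dom c p -> nbhs p P ->
  \forall x \near c p, chart_dom c (chart_inv c x) /\ P (chart_inv c x).
Proof.
move=> cp pP.
have cW : nbhs (c p) (chart_inv c @^-1` (chart_dom c `&` P)).
  apply: (chart_inv_continuous cp); rewrite chart_funK //.
  by apply: filterI => //; apply: open_nbhs_nbhs; split=> //; exact: chart_dom_open.
exact: cW.
Qed.

Lemma dfunE (W : normedModType R) c p (h : M -> W) u : atlas c -> chart_dom c p ->
  differentiable (h \o chart_inv c) (c p) ->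
  dfun p h u = 'D_(dfun p c u) (h \o chart_inv c) (c p).
Proof.
move=> ac cp dh; rewrite /dfun; set a := chart_at p.
have ap : chart_dom a p by exact: mem_chart_at.
have aa : atlas a by exact: chart_at_atlas.
have cE : (c \o chart_inv a) (a p) = c p by rewrite /= chart_funK.
have dc : derivable (c \o chart_inv a) (a p) u.
  apply: smooth_on_derivable (atlas_compatible aa ac) _; by exists p.
have [_] := @is_derive_comp _ _ _ _ (h \o chart_inv c) (c \o chart_inv a) (a p) u
  dc ltac:(by rewrite cE).
rewrite cE => <-.
apply: near_eq_derive.
have cn : nbhs p (chart_dom c).
  by apply: open_nbhs_nbhs; split=> //; exact: chart_dom_open.
apply: (@filterS _ (nbhs (a p)) (nbhs_filter _) _ _ _ (near_chart ap cn)).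
by move=> x [_ cx] /=; rewrite chart_funK.
Qed.

Lemma near_eq_dfun (W : normedModType R) p (h h' : M -> W) u :
  (\forall q \near p, h q = h' q) -> dfun p h u = dfun p h' u.
Proof.
move=> hh'; apply: near_eq_derive.
have := near_chart (mem_chart_at p) hh'.
apply: (@filterS _ (nbhs (chart_at p p)) (nbhs_filter _)) => x [] //.
Qed.

Section tangent_coordinates.
Variables (c : chart R M m) (p : M).
Hypotheses (ac : atlas c) (cp : chart_dom c p).
Let a := chart_at p.
Let ap : chart_dom a p. Proof. exact: mem_chart_at. Qed.
Let aa : atlas a. Proof. exact: chart_at_atlas. Qed.

(** The inverse of [dfun p c] (see [dfun_tvec], [tvec_dfun]): it turns components in the chart [c]
    into components in the preferred chart. *)
Definition tvec (v : 'rV[R]_m) : 'rV[R]_m := 'D_v (a \o chart_inv c) (c p).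

Let oT (d e : chart R M m) : open (d @` (chart_dom d `&` chart_dom e)).
Proof. by apply: chart_image_open; exact: chart_dom_open. Qed.

Lemma dfun_chartM u : dfun p c u = u *m jac (c \o chart_inv a) (a p).
Proof.
have /smooth_onP/(_ 1%N) C1 := atlas_compatible aa ac.
have ip : (a @` (chart_dom a `&` chart_dom c)) (a p) by exists p.
exact: (derive_jac u (@oT a c) ip C1).
Qed.

Lemma tvecM v : tvec v = v *m jac (a \o chart_inv c) (c p).
Proof.
have /smooth_onP/(_ 1%N) C1 := atlas_compatible ac aa.
have ip : (c @` (chart_dom c `&` chart_dom a)) (c p) by exists p.
exact: (derive_jac v (@oT c a) ip C1).
Qed.

Lemma dfun_tvec v : dfun p c (tvec v) = v.
Proof.
have dc : differentiable (c \o chart_inv a) (a p).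
  apply: (smooth_target_rV R m).2 (@oT a c) (atlas_compatible aa ac) _; by exists p.
have da : derivable (a \o chart_inv c) (c p) v.
  apply: smooth_on_derivable (atlas_compatible ac aa) _; by exists p.
have E : (a \o chart_inv c) (c p) = a p by rewrite /= chart_funK.
have [_] := @is_derive_comp _ _ _ _ (c \o chart_inv a) (a \o chart_inv c) (c p) v da
  ltac:(by rewrite E).
rewrite E => h; rewrite /dfun -/a /tvec -h.
rewrite (@near_eq_derive _ _ _ _ id); first exact: derive_id.
have an : nbhs p (chart_dom a).
  by apply: open_nbhs_nbhs; split=> //; exact: chart_dom_open.
have ci : nbhs (c p) (chart_img c).
  by apply: open_nbhs_nbhs; split; [exact: chart_img_open|exact: chart_imgE].
apply: (@filterS _ (nbhs (c p)) (nbhs_filter _) _ _ _ (filterI ci (near_chart cp an))).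
by move=> x [/chart_imgP[_ xE] [_ ax]] /=; rewrite chart_funK.
Qed.

Lemma tvec_dfun u : tvec (dfun p c u) = u.
Proof.
have inj : forall v v' : 'rV[R]_m, v *m jac (c \o chart_inv a) (a p) =
    v' *m jac (c \o chart_inv a) (a p) -> v = v'.
  have JJ : jac (a \o chart_inv c) (c p) *m jac (c \o chart_inv a) (a p) = 1%:M.
    apply/row_matrixP => i; rewrite row_mul -dfun_chartM rowE -tvecM dfun_tvec.
    by rewrite rowE mulmx1.
  move=> v v' E; have := congr1 (fun z => z *m jac (a \o chart_inv c) (c p)) E.
  by rewrite -!mulmxA (mulmx1C JJ) !mulmx1.
by apply: inj; rewrite -!dfun_chartM dfun_tvec.
Qed.

Lemma coord_vectorE i : coord_vector c p i = tvec (std_basis R i).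
Proof. by []. Qed.

Lemma form_evalE (w : M -> 'M[R]_m) u v :
  form_eval (w p) u v = form_eval (local_form w c (c p)) (dfun p c u) (dfun p c v).
Proof.
set J := jac (a \o chart_inv c) (c p).
have -> : local_form w c (c p) = J *m w p *m J^T.
  apply/matrixP => i j; rewrite mxE chart_funK // !coord_vectorE !tvecM -/J.
  by rewrite form_eval_mul form_eval_basis.
by rewrite -form_eval_mul -!tvecM !tvec_dfun.
Qed.

End tangent_coordinates.

Lemma dfun_linear (W : normedModType R) p (h : M -> W) u v k :
  differentiable (h \o chart_inv (chart_at p)) (chart_at p p) ->
  dfun p h (k *: u + v) = k *: dfun p h u + dfun p h v.
Proof. by move=> dh; rewrite /dfun !deriveE // linearP. Qed.

Theorem local_inverse (W : set M) (Theta : M -> 'rV[R]_m) p :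
  open W -> W p -> smooth_fun W Theta -> (forall u, dfun p Theta u = 0 -> u = 0) ->
  exists (r : R) (kappa : 'rV[R]_m -> M),
   [/\ 0 < r, smooth_into (ball (Theta p) r) kappa,
       forall z, ball (Theta p) r z -> W (kappa z) /\ Theta (kappa z) = z,
       kappa (Theta p) = p
     & \forall q \near p, ball (Theta p) r (Theta q) /\ kappa (Theta q) = q].
Proof.
move=> oW Wp TS inj; set a := chart_at p.
have ap : chart_dom a p by exact: mem_chart_at.
have aa : atlas a by exact: chart_at_atlas.
have [ O [ oO Op OS OW]] := smooth_fun_comp_chart oW TS aa ap Wp.
have TE : (Theta \o chart_inv a) (a p) = Theta p by rewrite /= chart_funK.
have [r [G [r0 GS Gin Gp Gn]]] := inverse_function oO Op OS inj.
rewrite TE in GS Gin Gp Gn.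
exists r, (chart_inv a \o G).
have oB : open (ball (Theta p) r) by exact: ball_open.
have GO z : ball (Theta p) r z -> O (G z) by move=> /Gin[].
have aG z : ball (Theta p) r z -> a (chart_inv a (G z)) = G z.
  by move=> /GO /OW[].
have kc z : ball (Theta p) r z -> {for z, continuous (chart_inv a \o G)}.
  move=> zB; apply: continuous_comp; first exact: smooth_on_continuous GS zB.
  rewrite /= -[G z](aG z zB); apply: chart_inv_continuous.
  by have [] := OW _ (GO z zB).
split=> //=.
- split=> // d ad.
  have -> : d \o (chart_inv a \o G) = (d \o chart_inv a) \o G by [].
  apply: (smooth_on_comp _ _ _ (atlas_compatible aa ad)).
  + by apply: open_setI_preimage => //; exact: chart_dom_open.
  + by apply: chart_image_open; exact: chart_dom_open.
  + move=> z [zB dz]; exists (chart_inv a (G z)); last exact: aG.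
    by split=> //; have [] := OW _ (GO z zB).
  + by apply: smooth_on_subset GS => z [].
- by move=> z zB; have [] := OW _ (GO z zB); have [_ /= ->] := Gin z zB.
- by rewrite Gp chart_funK.
have an : nbhs p (chart_dom a).
  by apply: open_nbhs_nbhs; split=> //; exact: chart_dom_open.
apply: (@filterS _ (nbhs p) (nbhs_filter _) _ _ _
  (filterI an (chart_continuous ap Gn))) => q [aq [/=]].
by rewrite chart_funK // => qB ->; rewrite chart_funK.
Qed.

End charts.

Arguments chart_image_open {R m M} c {W} _.

(** * Continuation along paths *)

Section connectedness.

(** The form in which connectedness drives every continuation below: both [P] and its negation
    propagate to nearby points. *)
Lemma connected_clopen (T : topologicalType) (I : set T) (P : T -> Prop) :
  open I -> connected I ->
  (forall x, I x -> P x -> \forall y \near x, P y) ->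
  (forall x, I x -> ~ P x -> \forall y \near x, ~ P y) ->
  forall x y, I x -> I y -> P x -> P y.
Proof.
move=> oI cI Pop Pcl x y Ix Iy Px.
suff: (I `&` P) = I by move=> E; have [] : (I `&` P) y by rewrite E.
apply: cI; first by exists x.
- exists (I `&` P); last by rewrite setIA setIid.
  rewrite openE => z [Iz Pz]; apply: filterI (Pop z Iz Pz).
  exact: open_nbhs_nbhs.
exists (~` (I `&` ~` P)).
  apply: open_closedC; rewrite openE => z [Iz Pz]; apply: filterI (Pcl z Iz Pz).
  exact: open_nbhs_nbhs.
apply/seteqP; split=> z [Iz]; first by move=> Pz; split=> // -[].
by move=> nz; split=> //; apply: contrapT => nPz; exact: nz.
Qed.

Lemma connected_clopenR (R : realType) (P : R -> Prop) :
  (forall x, P x -> \forall y \near x, P y) ->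
  (forall x, ~ P x -> \forall y \near x, ~ P y) ->
  forall x y, P x -> P y.
Proof.
move=> Pop Pcl x y Px.
have cT : connected [set: R] by apply/connected_intervalP.
exact: (@connected_clopen R setT P openT cT (fun x _ => Pop x) (fun x _ => Pcl x)
  x y Logic.I Logic.I Px).
Qed.

Lemma nbhs_box (R : realType) (s t : R) (P : R * R -> Prop) :
  nbhs (s, t) P -> exists2 e : R, 0 < e &
    forall s' t', `|s' - s| < e -> `|t' - t| < e -> P (s', t').
Proof.
move=> /nbhs_ballP[e /= e0 H]; exists e => // s' t' h1 h2.
by apply: H; split; rewrite /= -ball_normE /= distrC.
Qed.

Lemma box_nbhs (R : realType) (s t e : R) (P : R * R -> Prop) : 0 < e ->
  (forall s' t', `|s' - s| < e -> `|t' - t| < e -> P (s', t')) -> nbhs (s, t) P.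
Proof.
move=> e0 H; apply/nbhs_ballP; exists e => // -[s' t'] [] /=.
by rewrite -!ball_normE /= => h1 h2; apply: H; rewrite distrC.
Qed.

End connectedness.

Section homotopy_lifting.
Variables (R : realType) (S : Type).
(* [G h z] reads: near [z], [h] is a local section of the given covering *)
Variable (G : (R * R -> S) -> R * R -> Prop).
Hypothesis G_open : forall h z, G h z -> \forall z' \near z, G h z'.
Hypothesis G_eq : forall h1 h2 z, G h1 z -> G h2 z -> h1 z = h2 z ->
  \forall z' \near z, h1 z' = h2 z'.
Hypothesis G_neq : forall h1 h2 z, G h1 z -> G h2 z -> h1 z <> h2 z ->
  \forall z' \near z, h1 z' <> h2 z'.
Hypothesis G_ext : forall h1 h2 z, G h1 z -> (\forall z' \near z, h1 z' = h2 z') ->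
  G h2 z.

(** For fixed [s0], the set of [t] such that [h] is a section near [(s0, t)] is open and closed, and
    it contains 0 by the hypothesis on the bottom line. *)
Lemma homotopy_lifting (h : R * R -> S) :
  (forall s t, exists2 h', G h' (s, t) & \forall r \near t, h (s, r) = h' (s, r)) ->
  (forall s h', G h' (s, 0) -> h' (s, 0) = h (s, 0) ->
    \forall s' \near s, h (s', 0) = h' (s', 0)) ->
  forall z, G h z.
Proof.
move=> line base [s0 t].
(* In a box around [(s0, t0)] where [h'] is a section, agreement of [h] and [h'] on one horizontal
   slice spreads over the box along the vertical lines. *)
have key t0 : exists2 h', G h' (s0, t0) & exists2 e : R, 0 < e &
    (forall r, `|r - t0| < e -> h (s0, r) = h' (s0, r) /\ G h' (s0, r)) /\
    forall r1, `|r1 - t0| < e -> (\forall s \near s0, h (s, r1) = h' (s, r1)) ->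
      forall r, `|r - t0| < e -> G h (s0, r).
  have [h' Gh' hh'] := line s0 t0; exists h' => //.
  have [e1 e10 H1] := nbhs_box (G_open Gh').
  have [e2 e20 H2] := (nbhs_normE _ _).1 hh'.
  exists (Num.min e1 e2); first by rewrite lt_min e10.
  split=> [r|r1 r1e near1 r re].
    rewrite lt_min => /andP[h1 h2]; split; first exact: H2.
    by apply: H1 => //; rewrite subrr normr0.
  set e := Num.min e1 e2 in r1e re.
  have e0 : 0 < e by rewrite lt_min e10.
  have [e3 e30 H3] := (nbhs_normE _ _).1 near1.
  have Gl s r' : `|s - s0| < e -> `|r' - t0| < e -> G h' (s, r').
    by rewrite !lt_min => /andP[? _] /andP[? _]; exact: H1.
  clearbody e; pose I := ball t0 e.
  have IE r' : I r' <-> `|r' - t0| < e by rewrite /I -ball_normE /= distrC.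
  (* For fixed [s], both maps are sections along a connected interval, so they agree throughout once
     they agree at height [r1]. *)
  have agree s r' : `|s - s0| < e -> `|s - s0| < e3 -> I r' -> h (s, r') = h' (s, r').
    move=> se se3 Ir'.
    have P1 : h (s, r1) = h' (s, r1) by exact: H3.
    move: P1; apply: (@connected_clopen R I (fun r' => h (s, r') = h' (s, r'))) => //.
    - exact: ball_open.
    - apply/connected_intervalP => x y /IE xI /IE yI z /andP[xz zy].
      by apply/IE; move: xI yI; rewrite !ltr_norml => /andP[? ?] /andP[? ?]; lra.
    - move=> x /IE Ix E; have [h'' Gh'' hh''] := line s x.
      have E' : h'' (s, x) = h' (s, x) by rewrite -E; exact/esym/(nbhs_singleton hh'').
      have [d d0 Hd] := nbhs_box (G_eq Gh'' (Gl _ _ se Ix) E').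
      have nd : \forall y \near x, `|y - x| < d by apply/nbhs_normE; exists d.
      apply: filterS2 hh'' nd => y -> yx; apply: Hd => //.
      by rewrite subrr normr0.
    - move=> x /IE Ix E; have [h'' Gh'' hh''] := line s x.
      have E' : h'' (s, x) <> h' (s, x) by rewrite -(nbhs_singleton hh'').
      have [d d0 Hd] := nbhs_box (G_neq Gh'' (Gl _ _ se Ix) E').
      have nd : \forall y \near x, `|y - x| < d by apply/nbhs_normE; exists d.
      apply: filterS2 hh'' nd => y -> yx; apply: Hd => //.
      by rewrite subrr normr0.
    - exact/IE.
  apply: (@G_ext h'); first by apply: Gl => //; rewrite subrr normr0.
  have d0 : 0 < Num.min (Num.min e e3) (e - `|r - t0|).
    by rewrite !lt_min e0 e30 subr_gt0.
  apply: (box_nbhs d0) => s r'; rewrite !lt_min => /andP[/andP[se se3] _] /andP[_ r'e].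
  apply/esym/agree => //; apply/IE.
  have -> : r' - t0 = (r' - r) + (r - t0) by rewrite addrA subrK.
  by apply: (le_lt_trans (ler_normD _ _)); rewrite -ltrBrDr.
have slice h1 h2 t0 : G h1 (s0, t0) -> G h2 (s0, t0) -> h1 (s0, t0) = h2 (s0, t0) ->
    \forall s \near s0, h1 (s, t0) = h2 (s, t0).
  move=> G1 G2 E; have [d d0 Hd] := nbhs_box (G_eq G1 G2 E).
  by apply/nbhs_normE; exists d => // s sd; apply: Hd => //; rewrite subrr normr0.
have Q0 : G h (s0, 0).
  have [h' Gh' [e e0 [H1 H2]]] := key 0.
  apply: (H2 0); rewrite ?subrr ?normr0 //.
  by apply: base => //; have [|->] := H1 0; rewrite ?subrr ?normr0.
move: Q0; apply: (@connected_clopenR R (fun t => G h (s0, t))) => t0 Qt0.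
  have [h' Gh' [e e0 [H1 H2]]] := key t0.
  apply/nbhs_normE; exists e => // r re; apply: (H2 t0) => //.
    by rewrite subrr normr0.
  by apply: slice => //; have [|->] := H1 t0; rewrite ?subrr ?normr0.
have [h' Gh' [e e0 [H1 H2]]] := key t0.
apply/nbhs_normE; exists e => // r re Qr; apply: Qt0.
apply: (H2 r) => //; last by rewrite subrr normr0.
by have [E G'] := H1 r re; exact: slice.
Qed.

End homotopy_lifting.

Section clamp.
Variable R : realType.

(** Extends paths on [0, 1] to all of [R] by constants, so that continuity and connectedness can be
    used without restricting domains. *)
Definition clamp (t : R) : R := Num.max 0 (Num.min t 1).

Lemma clamp_itv t : 0 <= clamp t <= 1.
Proof. by rewrite /clamp le_max lexx ge_max ler01 ge_min lexx orbT. Qed.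

Lemma clamp_id t : 0 <= t <= 1 -> clamp t = t.
Proof. by move=> /andP[t0 t1]; rewrite /clamp min_l // max_r. Qed.

Lemma clamp_continuous : continuous clamp.
Proof.
move=> t; apply: (@continuous_max _ _ (cst 0) (fun t : R => Num.min t 1) t).
  exact: cst_continuous.
by apply: (@continuous_min _ _ id (cst 1) t); [exact: cvg_id|exact: cst_continuous].
Qed.

Lemma clamp0 : clamp 0 = 0. Proof. by rewrite clamp_id // lexx ler01. Qed.
Lemma clamp1 : clamp 1 = 1. Proof. by rewrite clamp_id // lexx ler01. Qed.

Lemma continuous_within_comp (X T T' : topologicalType) (A : set T) (f : T -> T')
    (c : X -> T) : {within A, continuous f} -> continuous c -> (forall x, A (c x)) ->
  continuous (f \o c).
Proof.
move=> /subspace_continuousP fA cc cA x N /(fA _ (cA x)) NN.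
exact: (@filterS _ (nbhs x) (nbhs_filter x) _ _ (fun y H => H (cA y)) (cc x _ NN)).
Qed.

Lemma nbhsS (X : topologicalType) (x : X) (A C : set X) :
  nbhs x A -> (forall y, A y -> C y) -> nbhs x C.
Proof. by move=> xA AC; apply: filterS xA. Qed.

Lemma nbhsS3 (X : topologicalType) (x : X) (A B D C : set X) :
  nbhs x A -> nbhs x B -> nbhs x D -> (forall y, A y -> B y -> D y -> C y) ->
  nbhs x C.
Proof. by move=> xA xB xD ABC; apply: filterS3 xA xB xD. Qed.

Lemma nbhsS2 (X : topologicalType) (x : X) (A B C : set X) :
  nbhs x A -> nbhs x B -> (forall y, A y -> B y -> C y) -> nbhs x C.
Proof. by move=> xA xB ABC; apply: filterS2 xA xB. Qed.

Lemma continuous_pair (X T1 T2 : topologicalType) (f : X -> T1) (g : X -> T2) :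
  continuous f -> continuous g -> continuous (fun x => (f x, g x)).
Proof. by move=> cf cg x; exact: (cvg_pair (cf x) (cg x)). Qed.

Lemma continuous_paste (T : topologicalType) (a b : R -> T) (t0 : R) :
  continuous a -> continuous b -> a t0 = b t0 ->
  continuous (fun t => if t <= t0 then a t else b t).
Proof.
move=> ca cb ab t N; case: (ltgtP t t0) => [tt0|tt0|tE].
- move=> aN; have lt : nbhs t [set u | u < t0].
    by apply: open_nbhs_nbhs; split=> //; exact: open_lt.
  by apply: (nbhsS2 lt (ca t N aN)) => u /= ut; rewrite ltW.
- move=> bN; have gt : nbhs t [set u | t0 < u].
    by apply: open_nbhs_nbhs; split=> //; exact: open_gt.
  by apply: (nbhsS2 gt (cb t N bN)) => u /= ut; rewrite leNgt ut.
- subst t0 => aN; have bN : nbhs (b t) N by rewrite -ab.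
  by apply: (nbhsS2 (ca t N aN) (cb t N bN)) => u /= au bu; case: ifP.
Qed.

End clamp.

(** * Continuation of primitives and monodromy *)

Section development.
Variables (R : realType) (M : topologicalType) (V : zmodType).
(* [GG W g]: on the open set [W], [g] is a local primitive along [F] *)
Variables (F : set M) (GG : set M -> (M -> V) -> Prop).
Hypothesis GG_open : forall W g, GG W g -> open W.
Hypothesis GG_cover : forall p, F p -> exists W, exists2 g, GG W g & W p.
Hypothesis GG_compat : forall W1 g1 W2 g2 p, GG W1 g1 -> GG W2 g2 -> W1 p -> W2 p ->
  F p -> \forall q \near p, F q -> g1 q - g2 q = g1 p - g2 p.

(** [h] continues the local primitives along [gamma]: near [t] it differs from some [g] composed
    with [gamma] by a constant. *)
Definition dev_at (gamma : R -> M) (h : R -> V) (t : R) :=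
  exists W g, [/\ GG W g, W (gamma t)
    & \forall r \near t, h r - g (gamma r) = h t - g (gamma t)].

Definition dev gamma h := forall t, dev_at gamma h t.

Lemma GG_compat_path (X : topologicalType) (gamma : X -> M) W1 g1 W2 g2 (x : X) :
  {for x, continuous gamma} -> (forall y, F (gamma y)) -> GG W1 g1 -> GG W2 g2 ->
  W1 (gamma x) -> W2 (gamma x) ->
  \forall y \near x, g1 (gamma y) - g2 (gamma y) = g1 (gamma x) - g2 (gamma x).
Proof.
move=> cg Fg G1 G2 W1x W2x.
by apply: (nbhsS (cg _ (GG_compat G1 G2 W1x W2x (Fg x)))) => y; apply; exact: Fg.
Qed.

Lemma dev_unique gamma h1 h2 : continuous gamma -> (forall t, F (gamma t)) ->
  dev gamma h1 -> dev gamma h2 -> forall t t', h1 t - h2 t = h1 t' - h2 t'.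
Proof.
move=> cg Fg d1 d2.
have loc t : \forall r \near t, h1 r - h2 r = h1 t - h2 t.
  have [W1 [g1 [G1 W1t n1]]] := d1 t; have [W2 [g2 [G2 W2t n2]]] := d2 t.
  have n := GG_compat_path (cg t) Fg G1 G2 W1t W2t.
  apply: (nbhsS3 n1 n2 n) => r e1 e2 e3.
  rewrite -(subrKA (g1 (gamma r))) e1 -(subrKA (g2 (gamma r)) (g1 (gamma r))) e3.
  by rewrite -opprB -[g2 (gamma r) - h2 r]opprB opprB e2 opprB addrA subrKA subrKA.
move=> t t'; have := erefl (h1 t' - h2 t').
apply: (@connected_clopenR R (fun t => h1 t - h2 t = h1 t' - h2 t')) => r e.
  by apply: (nbhsS (loc r)) => u ->.
by apply: (nbhsS (loc r)) => u ->.
Qed.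

Lemma dev_at_shift gamma h t v : dev_at gamma h t -> dev_at gamma (fun r => h r + v) t.
Proof.
move=> [W [g [G Wt n]]]; exists W, g; split=> //; apply: (nbhsS n) => r e.
by rewrite addrAC e addrAC.
Qed.

Lemma dev_at_comp gamma h (a : R -> R) t : {for t, continuous a} ->
  dev_at gamma h (a t) -> dev_at (gamma \o a) (h \o a) t.
Proof. by move=> ca [W [g [G Wt n]]]; exists W, g; split=> //; exact: (ca _ n). Qed.

Lemma near_eq_dev_at gamma h gamma' h' t : dev_at gamma h t ->
  (\forall r \near t, gamma r = gamma' r /\ h r = h' r) -> dev_at gamma' h' t.
Proof.
move=> [W [g [G Wt n]]] e; have [e1 e2] := nbhs_singleton e.
exists W, g; split=> //; first by rewrite -e1.
by apply: (nbhsS2 n e) => r + [<- <-]; rewrite e1 e2.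
Qed.

Lemma dev_at_local gamma W g t : GG W g -> W (gamma t) -> dev_at gamma (g \o gamma) t.
Proof. by move=> G Wt; exists W, g; split=> //; near=> r; rewrite !subrr.
Unshelve. all: by end_near. Qed.

Lemma dev_at_paste gamma1 h1 gamma2 h2 t0 t :
  continuous gamma1 -> continuous gamma2 ->
  (forall t, F (gamma1 t)) -> (forall t, F (gamma2 t)) ->
  (t <= t0 -> dev_at gamma1 h1 t) -> (t0 <= t -> dev_at gamma2 h2 t) ->
  gamma1 t0 = gamma2 t0 -> h1 t0 = h2 t0 ->
  dev_at (fun t => if t <= t0 then gamma1 t else gamma2 t)
    (fun t => if t <= t0 then h1 t else h2 t) t.
Proof.
move=> c1 c2 F1 F2 d1 d2 g12 h12; have [tt0|tt0|tE] := ltgtP t t0.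
- apply: near_eq_dev_at (d1 (ltW tt0)) _.
  have N : nbhs t [set u | u < t0] by apply: open_nbhs_nbhs; split=> //; exact: open_lt.
  by apply: (nbhsS N) => u /= ut; rewrite ltW.
- apply: near_eq_dev_at (d2 (ltW tt0)) _.
  have N : nbhs t [set u | t0 < u] by apply: open_nbhs_nbhs; split=> //; exact: open_gt.
  by apply: (nbhsS N) => u /= ut; rewrite leNgt ut.
subst t; have [W1 [g1 [G1 W1t n1]]] := d1 (lexx _).
have [W2 [g2 [G2 W2t n2]]] := d2 (lexx _).
exists W1, g1; split; rewrite ?lexx //.
rewrite -g12 in W2t.
have W1t' : W1 (gamma2 t0) by rewrite -g12.
have W2t' : W2 (gamma2 t0) by rewrite -g12.
have n := GG_compat_path (c2 t0) F2 G1 G2 W1t' W2t'.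
apply: (nbhsS3 n1 n2 n) => r e1 e2 e3; case: ifP => // _.
rewrite h12 g12 -(subrKA (g2 (gamma2 r))) e2.
have -> : g2 (gamma2 r) - g1 (gamma2 r) = g2 (gamma2 t0) - g1 (gamma2 t0).
  by rewrite -opprB e3 opprB.
by rewrite subrKA.
Qed.

(** Connectedness is applied to the set of [T] for which a continuation exists on [0, T]. *)
Lemma dev_exists gamma : continuous gamma -> (forall t, F (gamma t)) ->
  exists h, dev (gamma \o @clamp R) h.
Proof.
move=> cg Fg.
pose P (T : R) := exists h, forall t, 0 <= t <= T -> dev_at gamma h t.
have dev_at_nbhs h t : dev_at gamma h t -> \forall r \near t, dev_at gamma h r.
  move=> [W [g [G Wt n]]].
  have Wr : \forall r \near t, W (gamma r).
    by apply: cg; apply: open_nbhs_nbhs; split=> //; exact: GG_open G.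
  apply: (nbhsS2 Wr (nbhs_interior n)) => r Wr' nr; exists W, g; split=> //.
  by have e := nbhs_singleton nr; apply: (nbhsS nr) => u ->.
suff [h hP] : P 1.
  exists (h \o @clamp R) => t; apply: dev_at_comp; first exact: clamp_continuous.
  by apply: hP; exact: clamp_itv.
(* For negative [T] the condition is vacuous, which starts the argument. *)
have P0 : P (-1).
  exists (cst 0) => t /andP[t0 t1]; have := le_trans t0 t1.
  by rewrite oppr_ge0 real_leNgt ?num_real // ltr01.
move: P0; apply: connected_clopenR => T0.
  have [T00 _|T00 [h hP]] := ltP T0 0.
    have N : nbhs T0 [set u | u < 0] by apply: open_nbhs_nbhs; split=> //; exact: open_lt.
    apply: (nbhsS N) => T /= T0'; exists (cst 0) => t /andP[t0 t1].
    by have := le_trans t0 t1; rewrite leNgt T0'.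
  have dT0 : dev_at gamma h T0 by apply: hP; rewrite T00 lexx.
  have [e e0 He] := (nbhs_normE _ _).1 (dev_at_nbhs _ _ dT0).
  apply/nbhs_normE; exists e => // T Te; exists h => t /andP[t0 tT].
  have [tT0|tT0] := leP t T0; first by apply: hP; rewrite t0.
  apply: He; rewrite gtr0_norm ?subr_gt0 //.
  by apply: le_lt_trans Te; rewrite ger0_norm ?subr_ge0 ?lerB2r ?lerD2r // (le_trans (ltW tT0)).
move=> nP; have [W [g G WT]] := GG_cover (Fg T0).
have Wn : nbhs T0 (gamma @^-1` W).
  by apply: cg; apply: open_nbhs_nbhs; split=> //; exact: GG_open G.
have [e e0 He] := (nbhs_normE _ _).1 Wn.
apply/nbhs_normE; exists e => // T1 T1e [h hP]; apply: nP.
exists (fun t => if t <= T1 then h t else g (gamma t) + (h T1 - g (gamma T1))).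
move=> t /andP[t0 tT0].
apply: near_eq_dev_at (_ : dev_at (fun t => if t <= T1 then gamma t else gamma t) _ t) _; last first.
  by near=> r; split; [case: ifP|reflexivity].
apply: dev_at_paste => //.
- by move=> tT1; apply: hP; rewrite t0.
- move=> T1t; apply: (dev_at_shift (h T1 - g (gamma T1))).
  apply: (dev_at_local G); apply: He.
  rewrite ler0_norm ?subr_le0 // opprB; apply: le_lt_trans T1e.
  by rewrite ler0_norm ?subr_le0 ?(le_trans T1t) // opprB lerD2l lerN2.
- by rewrite addrC subrK.
Unshelve. all: by end_near. Qed.

(** The monodromy theorem: the continuations along the curves of a null homotopy fit together, so
    their final value is the same for the loop and for the constant path. *)
Lemma loop_dev gamma h : continuous gamma -> (forall t, F (gamma t)) ->
  null_homotopic_loop F gamma -> gamma 0 = gamma 1 -> dev gamma h -> h 1 = h 0.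
Proof.
move=> cg Fg [H [cH FH H0 H1 Hs]] loop dh.
pose cl (z : R * R) : R * R := (clamp z.1, clamp z.2).
have clA z : (`[0, 1] `*` `[0, 1])%classic (cl z).
  by split; rewrite /= in_itv /= clamp_itv.
have ccl : continuous cl.
  apply: (@continuous_pair _ _ _ (fun z : R * R => clamp z.1)
    (fun z : R * R => clamp z.2)) => z.
    by apply: (@continuous_comp _ _ _ fst); [exact: cvg_fst|exact: clamp_continuous].
  by apply: (@continuous_comp _ _ _ snd); [exact: cvg_snd|exact: clamp_continuous].
pose Hc := H \o cl.
have cHc : continuous Hc by exact: continuous_within_comp cH ccl clA.
have FHc z : F (Hc z) by exact/FH/clA.
have pairc (s : R) : continuous (fun t : R => (s, t)).
  move=> t N sN; have [e e0 He] := @nbhs_box R s t N sN; apply/nbhs_normE; exists e => // u ut.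
  by apply: He; rewrite ?subrr ?normr0.
have pairc' (t : R) : continuous (fun s : R => (s, t)).
  move=> s N sN; have [e e0 He] := @nbhs_box R s t N sN; apply/nbhs_normE; exists e => // u us.
  by apply: He; rewrite ?subrr ?normr0.
have cl_cl t : clamp (clamp t) = clamp t :> R by rewrite clamp_id // clamp_itv.
(* One continuation for each curve of the homotopy, normalised to start at 0; nothing is known yet
   about the dependence on [s]. *)
have [k Hk] : exists k : R -> R -> V, forall s,
    k s 0 = 0 /\ dev (fun t => Hc (s, t)) (k s).
  suff: forall s : R, exists ks : R -> V, ks 0 = 0 /\ dev (fun t => Hc (s, t)) ks.
    by move=> /choice[k Hk]; exists k.
  move=> s; have [|t|ks dks] := @dev_exists (fun t => Hc (s, t)).
  - by move=> t; apply: continuous_comp; [exact: pairc|exact: cHc].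
  - exact: FHc.
  exists (fun t => ks t + - ks 0); split; first by rewrite subrr.
  move=> t; apply: dev_at_shift; apply: near_eq_dev_at (dks t) _.
  by near=> r; split=> //; rewrite /= /Hc /cl /= cl_cl.
pose G (u : R * R -> V) z := exists W g v, [/\ GG W g, W (Hc z)
  & \forall z' \near z, u z' - g (Hc z') = v].
have Gdiff u1 u2 z : G u1 z -> G u2 z ->
    \forall z' \near z, u1 z' - u2 z' = u1 z - u2 z.
  move=> [W1 [g1 [v1 [G1 W1z n1]]]] [W2 [g2 [v2 [G2 W2z n2]]]].
  have n := GG_compat_path (cHc z) FHc G1 G2 W1z W2z.
  have key a b c d : a - c = v1 -> b - d = v2 -> a - b = v1 - v2 + (c - d).
    by move=> <- <-; rewrite opprB addrAC !addrA !subrK.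
  have E := key _ _ _ _ (nbhs_singleton n1) (nbhs_singleton n2).
  apply: (nbhsS3 n1 n2 n) => z' e1 e2 e3.
  by rewrite (key _ _ _ _ e1 e2) e3 E.
have GH : forall z, G (fun z => k z.1 z.2) z.
  apply: homotopy_lifting.
  - move=> u z [W [g [v [GW Wz n]]]].
    have Wn : \forall z' \near z, W (Hc z').
      by apply: cHc; apply: open_nbhs_nbhs; split=> //; exact: GG_open GW.
    by apply: (nbhsS2 Wn (nbhs_interior n)) => z' Wz' nz'; exists W, g, v.
  - move=> u1 u2 z G1 G2 E; apply: (nbhsS (Gdiff _ _ _ G1 G2)) => z'.
    by rewrite E subrr => /eqP; rewrite subr_eq0 => /eqP.
  - move=> u1 u2 z G1 G2 E; apply: (nbhsS (Gdiff _ _ _ G1 G2)) => z' + E'.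
    by rewrite E' subrr => /esym/eqP; rewrite subr_eq0 => /eqP.
  - move=> u1 u2 z [W [g [v [GW Wz n]]]] e; exists W, g, v; split=> //.
    by apply: (nbhsS2 n e) => z' + <-.
  - move=> s t; have [k0 dk] := Hk s; have [W [g [GW Wt n]]] := dk t.
    exists (fun z => g (Hc z) + (k s t - g (Hc (s, t)))).
      exists W, g, (k s t - g (Hc (s, t))); split=> //.
      by near=> z'; rewrite addrC addKr.
    by apply: (nbhsS n) => r /= <-; rewrite addrC subrK.
  - move=> s u [W [g [v [GW Wz n]]]] /= us0.
    have [k0 _] := Hk s; rewrite k0 in us0.
    have E s' : Hc (s', 0) = gamma 0.
      rewrite /Hc /cl /= clamp0; have [|-> _] := Hs (clamp s') => //.
      by rewrite /= in_itv /= clamp_itv.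
    apply: (nbhsS (pairc' 0 s _ n)) => s' /=.
    have [-> _] := Hk s'.
    rewrite E; have := nbhs_singleton n; rewrite E us0 => <- /(addIr _) ->.
    by [].
(* All curves end at the base point, so a local primitive is constant along the edge [t = 1], and
   hence so is [k]. *)
have const1 : k 0 1 = k 1 1.
  have E s : Hc (s, 1) = gamma 0.
    rewrite /Hc /cl /= clamp1; have [|_ ->] := Hs (clamp s) => //.
    by rewrite /= in_itv /= clamp_itv.
  have loc s : \forall s' \near s, k s' 1 = k s 1.
    have [W [g [v [GW Wz n]]]] := GH (s, 1).
    apply: (nbhsS (pairc' 1 s _ n)) => s' /=.
    by have := nbhs_singleton n; rewrite /= !E => <- /(addIr _) ->.
  apply: (@connected_clopenR R (fun s => k s 1 = k 1 1) _ _ 1 0) => // s e.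
    by apply: (nbhsS (loc s)) => s' ->.
  by apply: (nbhsS (loc s)) => s' ->.
have k11 : k 1 1 = 0.
  have [k0 dk] := Hk 1.
  have dc : dev (fun t => Hc (1, t)) (cst 0).
    move=> t; have [W [g G' Wt]] := GG_cover (FHc (1, t)).
    apply: near_eq_dev_at (dev_at_shift (- g (gamma 0)) (dev_at_local G' Wt)) _.
    near=> r; split=> //=; rewrite /Hc /cl /= clamp1 H1 ?subrr //.
    by rewrite /= in_itv /= clamp_itv.
  have := dev_unique _ _ dk dc 1 0; rewrite k0 !subr0; apply.
    by move=> t; apply: continuous_comp; [exact: pairc|exact: cHc].
  by move=> t; exact: FHc.
have E0 : (fun t => Hc (0, t)) = gamma \o @clamp R.
  apply/funext => t; rewrite /Hc /cl /= clamp0 H0 //.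
  by rewrite /= in_itv /= clamp_itv.
have [k0 dk] := Hk 0; rewrite E0 in dk.
have dhc : dev (gamma \o @clamp R) (h \o @clamp R).
  by move=> t; apply: dev_at_comp => //; exact: clamp_continuous.
have := dev_unique _ _ dhc dk 1 0.
rewrite /= clamp0 clamp1 const1 k11 k0 !subr0; apply.
  by move=> t; apply: continuous_comp; [exact: clamp_continuous|exact: cg].
by move=> t; exact: Fg.
Unshelve. all: by end_near. Qed.

Hypothesis GG_path : forall W g p, GG W g -> W p -> F p ->
  \forall q \near p, F q -> exists mid : R -> M, [/\ continuous mid,
    forall t, F (mid t) /\ W (mid t), mid 0 = p & mid 1 = q].

(** [G p] is the final value of the continuation along a chosen path from [p0] to [p]. The choices
    at [p] and at a nearby [q] are compared by the loop that goes to [p], crosses to [q] inside [W],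
    and returns along the path of [q]. *)
Lemma fibre_primitive : simply_connected R F ->
  exists G : M -> V, forall W g p, GG W g -> W p -> F p ->
    \forall q \near p, F q -> G q - g q = G p - g p.
Proof.
move=> [[[p0 Fp0] pc] sc].
have pathP p : exists gh : (R -> M) * (R -> V), F p ->
    [/\ continuous gh.1, forall t, F (gh.1 t), gh.1 0 = p0, gh.1 1 = p
      & gh.2 0 = 0 /\ dev gh.1 gh.2].
  have [Fp|] := pselect (F p); last by exists (cst p0, cst 0).
  have [gamma [[cg Fg] g0 g1]] := pc _ _ Fp0 Fp.
  have cgc : continuous (gamma \o @clamp R).
    apply: continuous_within_comp cg (@clamp_continuous R) _ => t.
    by rewrite /= in_itv /= clamp_itv.
  have Fgc t : F ((gamma \o @clamp R) t).
    by apply: Fg; rewrite /= in_itv /= clamp_itv.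
  have [h dh] := dev_exists cgc Fgc.
  exists (gamma \o @clamp R, fun t => h t + - h 0) => _; split=> //=.
  - by rewrite clamp0.
  - by rewrite clamp1.
  split=> [|t]; first by rewrite subrr.
  apply: dev_at_shift; apply: near_eq_dev_at (dh t) _.
  by near=> r; split=> //=; rewrite (clamp_id (clamp_itv r)).
have /choice[gh ghP] := pathP.
exists (fun p => (gh p).2 1) => W g p GW Wp Fp.
apply: (nbhsS (GG_path GW Wp Fp)) => q mq Fq.
have [mid [cm Fm m0 m1]] := mq Fq.
have [cp Fgp p0E p1E [hp0 dp]] := ghP p Fp.
have [cq Fgq q0E q1E [hq0 dq]] := ghP q Fq.
set gp := (gh p).1 in cp Fgp p0E p1E dp; set hp := (gh p).2 in hp0 dp *.
set gq := (gh q).1 in cq Fgq q0E q1E dq; set hq := (gh q).2 in hq0 dq *.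
(* The three legs of the loop are run on [0, 1], [1, 2] and, reversed, on [2, 3]; [b] below rescales
   [0, 1] to [0, 3]. *)
pose a2 : R -> R := fun t => t - 1; pose a3 : R -> R := fun t => 3 - t.
have ca2 : continuous a2.
  by move=> t; apply: cvgB; [exact: cvg_id|exact: cvg_cst].
have ca3 : continuous a3.
  by move=> t; apply: cvgB; [exact: cvg_cst|exact: cvg_id].
have c2 : continuous (mid \o a2) by move=> t; apply: continuous_comp; [exact: ca2|exact: cm].
have c3 : continuous (gq \o a3) by move=> t; apply: continuous_comp; [exact: ca3|exact: cq].
pose d23 t := if t <= 2 then (mid \o a2) t else (gq \o a3) t.
pose h23 t := if t <= 2 then g (mid (a2 t)) + (hp 1 - g p)
  else hq (a3 t) + (g q + (hp 1 - g p) - hq 1).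
have a22 : a2 2 = 1 by rewrite /a2; lra.
have a32 : a3 2 = 1 by rewrite /a3; lra.
have a21 : a2 1 = 0 by rewrite /a2; lra.
have le12 : (1 : R) <= 2 by lra.
have c23 : continuous d23 by apply: continuous_paste => //=; rewrite a22 a32 m1 q1E.
have F23 t : F (d23 t) by rewrite /d23; case: ifP => _ /=; [have [] := Fm (a2 t)|exact: Fgq].
have dev23 : dev d23 h23.
  move=> t; apply: dev_at_paste => //=.
  - by move=> u; have [] := Fm (a2 u).
  - move=> _; apply: (dev_at_shift (hp 1 - g p)).
    by apply: (@dev_at_local _ W g t GW); have [] := Fm (a2 t).
  - move=> _; apply: dev_at_shift; exact: (dev_at_comp (ca3 t) (dq _)).
  - by rewrite a22 a32 m1 q1E.
  - by rewrite a22 a32 m1 [RHS]addrC subrK.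
pose d t := if t <= 1 then gp t else d23 t.
pose h t := if t <= 1 then hp t else h23 t.
have cd : continuous d.
  by apply: continuous_paste => //; rewrite /d23 le12 /= a21 m0 p1E.
have Fd t : F (d t) by rewrite /d; case: ifP.
have devd : dev d h.
  move=> t; apply: dev_at_paste => //.
    by rewrite /d23 le12 /= a21 m0 p1E.
  by rewrite /h23 le12 a21 m0 [RHS]addrC subrK.
pose b : R -> R := fun t => 3 * t.
have cb : continuous b by move=> t; apply: cvgM; [exact: cvg_cst|exact: cvg_id].
have cdb : continuous (d \o b) by move=> t; apply: continuous_comp; [exact: cb|exact: cd].
have b0 : b 0 = 0 by rewrite /b; lra.
have b1 : b 1 = 3 by rewrite /b; lra.
have nle31 : (3 <= 1 :> R) = false by apply/negbTE; rewrite -ltNge; lra.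
have nle32 : (3 <= 2 :> R) = false by apply/negbTE; rewrite -ltNge; lra.
have a33 : a3 3 = 0 by rewrite /a3; lra.
have loop : (d \o b) 0 = (d \o b) 1.
  by rewrite /= b0 b1 /d ler01 nle31 /d23 nle32 /= a33 p0E q0E.
have nh : null_homotopic_loop F (d \o b).
  apply: sc loop; split=> [|t _]; last exact: Fd.
  by apply: continuous_subspaceT.
have devdb : dev (d \o b) (h \o b).
  by move=> t; apply: dev_at_comp; [exact: cb|exact: devd].
have := loop_dev cdb (fun t => Fd (b t)) nh loop devdb.
rewrite /= b0 b1 /h ler01 nle31 /h23 nle32 a33 hp0 hq0 add0r => /eqP.
by rewrite subr_eq0 => /eqP <-; rewrite addrC addKr.
Unshelve. all: by end_near. Qed.

End development.

(** * Sliding paths along flows *)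

Section sliding.
Variables (R : realType) (m n : nat) (M : topologicalType).
Variables (Theta : M -> 'rV[R]_m) (e : 'I_n -> 'rV[R]_m).
Hypothesis M_hausdorff : hausdorff_space M.
Hypothesis Theta_continuous : continuous Theta.
Hypothesis Theta_etale : forall p, exists kappa : 'rV[R]_m -> M,
  [/\ \forall z \near Theta p, {for z, continuous kappa} /\ Theta (kappa z) = z,
      kappa (Theta p) = p & \forall q \near p, kappa (Theta q) = q].
Hypothesis flow : forall k p, exists gamma : R -> M,
  [/\ continuous gamma, gamma 0 = p & forall t, Theta (gamma t) = Theta p - t *: e k].

(** Lifts through an etale map are unique: near the common value both are recovered from their image
    by the same [kappa]. *)
Lemma lift_eq (X : topologicalType) (x : X) (u1 u2 : X -> M) :
  {for x, continuous u1} -> {for x, continuous u2} -> u1 x = u2 x ->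
  (\forall y \near x, Theta (u1 y) = Theta (u2 y)) ->
  \forall y \near x, u1 y = u2 y.
Proof.
move=> c1 c2 E T; have [kappa [_ _ kn]] := Theta_etale (u1 x).
have kn2 := kn; rewrite E in kn2.
by apply: (nbhsS3 (c1 _ kn) (c2 _ kn2) T) => y /= e1 e2 e3; rewrite -e1 -e2 e3.
Qed.

(** The hypothesis [flow] gives curves that need not depend continuously on their origin. Continuity
    of the slid path comes from [homotopy_lifting], because [h] lifts the continuous map [K] through
    the etale map [Theta]. *)
Lemma slide k (psi : R -> M) (c : R -> R) : continuous psi -> continuous c ->
  exists psi' : R -> M, [/\ continuous psi',
    forall t, Theta (psi' t) = Theta (psi t) - c t *: e k
    & forall t, c t = 0 -> psi' t = psi t].
Proof.
move=> cpsi cc.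
have /choice[gamma Hg] := flow k.
(* [z.1] is the parameter of the path and [z.2] scales the flow time: [z.2 = 0] gives [psi], and
   [z.2 = 1] the slid path. *)
pose h (z : R * R) := gamma (psi z.1) (z.2 * c z.1).
pose K (z : R * R) := Theta (psi z.1) - (z.2 * c z.1) *: e k.
have hK z : Theta (h z) = K z by have [_ _ ->] := Hg (psi z.1).
have h0 s : h (s, 0) = psi s by rewrite /h /= mul0r; have [_ ->] := Hg (psi s).
have c1 : continuous (fst : R * R -> R) by move=> z; exact: cvg_fst.
have c2 : continuous (snd : R * R -> R) by move=> z; exact: cvg_snd.
have cK : continuous K.
  have cT : continuous (fun z : R * R => Theta (psi z.1)).
    move=> z; apply: (@continuous_comp _ _ _ fst (Theta \o psi)); first exact: c1.
    by apply: continuous_comp; [exact: cpsi|exact: Theta_continuous].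
  have cc1 : continuous (fun z : R * R => c z.1).
    by move=> z; apply: (@continuous_comp _ _ _ fst c); [exact: c1|exact: cc].
  move=> z; apply: cvgB; first exact: cT.
  by apply: cvgZr_tmp; apply: cvgM; [exact: c2|exact: cc1].
have pairc' (t : R) : continuous (fun s : R => (s, t)).
  move=> s N sN; have [d d0 Hd] := @nbhs_box R s t N sN; apply/nbhs_normE; exists d => // u us.
  by apply: Hd; rewrite ?subrr ?normr0.
have pairc (s : R) : continuous (fun t : R => (s, t)).
  move=> t N sN; have [d d0 Hd] := @nbhs_box R s t N sN; apply/nbhs_normE; exists d => // u us.
  by apply: Hd; rewrite ?subrr ?normr0.
have ch (s : R) : continuous (fun t : R => h (s, t)).
  move=> t; apply: (@continuous_comp R R M (fun t : R => t * c s) (gamma (psi s))).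
    by apply: cvgM; [exact: cvg_id|exact: cvg_cst].
  by have [cg _ _] := Hg (psi s); exact: cg.
pose G (u : R * R -> M) (z : R * R) :=
  \forall z' \near z, {for z', continuous u} /\ Theta (u z') = K z'.
have GH : forall z, G h z.
  apply: homotopy_lifting.
  - by move=> u z /nbhs_interior.
  - move=> u1 u2 z G1 G2 E.
    have [cu1 _] := nbhs_singleton G1; have [cu2 _] := nbhs_singleton G2.
    apply: lift_eq => //; apply: (nbhsS2 G1 G2) => z' [_ ->] [_ ->] //.
  - move=> u1 u2 z G1 G2 /eqP E.
    have [cu1 _] := nbhs_singleton G1; have [cu2 _] := nbhs_singleton G2.
    move: M_hausdorff; rewrite open_hausdorff => /(_ _ _ E) [[A B] /= [Az Bz] [oA oB AB]].
    have nA : nbhs (u1 z) A by apply: open_nbhs_nbhs; split=> //; exact: set_mem.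
    have nB : nbhs (u2 z) B by apply: open_nbhs_nbhs; split=> //; exact: set_mem.
    apply: (nbhsS2 (cu1 _ nA) (cu2 _ nB)) => z' /= Az' Bz' E'.
    have : (A `&` B) (u1 z') by split=> //; rewrite E'.
    by rewrite (eqP AB).
  - move=> u1 u2 z G1 E; apply: (nbhsS2 G1 (nbhs_interior E)) => z' [cu TE] E'.
    have EE := nbhs_singleton E'; split; last by rewrite -EE.
    move=> N; rewrite -EE => /cu uN.
    by apply: (nbhsS2 uN E') => y /= + <-.
  - move=> s t; have [kappa [k1 k2 k3]] := Theta_etale (h (s, t)).
    exists (kappa \o K).
      rewrite hK in k1; rewrite /G; apply: (nbhsS (cK (s, t) _ (nbhs_interior k1))) => z' /= kz'.
      have [kc ->] := nbhs_singleton kz'; split=> //.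
      by apply: continuous_comp; [exact: cK|exact: kc].
    by apply: (nbhsS (ch s t _ k3)) => r /=; rewrite hK.
  - move=> s u Gu us; have [cu _] := nbhs_singleton Gu.
    apply: lift_eq.
    + have hE : (fun s' => h (s', 0)) = psi by apply/funext => s'; exact: h0.
      by rewrite hE; exact: cpsi.
    + by apply: (@continuous_comp _ _ _ (fun s' => (s', 0)) u); [exact: pairc'|exact: cu].
    + by rewrite us.
    + by apply: (nbhsS (pairc' 0 s _ Gu)) => s' /= [_ ->]; rewrite hK.
exists (fun s => h (s, 1)); split.
- move=> s; have [cu _] := nbhs_singleton (GH (s, 1)).
  exact: (@continuous_comp _ _ _ (fun s' : R => (s', (1 : R))) h s (pairc' 1 s) cu).
- by move=> t; rewrite hK /K /= mul1r.
- by move=> t ct; rewrite -h0 /h /= ct !mulr0.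
Qed.

(** The flows are applied one after another; only their effect on [Theta] is recorded, where
    translations add up. *)
Lemma slides (s : seq 'I_n) (psi : R -> M) (c : 'I_n -> R -> R) : continuous psi ->
  (forall k, continuous (c k)) ->
  exists psi' : R -> M, [/\ continuous psi',
    forall t, Theta (psi' t) = Theta (psi t) - \sum_(k <- s) c k t *: e k
    & forall t, (forall k, c k t = 0) -> psi' t = psi t].
Proof.
move=> cpsi cc; elim: s => [|k s [psi1 [c1 T1 E1]]].
  by exists psi; split=> // t; rewrite big_nil subr0.
have [psi2 [c2 T2 E2]] := slide k c1 (cc k).
exists psi2; split=> // [t|t ct].
  by rewrite T2 T1 big_cons opprD addrA addrAC.
by rewrite E2 // E1.
Qed.

(** Sliding by [c] makes [Theta] constant along the path, so the slid path is constant by [lift_eq];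
    as [c] vanishes at 0 and 1, its endpoints are those of [delta]. *)
Lemma sliding_loop (delta : R -> M) (c : 'I_n -> R -> R) : continuous delta ->
  (forall k, continuous (c k)) ->
  (forall t, Theta (delta t) = Theta (delta 0) + \sum_k c k t *: e k) ->
  (forall k, c k 0 = 0 /\ c k 1 = 0) -> delta 0 = delta 1.
Proof.
move=> cd cc TE c01; have [psi [cpsi TP E]] := slides (index_enum _) cd cc.
have TPc t : Theta (psi t) = Theta (delta 0) by rewrite TP TE addrK.
have loc t : \forall t' \near t, psi t' = psi t.
  apply: lift_eq; [exact: cpsi|exact: cvg_cst|by []|].
  by near=> t'; rewrite !TPc.
have E0 : psi 0 = delta 0 by apply: E => k; have [] := c01 k.
have E1 : psi 1 = delta 1 by apply: E => k; have [] := c01 k.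
rewrite -E0 -E1.
apply/esym; apply: (@connected_clopenR R (fun t => psi t = psi 0) _ _ 0 1) => // t e'.
  by apply: (nbhsS (loc t)) => t' ->.
by apply: (nbhsS (loc t)) => t' ->.
Unshelve. all: by end_near. Qed.

End sliding.

(** * Smooth maps into manifolds and push-forward of vectors *)

Section smooth_into_calculus.
Variables (R : realType) (m : nat) (M : manifold R m).

Lemma is_derive_into (V W : normedModType R) (kappa : V -> M) (h : M -> W) z v :
  {for z, continuous kappa} -> derivable (chart_at (kappa z) \o kappa) z v ->
  differentiable (h \o chart_inv (chart_at (kappa z))) (chart_at (kappa z) (kappa z)) ->
  is_derive z v (h \o kappa) (dfun (kappa z) h ('D_v (chart_at (kappa z) \o kappa) z)).
Proof.
move=> ck dk dh; set a := chart_at (kappa z) in dk dh *.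
have [h1 h2] := @is_derive_comp _ _ _ _ (h \o chart_inv a) (a \o kappa) z v dk dh.
have an : nbhs (kappa z) (chart_dom a).
  by apply: open_nbhs_nbhs; split; [exact: chart_dom_open|exact: mem_chart_at].
have E : \forall y \near z, ((h \o chart_inv a) \o (a \o kappa)) y = (h \o kappa) y.
  by apply: (nbhsS (ck _ an)) => y /= ay; rewrite chart_funK.
split; first exact: near_eq_derivable E h1.
by rewrite -(near_eq_derive _ E) h2.
Qed.

Lemma smooth_fun_differentiable (W : normedModType R) (U : set M) (h : M -> W) p c :
  smooth_target W -> open U -> U p -> smooth_fun U h -> atlas c -> chart_dom c p ->
  differentiable (h \o chart_inv c) (c p).
Proof.
move=> [_ tW] oU Up hS ac cp.
by have [ O [ oO Op OS _]] := smooth_fun_comp_chart oU hS ac cp Up; exact: tW oO OS Op.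
Qed.

Lemma smooth_fun_continuous (W : normedModType R) (U : set M) (h : M -> W) p :
  smooth_fun U h -> open U -> U p -> {for p, continuous h}.
Proof.
move=> hS oU Up; set a := chart_at p; have ap : chart_dom a p by exact: mem_chart_at.
have [ O [ oO Op OS _]] := smooth_fun_comp_chart oU hS (atlas_at p) ap Up.
have := smooth_on_continuous OS Op => ch N; rewrite -[h p]/((h \o id) p).
have E : (h \o chart_inv a) (a p) = h p by rewrite /= chart_funK.
rewrite /= -E => /ch hN.
have an : nbhs p (chart_dom a) by apply: open_nbhs_nbhs; split=> //; exact: chart_dom_open.
by apply: (nbhsS2 an (chart_continuous ap hN)) => q aq /=; rewrite chart_funK.
Qed.

Lemma smooth_fun_into (V W : normedModType R) (U : set M) (U' : set V) (h : M -> W)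
    (kappa : V -> M) : smooth_target W -> open U -> open U' -> smooth_fun U h ->
  smooth_into U' kappa -> (forall z, U' z -> U (kappa z)) ->
  smooth_on U' (h \o kappa).
Proof.
move=> [tW _] oU oU' hS [ck kS] kU; apply: smooth_on_local => z U'z.
set a := chart_at (kappa z); have aa : atlas a by exact: atlas_at.
have ak : chart_dom a (kappa z) by exact: mem_chart_at.
pose N := U' `&` kappa @^-1` chart_dom a.
have oN : open N by apply: open_setI_preimage => //; exact: chart_dom_open.
exists N; first by apply: open_nbhs_nbhs; split.
apply: (@smooth_on_eq _ _ _ _ ((h \o chart_inv a) \o (a \o kappa))) => //.
  by move=> y [U'y ay] /=; rewrite chart_funK.
apply: (tW _ _ _ (a @` (chart_dom a `&` U))) => //.
- exact: chart_image_open.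
- by move=> y [U'y ay]; exists (kappa y) => //; split=> //; exact: kU.
- exact: hS.
- exact: kS.
Qed.

Lemma smooth_into_comp (V : normedModType R) (k : nat) (U : set 'rV[R]_k) (U' : set V)
    (kappa : 'rV[R]_k -> M) (g : V -> 'rV[R]_k) : open U -> open U' ->
  smooth_into U kappa -> smooth_on U' g -> (forall z, U' z -> U (g z)) ->
  smooth_into U' (kappa \o g).
Proof.
move=> oU oU' [ck kS] gS gU.
have cg z : U' z -> {for z, continuous g} by exact: smooth_on_continuous.
have ckg z : U' z -> {for z, continuous (kappa \o g)}.
  by move=> U'z; apply: continuous_comp; [exact: cg|exact/ck/gU].
split=> // c ac.
rewrite (_ : c \o (kappa \o g) = (c \o kappa) \o g) //.
apply: (smooth_on_comp _ _ _ (kS c ac)).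
- by apply: open_setI_preimage => //; exact: chart_dom_open.
- by apply: open_setI_preimage => //; exact: chart_dom_open.
- by move=> z [U'z kz]; split=> //; exact: gU.
- by apply: smooth_on_subset gS => z [].
Qed.

Lemma smooth_into_derivable (V : normedModType R) (U : set V) (kappa : V -> M) z v :
  smooth_into U kappa -> open U -> U z ->
  derivable (chart_at (kappa z) \o kappa) z v.
Proof.
move=> [ck kS] oU Uz; apply: smooth_on_derivable (kS _ (atlas_at _)) _.
by split=> //; exact: mem_chart_at.
Qed.

(* The image of the tangent vector [v] under the differential of [kappa] at [z] *)
Definition push (V : normedModType R) (kappa : V -> M) (z v : V) : 'rV[R]_m :=
  'D_v (chart_at (kappa z) \o kappa) z.

Lemma is_derive_push (V W : normedModType R) (U : set M) (U' : set V) (h : M -> W)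
    (kappa : V -> M) z v : smooth_target W -> open U -> open U' -> smooth_fun U h ->
  smooth_into U' kappa -> U' z -> U (kappa z) ->
  is_derive z v (h \o kappa) (dfun (kappa z) h (push kappa z v)).
Proof.
move=> tW oU oU' hS kS U'z Uk; apply: is_derive_into.
- by have [ck _] := kS; exact: ck.
- exact: smooth_into_derivable kS oU' U'z.
- by apply: smooth_fun_differentiable hS _ _ => //; [exact: atlas_at|exact: mem_chart_at].
Qed.

Lemma dfun_coord k (U : set M) (h : M -> 'rV[R]_k) p u j : open U -> U p ->
  smooth_fun U h -> dfun p (fun q => h q 0 j) u = dfun p h u 0 j.
Proof.
move=> oU Up hS; rewrite /dfun -derive_coord //; apply: diff_derivable.
apply: smooth_fun_differentiable hS _ _ => //;
  [exact: smooth_target_rV|exact: atlas_at|exact: mem_chart_at].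
Qed.

Lemma smooth_fun_coord k (U : set M) (h : M -> 'rV[R]_k) j : open U ->
  smooth_fun U h -> smooth_fun U (fun q => h q 0 j).
Proof.
move=> oU hS c ac; have oc := chart_image_open c oU.
by move/(smooth_on_mxP _ oc): (hS c ac) => /(_ 0 j).
Qed.

Lemma smooth_fun_rowP k (U : set M) (h : M -> 'rV[R]_k) : open U ->
  (forall j, smooth_fun U (fun q => h q 0 j)) -> smooth_fun U h.
Proof.
move=> oU hS c ac; have oc := chart_image_open c oU.
by apply/(smooth_on_mxP _ oc) => i j; rewrite ord1; exact: (hS j c ac).
Qed.

Lemma dfun_chart_at (p : M) u : dfun p (chart_at p) u = u.
Proof.
set a := chart_at p; have ap : chart_dom a p by exact: mem_chart_at.
rewrite /dfun -/a (@near_eq_derive _ _ _ _ id); first exact: derive_id.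
have ai : nbhs (a p) (chart_img a).
  by apply: open_nbhs_nbhs; split; [exact: chart_img_open|exact: chart_imgE].
by apply: (nbhsS ai) => x /chart_imgP[].
Qed.

Lemma dfun_scale (W : normedModType R) (U : set M) (h : M -> W) p u (k : R) :
  smooth_target W -> open U -> U p -> smooth_fun U h ->
  dfun p h (k *: u) = k *: dfun p h u.
Proof.
move=> tW oU Up hS.
have dh : differentiable (h \o chart_inv (chart_at p)) (chart_at p p).
  by apply: smooth_fun_differentiable hS _ _ => //; [exact: atlas_at|exact: mem_chart_at].
by rewrite /dfun !deriveE // linearZ.
Qed.

Lemma dfun_lin (W : normedModType R) (U : set M) (h : M -> W) p u v (k : R) :
  smooth_target W -> open U -> U p -> smooth_fun U h ->
  dfun p h (k *: u + v) = k *: dfun p h u + dfun p h v.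
Proof.
move=> tW oU Up hS; apply: dfun_linear.
by apply: smooth_fun_differentiable hS _ _ => //; [exact: atlas_at|exact: mem_chart_at].
Qed.

(** Hamiltonian fields are tested against vector fields; this lets them be tested against a single
    tangent vector. The extension is constant in a chart, cut off by a bump function. *)
Lemma vector_extension (p : M) (v : 'rV[R]_m) : exists2 Y, vector_field (M := M) Y & Y p = v.
Proof.
set a := chart_at p; have ap : chart_dom a p by exact: mem_chart_at.
have aa : atlas a by exact: atlas_at.
have [r r0 Hr] : exists2 r, 0 < r & forall y, `|y - a p| < r -> chart_img a y.
  by apply: open_norm; [exact: chart_img_open|exact: chart_imgE].
(* The bump is then supported in radius [2 * (r / 3) < r], hence in a compact subset of the chart
   image. *)
have d0 : 0 < r / 3 by rewrite divr_gt0.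
have [phi [phiS phi1 phi0]] := smooth_bump (a p) d0.
pose K := [set x : 'rV[R]_m | `|x - a p| <= 2 * (r / 3)].
have KI x : K x -> chart_img a x.
  rewrite /K /= => Kx; apply: Hr; apply: (le_lt_trans Kx); lra.
have cK : compact K.
  apply: bounded_closed_compact.
    exists (2 * (r / 3) + `|a p|); split; first exact: num_real.
    move=> y yb x /= Kx; apply: le_trans (ltW yb).
    by rewrite -[x](subrK (a p)); apply: (le_trans (ler_normD _ _)); rewrite lerD2r.
  rewrite (_ : K = closed_ball_ (fun x => `|x|) (a p) (2 * (r / 3))).
    exact: closed_closed_ball_.
  by apply/seteqP; split=> x; rewrite /K /closed_ball_ /= distrC.
(* As [M] is Hausdorff, the support is closed in [M], so the extension by zero is smooth on its open
   complement. *)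
have cK' : closed (chart_inv a @` K).
  apply: compact_closed; first exact: manifold_hausdorff.
  apply: continuous_compact => //; apply: continuous_in_subspaceT => x.
  rewrite inE => /KI[q aq xE]; rewrite -xE; exact: chart_inv_continuous.
pose v0 := dfun p a v.
pose Y q := if pselect (chart_dom a q) then phi (a q) *: tvec a q v0 else 0.
exists Y; last first.
  rewrite /Y; case: pselect => [ap'|//]; rewrite phi1 ?subrr ?normr0 ?scale1r; last exact: ltW.
  exact: tvec_dfun.
move=> c ac; apply: smooth_on_local => _ [q cq <-].
have cdom : open (chart_dom c) by exact: chart_dom_open.
have [aq|naq] := pselect (chart_dom a q).
  pose N := c @` (chart_dom c `&` chart_dom a).
  have oN : open N by apply: chart_image_open; exact: chart_dom_open.
  exists N; first by apply: open_nbhs_nbhs; split=> //; exists q.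
  pose psi y := phi y *: 'D_v0 (c \o chart_inv a) y.
  have oP : open (a @` (chart_dom a `&` chart_dom c)) by exact: chart_image_open.
  have psiS : smooth_on (a @` (chart_dom a `&` chart_dom c)) psi.
    apply/smooth_onP => k; apply/(Ck_mxP _ _ oP) => i j.
    apply: (@eq_Ck _ _ _ _ _ (fun y => phi y * ('D_v0 (c \o chart_inv a) y) i j)) => //.
      by move=> y _; rewrite /psi mxE.
    apply: Ck_mul => //.
      by apply: (Ck_subset (U' := setT)) => //; move/smooth_onP: phiS; apply.
    have /smooth_onP/(_ k.+1)/CkS[_ /(_ v0)[_ D]] := atlas_compatible aa ac.
    by move/(Ck_mxP _ _ oP): D; apply.
  apply: (@smooth_on_eq _ _ _ _ (psi \o (a \o chart_inv c))) => //.
    move=> _ [q' [cq' aq'] <-] /=; rewrite chart_funK //.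
    rewrite /Y; case: pselect => [aq''|//]; rewrite /psi.
    have tm := @smooth_target_rV R m.
    rewrite (dfun_scale _ _ tm cdom cq' (smooth_fun_chart ac)); congr (_ *: _).
    rewrite (dfunE _ aa aq').
      by rewrite dfun_tvec.
    exact: smooth_fun_differentiable tm cdom cq' (smooth_fun_chart ac) aa aq'.
  apply: smooth_on_comp oN oP _ psiS (atlas_compatible ac aa).
  by move=> _ [q' [cq' aq'] <-] /=; rewrite chart_funK //; exists q'.
pose N := c @` (chart_dom c `&` ~` (chart_inv a @` K)).
have oN : open N by apply: chart_image_open; exact: closed_openC.
exists N.
  apply: open_nbhs_nbhs; split=> //; exists q => //; split=> // -[x /KI /chart_imgP[ax _] xq].
  by apply: naq; rewrite -xq.
apply: (@smooth_on_eq _ _ _ _ (cst 0)) => //; last by apply/smooth_onP => k; exact: Ck_cst.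
move=> _ [q' [cq' nq'] <-] /=; rewrite chart_funK //.
have -> : Y q' = 0.
  rewrite /Y; case: pselect => [aq'|//].
  have [->|/phi0 h] := eqVneq (phi (a q')) 0; first by rewrite scale0r.
  by exfalso; apply: nq'; exists (a q') => //; rewrite chart_funK.
by rewrite /dfun derive0.
Qed.

Lemma push_dfun k (W : set M) (O : set 'rV[R]_k) (Theta : M -> 'rV[R]_k)
    (kappa : 'rV[R]_k -> M) p u :
  open W -> W p -> smooth_fun W Theta -> open O -> O (Theta p) ->
  smooth_into O kappa -> (\forall q \near p, kappa (Theta q) = q) ->
  push kappa (Theta p) (dfun p Theta u) = u.
Proof.
move=> oW Wp TS oO Op kS kT; have kp := nbhs_singleton kT.
rewrite /push kp; set a := chart_at p; have ap : chart_dom a p by exact: mem_chart_at.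
have dT : differentiable (Theta \o chart_inv a) (a p).
  by apply: smooth_fun_differentiable oW Wp TS (atlas_at p) ap; exact: smooth_target_rV.
have dT' : derivable (Theta \o chart_inv a) (a p) u by exact: diff_derivable.
have TE : (Theta \o chart_inv a) (a p) = Theta p by rewrite /= chart_funK.
have [ck kSc] := kS.
have oN : open (O `&` kappa @^-1` chart_dom a).
  by apply: open_setI_preimage => //; exact: chart_dom_open.
have dk : differentiable (a \o kappa) (Theta p).
  apply: (smooth_target_rV R m).2 oN (kSc a (atlas_at p)) _.
  by split=> //=; rewrite kp.
have [_] := @is_derive_comp _ _ _ _ (a \o kappa) (Theta \o chart_inv a) (a p) u dT'
  ltac:(by rewrite TE).
rewrite TE => h; rewrite /dfun -/a -h.
rewrite (@near_eq_derive _ _ _ _ id); first exact: derive_id.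
have ai : nbhs (a p) (chart_img a).
  by apply: open_nbhs_nbhs; split; [exact: chart_img_open|exact: chart_imgE].
apply: (nbhsS2 ai (near_chart ap kT)) => x /chart_imgP[_ xE] [_ E] /=.
by rewrite E xE.
Qed.

Lemma dfun_push k (W : set M) (O : set 'rV[R]_k) (Theta : M -> 'rV[R]_k)
    (kappa : 'rV[R]_k -> M) z v :
  open W -> W (kappa z) -> smooth_fun W Theta -> open O -> O z ->
  smooth_into O kappa -> (\forall y \near z, Theta (kappa y) = y) ->
  dfun (kappa z) Theta (push kappa z v) = v.
Proof.
move=> oW Wk TS oO Oz kS kT.
have [_ <-] := is_derive_push v (@smooth_target_rV R k) oW oO TS kS Oz Wk.
rewrite (@near_eq_derive _ _ _ _ id); first exact: derive_id.
exact: kT.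
Qed.

End smooth_into_calculus.

(** * Lagrangian fibrations *)

Section linear_algebra.
Variable R : realType.

Lemma row_sqnorm_eq0 k (u : 'rV[R]_k) : u *m u^T = 0 -> u = 0.
Proof.
move=> /matrixP/(_ 0 0); rewrite !mxE => H; apply/rowP => i; rewrite mxE.
have ge0 j : true -> 0 <= u 0 j * u^T j 0 by move=> _; rewrite mxE -expr2 sqr_ge0.
have /eqP : u 0 i * u^T i 0 = 0 by exact: (psumr_eq0P ge0 H).
by rewrite mxE mulf_eq0 orbb => /eqP.
Qed.

Lemma row_basis_of_rank m k r (A : 'M[R]_(m, k)) : \rank A = r ->
  exists K : 'M[R]_(r, k), (K :=: A)%MS.
Proof. by move=> <-; exists (row_base A); exact: eq_row_base. Qed.

(** Both row spaces lie in the [A]-orthogonal complement of [K], which has dimension [n + n - n]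
    because [A] is invertible. *)
Lemma lagrangian_eqmx n (A : 'M[R]_(n + n)) (K X : 'M[R]_(n, n + n)) :
  row_free K -> row_free X -> A \in unitmx ->
  K *m (X *m A)^T = 0 -> K *m A *m K^T = 0 -> (X :=: K)%MS.
Proof.
move=> fK fX uA KX KK.
have rK : \rank K = n by exact/eqP.
have rX : \rank X = n by exact/eqP.
have rk : \rank (kermx (A *m K^T)) = n.
  rewrite mxrank_ker -(mxrank_tr (A *m K^T)) trmx_mul trmxK mxrankMfree ?rK ?addnK //.
  by rewrite row_free_unit unitmx_tr.
have sK : (K <= kermx (A *m K^T))%MS by apply/sub_kermxP; rewrite mulmxA.
have sX : (X <= kermx (A *m K^T))%MS.
  apply/sub_kermxP; rewrite mulmxA; apply: trmx_inj.
  by rewrite trmx_mul trmxK trmx0.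
have kK : (kermx (A *m K^T) <= K)%MS.
  by rewrite -(geq_leqif (mxrank_leqif_sup sK)) rk rK.
have XK := submx_trans sX kK.
by apply/eqmxP; rewrite XK -(geq_leqif (mxrank_leqif_sup XK)) rX rK leqnn.
Qed.

End linear_algebra.

Section smooth_fun_matrices.
Variables (R : realType) (m : nat) (M : manifold R m) (U : set M).
Hypothesis oU : open U.

Lemma smooth_fun_eq (W : normedModType R) (h h' : M -> W) :
  (forall q, U q -> h q = h' q) -> smooth_fun U h -> smooth_fun U h'.
Proof.
move=> hh' hS c ac; apply: (smooth_on_eq (chart_image_open c oU) _ (hS c ac)).
by move=> _ [q [cq Uq] <-] /=; rewrite chart_funK // hh'.
Qed.

Lemma smooth_fun_mulmxr k l (h : M -> 'rV[R]_k) (A : 'M[R]_(k, l)) :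
  smooth_fun U h -> smooth_fun U (fun q => h q *m A).
Proof.
move=> hS c ac; have oc := chart_image_open c oU.
have AS : smooth_on setT (mulmxr A : 'rV[R]_k -> 'rV[R]_l).
  by apply/smooth_onP => j; exact: Ck_mulmxr.
exact: (smooth_on_comp oc openT (fun _ _ => Logic.I) AS (hS c ac)).
Qed.

Lemma smooth_fun_row_mx k l (h1 : M -> 'rV[R]_k) (h2 : M -> 'rV[R]_l) :
  smooth_fun U h1 -> smooth_fun U h2 -> smooth_fun U (fun q => row_mx (h1 q) (h2 q)).
Proof.
move=> S1 S2; apply: smooth_fun_rowP => // j.
case: (split_ordP j) => i ->.
  by apply: smooth_fun_eq (smooth_fun_coord i oU S1) => q _; rewrite row_mxEl.
by apply: smooth_fun_eq (smooth_fun_coord i oU S2) => q _; rewrite row_mxEr.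
Qed.

Lemma dfun_row_mx k l (h1 : M -> 'rV[R]_k) (h2 : M -> 'rV[R]_l) p u : U p ->
  smooth_fun U h1 -> smooth_fun U h2 ->
  dfun p (fun q => row_mx (h1 q) (h2 q)) u = row_mx (dfun p h1 u) (dfun p h2 u).
Proof.
move=> Up S1 S2; apply/rowP => j.
rewrite -(dfun_coord _ _ oU Up (smooth_fun_row_mx S1 S2)).
case: (split_ordP j) => i ->.
  rewrite row_mxEl -(dfun_coord _ _ oU Up S1).
  by congr (dfun p _ u); apply/funext => q; rewrite row_mxEl.
rewrite row_mxEr -(dfun_coord _ _ oU Up S2).
by congr (dfun p _ u); apply/funext => q; rewrite row_mxEr.
Qed.

Lemma dfun_mulmxr k l (h : M -> 'rV[R]_k) (A : 'M[R]_(k, l)) p u : U p ->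
  smooth_fun U h -> dfun p (fun q => h q *m A) u = dfun p h u *m A.
Proof.
move=> Up hS; set a := chart_at p.
have dh : differentiable (h \o chart_inv a) (a p).
  by apply: smooth_fun_differentiable oU Up hS (atlas_at p) (mem_chart_at p);
    exact: smooth_target_rV.
have cA : continuous (mulmxr A : 'rV[R]_k -> 'rV[R]_l) by exact: mulmxr_continuous.
have dA : differentiable (mulmxr A : 'rV[R]_k -> 'rV[R]_l) ((h \o chart_inv a) (a p)).
  exact: linear_differentiable.
have du : derivable (h \o chart_inv a) (a p) u by exact: diff_derivable.
have [_] := is_derive_comp du dA.
by rewrite /dfun -/a => ->; rewrite deriveE // diff_lin.
Qed.

End smooth_fun_matrices.

Section lagrangian_fibration.
Variables (R : realType) (n : nat) (M : manifold R (n + n)).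
Variables (w : M -> 'M[R]_(n + n)) (f : M -> 'rV[R]_n).
Variable (X : 'I_n -> M -> 'rV[R]_(n + n)).
Hypothesis w_symplectic : symplectic w.
Hypothesis f_smooth : smooth_fun setT f.
Hypothesis f_lagrangian : forall p, lagrangian w (f @^-1` [set f p]).
Hypothesis X_hamiltonian : forall i, hamiltonian_field w (fun p => f p 0 i) (X i).
Hypothesis X_free : forall p, row_free (\matrix_(i < n) X i p).

Let oT := @openT M.
Let trV k := @smooth_target_rV R k.

Definition Xmx p : 'M[R]_(n, n + n) := \matrix_i X i p.

Lemma hamiltonianE i p v : form_eval (w p) (X i p) v = dfun p (fun q => f q 0 i) v.
Proof. by have [Y vY <-] := vector_extension p v; have [_ ->] := X_hamiltonian i. Qed.

Lemma dfun_fE p v : dfun p f v = v *m (Xmx p *m w p)^T.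
Proof.
apply/rowP => j; rewrite -(dfun_coord _ _ oT) // -hamiltonianE /form_eval.
have -> : v *m (Xmx p *m w p)^T = (Xmx p *m w p *m v^T)^T by rewrite [RHS]trmx_mul trmxK.
have -> : X j p = row j (Xmx p) by rewrite rowK.
by rewrite -!row_mul mxE [RHS]mxE.
Qed.

Lemma w_unit p : w p \in unitmx.
Proof.
have [_ _ nd] := w_symplectic.
rewrite -row_free_unit -kermx_eq0; apply/eqP/row_matrixP => i; rewrite row0.
apply: (nd p) => v; rewrite /form_eval.
by rewrite -row_mul mulmx_ker row0 mul0mx mxE.
Qed.

(** [f] is a submersion: the [X_i] are independent and [w] is nondegenerate. *)
Lemma rank_df p : \rank (Xmx p *m w p)^T = n.
Proof.
rewrite mxrank_tr mxrankMfree; first exact/eqP/X_free.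
by rewrite row_free_unit w_unit.
Qed.

Lemma kernel_basis p : exists2 K : 'M[R]_(n, n + n), row_free K &
  forall v, dfun p f v = 0 <-> exists a, v = a *m K.
Proof.
have rk : \rank (kermx (Xmx p *m w p)^T) = n by rewrite mxrank_ker rank_df addnK.
have [K KE] := row_basis_of_rank rk; exists K; first by rewrite /row_free KE rk.
move=> v; rewrite dfun_fE; split=> [v0|[a ->]].
  by have /submxP[a ->] : (v <= K)%MS by [rewrite KE; apply/sub_kermxP]; exists a.
by apply/sub_kermxP; rewrite -KE; exact: submxMl.
Qed.

(** [f] is completed to coordinates by the scalar products with a basis [K] of ker df, so [L] is
    [K^T]. A vector [y *m K] of the kernel on which these vanish has square norm zero. *)
Lemma submersion_chart p : exists (L : 'M[R]_(n + n, n)) (r : R)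
    (kappa : 'rV[R]_(n + n) -> M),
  let Phi q := row_mx (f q) (chart_at p q *m L) in
  [/\ 0 < r, smooth_fun (chart_dom (chart_at p)) Phi,
      smooth_into (ball (Phi p) r) kappa,
      forall z, ball (Phi p) r z -> chart_dom (chart_at p) (kappa z) /\ Phi (kappa z) = z
    & kappa (Phi p) = p /\
      \forall q \near p, ball (Phi p) r (Phi q) /\ kappa (Phi q) = q].
Proof.
set a := chart_at p; have aa : atlas a by exact: atlas_at.
have ap : chart_dom a p by exact: mem_chart_at.
have oa : open (chart_dom a) by exact: chart_dom_open.
have [K Kf KE] := kernel_basis p.
exists K^T; pose Phi q := row_mx (f q) (a q *m K^T).
have aS : smooth_fun (chart_dom a) a by exact: smooth_fun_chart.
have aKS := smooth_fun_mulmxr oa K^T aS.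
have fS : smooth_fun (chart_dom a) f by exact: smooth_fun_subset f_smooth.
have PS : smooth_fun (chart_dom a) Phi by exact: smooth_fun_row_mx.
have Pinj u : dfun p Phi u = 0 -> u = 0.
  rewrite (dfun_row_mx oa _ ap fS aKS) (dfun_mulmxr oa _ _ ap aS) dfun_chart_at.
  rewrite -[X in _ = X -> _]row_mx0 => /eq_row_mx[/KE[y uE]].
  rewrite uE -mulmxA => H.
  have : (y *m K) *m (y *m K)^T = 0.
    by rewrite trmx_mul mulmxA -(mulmxA y) H mul0mx.
  exact: row_sqnorm_eq0.
have [r [kappa [r0 kS kin kp kn]]] := local_inverse oa ap PS Pinj.
by exists r, kappa.
Qed.

(** In the coordinates of [submersion_chart], [u] is the velocity of a straight line in the fibre.
    As [tangent_to] asks for a curve on all of [R], the line is run with a bounded parameter [tau]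
    such that [tau 0 = 0] and [tau' 0 = 1]. *)
Lemma tangent_fibre p u : dfun p f u = 0 -> tangent_to (f @^-1` [set f p]) p u.
Proof.
move=> fu0.
have [L [r [kappa [r0 PS kS kin [kp kn]]]]] := submersion_chart p.
set a := chart_at p in PS kin; set Phi := (fun q => _) in PS kS kin kp kn.
have ap : chart_dom a p by exact: mem_chart_at.
have oa : open (chart_dom a) by exact: chart_dom_open.
have aS : smooth_fun (chart_dom a) a by exact: smooth_fun_chart (atlas_at p).
have aLS := smooth_fun_mulmxr oa L aS.
have fS : smooth_fun (chart_dom a) f by exact: smooth_fun_subset f_smooth.
pose zeta := dfun p Phi u.
have zl : lsubmx zeta = 0.
  by rewrite /zeta (dfun_row_mx oa _ ap fS aLS) row_mxKl.
(* With this [k], [|zeta| < r * k]; as [tau t = t / (1 + k^2 t^2)] satisfies [|tau t| * k <= 1], the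
   curve never leaves the ball of radius [r]. *)
pose k := `|zeta| / r + 1.
have k0 : 0 < k by rewrite ltr_wpDl // divr_ge0 // ltW.
pose den (t : R) := 1 + k * k * (t * t).
have den1 t : 1 <= den t.
  by rewrite lerDl; apply: mulr_ge0; [exact: mulr_ge0 (ltW k0) (ltW k0)|rewrite -expr2 sqr_ge0].
have den0 t : den t != 0 by rewrite gt_eqF // (lt_le_trans ltr01).
pose tau (t : R) := t * (den t)^-1.
have tau_bound t : `|tau t| * k <= 1.
  rewrite /tau normrM normfV (ger0_norm (le_trans ler01 (den1 t))) mulrAC.
  rewrite ler_pdivrMr ?(lt_le_trans ltr01) // mul1r /den.
  have -> : k * k * (t * t) = (`|t| * k) * (`|t| * k).
    have tt : t * t = `|t| * `|t| by rewrite -!expr2 real_normK ?num_real.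
    by rewrite tt; ring.
  have : 0 <= `|t| * k by rewrite mulr_ge0 // ltW.
  move: (`|t| * k) => s s0; have := sqr_ge0 (s - 1); rewrite expr2 => H.
  have -> : 1 + s * s = (s - 1) * (s - 1) + s + s by ring.
  by rewrite -addrA ler_wpDl // lerDl.
have oTR := @openT R.
have idC j : Ck j setT (id : R -> R) by exact: Ck_id.
have denC j : Ck j setT den.
  exact: (Ck_add oTR (Ck_cst _ _ _)
    (Ck_mul oTR (Ck_cst _ _ _) (Ck_mul oTR (idC j) (idC j)))).
have invC j : Ck j setT (fun t => (den t)^-1).
  exact: (Ck_inv oTR (fun t _ => den0 t) (denC j)).
have tauC j : Ck j setT tau by exact: (Ck_mul oTR (idC j) (invC j)).
have tau0 : tau 0 = 0 by rewrite /tau mul0r.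
have dtau : is_derive (0 : R) 1 tau 1.
  have /CkS[_ /(_ 1)[dt _]] := tauC 1%N; split; first exact: dt.
  have di : derivable (fun t => (den t)^-1) 0 1.
    by have [_ /(_ 1) [+ _]] := (CkS _ _ _).1 (invC 1%N); apply.
  have did : derivable (id : R -> R) 0 1 by exact: derivable_id.
  have -> : tau = (id : R -> R) * (fun t => (den t)^-1) by [].
  rewrite (deriveM did di) derive_id scale0r add0r /den !mulr0 addr0 invr1.
  by rewrite scale1r.
pose line (s : R) := Phi p + s *: zeta.
have lineB t : ball (Phi p) r (line (tau t)).
  rewrite -ball_normE /= opprD addrA subrr sub0r normrN normrZ.
  have h : `|zeta| < r * k.
    by rewrite /k mulrDr mulr1 mulrCA divff ?gt_eqF // mulr1 ltrDl.
  have [->|t0] := eqVneq (tau t) 0; first by rewrite normr0 mul0r.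
  apply: (@lt_le_trans _ _ (`|tau t| * (r * k))); first by rewrite ltr_pM2l ?normr_gt0.
  by rewrite mulrCA -[leRHS]mulr1 ler_pM2l.
have oB : open (ball (Phi p) r) by exact: ball_open.
have lineC j : Ck j setT (line \o tau).
  apply/(Ck_mxP _ _ oTR) => i l.
  apply: (@eq_Ck _ _ _ _ _ (fun t => Phi p i l + tau t * zeta i l)) => //.
    by move=> t _; rewrite /line /= !mxE.
  apply: Ck_add => //; first exact: Ck_cst.
  by apply: Ck_mul => //; exact: Ck_cst.
have kz0 : ball (Phi p) r (Phi p) by exact: ballxx.
exists (kappa \o (line \o tau)); split.
- apply: smooth_into_comp oB oTR kS _ _ => //; last by move=> t _; exact: lineB.
  exact/smooth_onP.
- move=> t /=; have [_ /(congr1 lsubmx)] := kin _ (lineB t).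
  by rewrite row_mxKl /line linearD linearZ /= zl scaler0 addr0 row_mxKl.
- by rewrite /= tau0 /line scale0r addr0 kp.
have pE : push kappa (Phi p) zeta = u.
  apply: push_dfun oa ap PS oB kz0 kS _.
  by apply: nbhsS kn _ => q [].
rewrite (_ : chart_at p \o _ = ((chart_at p \o kappa) \o line) \o tau) //.
have dk : derivable (chart_at p \o kappa) (Phi p + 0 *: zeta) zeta.
  by rewrite scale0r addr0 -{1}kp; exact: smooth_into_derivable kS oB kz0.
have [dl1 dl2] := is_derive_line dk.
have dtau1 : derivable tau 0 1 by case: dtau.
have dl : differentiable ((chart_at p \o kappa) \o line) (tau 0).
  by rewrite tau0; apply/derivable1_diffP.
have [h1 h2] := is_derive_comp dtau1 dl.
split; first exact: h1.
have [_ d1] := dtau.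
by rewrite h2 d1 tau0 dl2 scale0r addr0 -{1}kp.
Qed.

(** ker df is isotropic, being tangent to a Lagrangian fibre, and it is [w]-orthogonal to the [X_i]
    because [w(X_i, v) = df_i(v)]. Both spaces have dimension [n], so [lagrangian_eqmx] identifies
    them. *)
Lemma kernel_df p v : dfun p f v = 0 <-> exists a, v = a *m Xmx p.
Proof.
have [K Kf KE] := kernel_basis p.
have Kd y : dfun p f (y *m K) = 0 by apply/KE; exists y.
have KX : K *m (Xmx p *m w p)^T = 0.
  by apply/row_matrixP => i; rewrite row_mul -dfun_fE rowE Kd row0.
have KK : K *m w p *m K^T = 0.
  apply/matrixP => i j; rewrite [RHS]mxE.
  have T y : tangent_to (f @^-1` [set f p]) p (y *m K) by exact/tangent_fibre/Kd.
  have [_ iso] := f_lagrangian p.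
  have := iso p _ _ erefl (T (std_basis R i)) (T (std_basis R j)).
  by rewrite form_eval_mul form_eval_basis.
have XK := lagrangian_eqmx Kf (X_free p) (w_unit p) KX KK.
rewrite KE; split=> -[y ->].
  by have /submxP[b ->] : (y *m K <= Xmx p)%MS by [rewrite XK submxMl]; exists b.
by have /submxP[b ->] : (y *m Xmx p <= K)%MS by [rewrite -XK submxMl]; exists b.
Qed.

End lagrangian_fibration.

Section calculus_supplements.
Variables (R : realType) (m : nat) (M : manifold R m).

Lemma smooth_fun_comp (W : normedModType R) k (U : set M) (h : M -> 'rV[R]_k)
    (O : set 'rV[R]_k) (phi : 'rV[R]_k -> W) : smooth_target W -> open U -> open O ->
  (forall q, U q -> O (h q)) -> smooth_fun U h -> smooth_on O phi ->
  smooth_fun U (fun q => phi (h q)).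
Proof.
move=> [tW _] oU oO hO hS pS c ac.
apply: (tW _ _ _ O phi (h \o chart_inv c)) => //; first exact: chart_image_open.
  by move=> _ [q [cq Uq] <-] /=; rewrite chart_funK //; exact: hO.
exact: hS.
Qed.

Lemma dfun_comp (W : normedModType R) k (U : set M) (h : M -> 'rV[R]_k)
    (O : set 'rV[R]_k) (phi : 'rV[R]_k -> W) p u : smooth_target W -> open U -> open O ->
  U p -> O (h p) -> smooth_fun U h -> smooth_on O phi ->
  dfun p (fun q => phi (h q)) u = 'D_(dfun p h u) phi (h p).
Proof.
move=> [_ tW] oU oO Up Op hS pS; set a := chart_at p.
have E : (h \o chart_inv a) (a p) = h p by rewrite /= chart_funK //; exact: mem_chart_at.
have dh : derivable (h \o chart_inv a) (a p) u.
  apply: diff_derivable.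
  apply: smooth_fun_differentiable oU Up hS (atlas_at p) (mem_chart_at p).
  exact: smooth_target_rV.
have dp : differentiable phi ((h \o chart_inv a) (a p)) by rewrite E; exact: tW oO pS Op.
by have [_] := is_derive_comp dh dp; rewrite E.
Qed.

Lemma dfunB (W : normedModType R) (U : set M) (h1 h2 : M -> W) p u :
  smooth_target W -> open U -> U p -> smooth_fun U h1 -> smooth_fun U h2 ->
  dfun p (fun q => h1 q - h2 q) u = dfun p h1 u - dfun p h2 u.
Proof.
move=> tW oU Up S1 S2; set a := chart_at p.
have d1 : derivable (h1 \o chart_inv a) (a p) u.
  by apply: diff_derivable; apply: smooth_fun_differentiable tW oU Up S1 (atlas_at p) (mem_chart_at p).
have d2 : derivable (h2 \o chart_inv a) (a p) u.
  by apply: diff_derivable; apply: smooth_fun_differentiable tW oU Up S2 (atlas_at p) (mem_chart_at p).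
by rewrite /dfun -deriveB.
Qed.

Lemma smooth_fun_sub (W : normedModType R) (U : set M) (h1 h2 : M -> W) :
  open U -> smooth_fun U h1 -> smooth_fun U h2 -> smooth_fun U (fun q => h1 q - h2 q).
Proof.
move=> oU S1 S2 c ac; have oc := chart_image_open c oU.
have /smooth_onP C1 := S1 c ac; have /smooth_onP C2 := S2 c ac.
by apply/smooth_onP => k; exact: Ck_sub.
Qed.

Lemma dfun_sum (U : set M) p k (h : M -> 'rV[R]_k) l (a : 'rV[R]_l) (B : 'M[R]_(l, m)) :
  open U -> U p -> smooth_fun U h ->
  dfun p h (a *m B) = \sum_j a 0 j *: dfun p h (row j B).
Proof.
move=> oU Up hS; rewrite mulmx_sum_row.
have tW := @smooth_target_rV R k.
have h0 : dfun p h 0 = 0 by have := dfun_scale 0 0 tW oU Up hS; rewrite !scale0r.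
elim: (index_enum _) => [|j s IHs]; first by rewrite !big_nil.
by rewrite !big_cons (dfun_lin _ _ _ tW oU Up hS) IHs.
Qed.

Lemma derive0_constR (F : 'rV[R]_m -> R) (U : set 'rV[R]_m) y v :
  open U -> smooth_on U F -> (forall t, 0 <= t <= 1 -> U (y + t *: v)) ->
  (forall x, U x -> 'D_v F x = 0) -> F (y + v) = F y.
Proof.
move=> oU FS yU D0; apply/eqP; rewrite -subr_eq0.
have [t t01 E] : exists2 t, 0 <= t <= 1 & F (y + 1 *: v) - F y =
    1 * 'D_v F (y + t *: v).
  apply: (@MVT_line R _ F y v 1 ltr01) => t /yU Ut.
  exact: smooth_on_derivable FS Ut.
by move: E; rewrite scale1r => ->; rewrite mul1r D0 //; exact: yU.
Qed.

Lemma derive0_const k (F : 'rV[R]_m -> 'rV[R]_k) (U : set 'rV[R]_m) y v :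
  open U -> smooth_on U F -> (forall t, 0 <= t <= 1 -> U (y + t *: v)) ->
  (forall x, U x -> 'D_v F x = 0) -> F (y + v) = F y.
Proof.
move=> oU FS yU D0; apply/rowP => j.
have FjS : smooth_on U (fun x => F x 0 j) by move/(smooth_on_mxP _ oU): FS; apply.
apply: (derive0_constR oU FjS yU) => x Ux.
by rewrite derive_coord ?D0 ?mxE //; exact: smooth_on_derivable FS Ux.
Qed.

Lemma local_form_pull (w : M -> 'M[R]_m) k (O : set 'rV[R]_k) (kappa : 'rV[R]_k -> M)
    c z u v : atlas c -> open O -> smooth_into O kappa -> O z -> chart_dom c (kappa z) ->
  form_eval (pull (c \o kappa) (local_form w c) z) u v =
  form_eval (w (kappa z)) (push kappa z u) (push kappa z v).
Proof.
move=> ac oO kS Oz ck.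
have oc : open (chart_dom c) by exact: chart_dom_open.
have tm := @smooth_target_rV R m.
have E x : dfun (kappa z) c (push kappa z x) = x *m jac (c \o kappa) z.
  have [_ <-] := is_derive_push x tm oc oO (smooth_fun_chart ac) kS Oz ck.
  have oN : open (O `&` kappa @^-1` chart_dom c).
    by have [ckc _] := kS; apply: open_setI_preimage.
  have [_ /(_ c ac) /smooth_onP /(_ 1%N) C1] := kS.
  have Nz : (O `&` kappa @^-1` chart_dom c) z by [].
  exact: (derive_jac x oN Nz C1).
by rewrite (form_evalE ac ck) !E form_eval_mul.
Qed.

Lemma pull_symplectic (w : M -> 'M[R]_m) k (O : set 'rV[R]_k)
    (kappa : 'rV[R]_k -> M) c : symplectic w -> atlas c -> open O ->
  smooth_into O kappa -> (forall z, O z -> chart_dom c (kappa z)) ->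
  form2_on O (pull (c \o kappa) (local_form w c)) /\
  closed2_on O (pull (c \o kappa) (local_form w c)).
Proof.
move=> [_ /(_ c) wc _] ac oO [ck kS] kc; have [w2 wcl] := wc ac.
have kSO : smooth_on O (c \o kappa).
  by apply: smooth_on_subset (kS c ac) => z Oz; split=> //; exact: kc.
have oi : open (chart_img c) by exact: chart_img_open.
have kin z : O z -> chart_img c ((c \o kappa) z) by move=> /kc /chart_imgE.
split; first exact: (form2_pull oO oi kSO kin w2).
exact: (closed2_pull oO oi kSO kin w2 wcl).
Qed.

End calculus_supplements.

(** * Good functions: uniqueness up to functions of f *)

Section local_primitives.
Variables (R : realType) (n : nat) (M : manifold R (n + n)).
Variables (w : M -> 'M[R]_(n + n)) (f : M -> 'rV[R]_n).
Variable (X : 'I_n -> M -> 'rV[R]_(n + n)).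
Hypothesis w_symplectic : symplectic w.
Hypothesis f_smooth : smooth_fun setT f.
Hypothesis X_formE : forall i p v,
  form_eval (w p) (X i p) v = dfun p (fun q => f q 0 i) v.
Hypothesis ker_df : forall p v, dfun p f v = 0 <-> exists a, v = a *m Xmx X p.

Let oT := @openT M.
Let trV k := @smooth_target_rV R k.

(* On [W], [(f, g)] are coordinates in which [X_i] is minus the [i]-th
   vertical coordinate field. *)
Definition good (W : set M) (g : M -> 'rV[R]_n) := [/\ open W, smooth_fun W g &
  forall p i, W p -> dfun p g (X i p) = - std_basis R i].

Lemma dfun_fX p i : dfun p f (X i p) = 0.
Proof. by apply/ker_df; exists (std_basis R i); rewrite -rowE rowK. Qed.

Lemma good_vertical W g p a : good W g -> W p -> dfun p g (a *m Xmx X p) = - a.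
Proof.
move=> [oW gS gX] Wp; rewrite (dfun_sum _ _ oW Wp gS).
rewrite {2}(row_sum_delta a) -sumrN; apply: eq_bigr => j _.
by rewrite rowK gX // scalerN.
Qed.

Lemma good_fg_inj W g p u : good W g -> W p ->
  dfun p (fun q => row_mx (f q) (g q)) u = 0 -> u = 0.
Proof.
move=> gg Wp; have [oW gS _] := gg.
have fS : smooth_fun W f by exact: smooth_fun_subset f_smooth.
rewrite (dfun_row_mx oW _ Wp fS gS) -[X in _ = X -> _]row_mx0.
move=> /eq_row_mx[/ker_df[a ->]]; rewrite (good_vertical _ gg Wp) => /eqP.
by rewrite oppr_eq0 => /eqP ->; rewrite mul0mx.
Qed.

Lemma good_chart W g p : good W g -> W p ->
  let Theta q := row_mx (f q) (g q) in
  exists (r : R) (kappa : 'rV[R]_(n + n) -> M),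
   [/\ 0 < r, smooth_into (ball (Theta p) r) kappa,
       forall z, ball (Theta p) r z -> W (kappa z) /\ Theta (kappa z) = z,
       kappa (Theta p) = p
     & \forall q \near p, ball (Theta p) r (Theta q) /\ kappa (Theta q) = q].
Proof.
move=> gg Wp Theta; have [oW gS _] := gg.
have fS : smooth_fun W f by exact: smooth_fun_subset f_smooth.
apply: local_inverse => //; first exact: smooth_fun_row_mx.
by move=> u; exact: good_fg_inj gg Wp.
Qed.

Lemma ball_rowP k (x y : 'rV[R]_k) e : 0 < e ->
  ball x e y <-> forall i, `|y 0 i - x 0 i| < e.
Proof.
move=> e0; split=> [+ i|H].
  rewrite -ball_normE /= distrC => yx.
  by apply: le_lt_trans yx; have := rV_coord_norm (y - x) i; rewrite !mxE.
split=> // i j; rewrite ord1 /ball /= /ball_ distrC; exact: H.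
Qed.

Lemma ball_row_mx (x x' y y' : 'rV[R]_n) e : 0 < e ->
  ball (row_mx x y) e (row_mx x' y') <-> ball x e x' /\ ball y e y'.
Proof.
move=> e0; rewrite !ball_rowP //; split=> [H|[H1 H2] i].
  split=> i; first by have := H (lshift n i); rewrite !row_mxEl.
  by have := H (rshift n i); rewrite !row_mxEr.
by case: (split_ordP i) => j ->; rewrite ?row_mxEl ?row_mxEr.
Qed.

Lemma smooth_on_row_mxl (y : 'rV[R]_n) U :
  smooth_on U (fun x : 'rV[R]_n => row_mx x y : 'rV[R]_(n + n)).
Proof.
apply: (smooth_on_subset (U' := setT)) => //; apply/smooth_onP => k.
have oV := @openT 'rV[R]_n; apply/(Ck_mxP _ _ oV) => i j.
case: (split_ordP j) => l ->.
  apply: (@eq_Ck _ _ _ _ _ (fun x : 'rV[R]_n => x i l)) => //.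
    by move=> x _; rewrite row_mxEl.
  by move/(Ck_mxP _ _ oV): (@Ck_id R 'rV[R]_n k setT); apply.
apply: (@eq_Ck _ _ _ _ _ (cst (y i l))) => //; last exact: Ck_cst.
by move=> x _; rewrite row_mxEr.
Qed.

(** Both differentials send [a *m Xmx X p] to [- a], so in the coordinates [(f, g1)] the difference
    has no vertical derivative. [c] is its restriction to the slice where [g1] equals [g1 p]. *)
Lemma good_compat W1 g1 W2 g2 p : good W1 g1 -> good W2 g2 -> W1 p -> W2 p ->
  exists O c, [/\ open O, O (f p), smooth_on O c &
    \forall q \near p, O (f q) /\ g2 q - g1 q = c (f q)].
Proof.
move=> G1 G2 W1p W2p; have [oW1 S1 X1] := G1; have [oW2 S2 X2] := G2.
pose W := W1 `&` W2; have oW : open W by exact: openI.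
have gg : good W g1.
  by split=> // [|q i [? _]]; [apply: smooth_fun_subset S1 => q []|exact: X1].
have S1' : smooth_fun W g1 by have [] := gg.
have S2' : smooth_fun W g2 by apply: smooth_fun_subset S2 => q [].
have fS : smooth_fun W f by exact: smooth_fun_subset f_smooth.
have [r [kappa [r0 kS kin kp kn]]] := good_chart gg (conj W1p W2p).
set Theta := (fun q => row_mx (f q) (g1 q)) in kS kin kp kn.
have TS : smooth_fun W Theta by exact: smooth_fun_row_mx.
pose d q : 'rV[R]_n := g2 q - g1 q.
have dS : smooth_fun W d by exact: smooth_fun_sub.
set Bl := ball (Theta p) r in kS kin kn.
have oB : open Bl by exact: ball_open.
have DS : smooth_on Bl (d \o kappa).
  by apply: smooth_fun_into (trV n) oW oB dS kS _ => z /kin[].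
have D0 y z : Bl z -> 'D_(row_mx 0 y) (d \o kappa) z = 0.
  move=> Bz; have [Wk kT] := kin z Bz.
  have [_ ->] := is_derive_push (row_mx 0 y) (trV n) oW oB dS kS Bz Wk.
  have TE : dfun (kappa z) Theta (push kappa z (row_mx 0 y)) = row_mx 0 y.
    apply: (dfun_push _ oW Wk TS oB Bz kS).
    by apply: nbhsS (open_nbhs_nbhs (conj oB Bz)) _ => x /kin[].
  have fE : dfun (kappa z) f (push kappa z (row_mx 0 y)) = 0.
    by move: TE; rewrite (dfun_row_mx oW _ Wk fS S1') => /eq_row_mx[].
  have [a ->] := (ker_df _ _).1 fE.
  rewrite (dfunB _ (trV n) oW Wk S2' S1') (good_vertical _ gg Wk).
  by rewrite (good_vertical _ G2) ?subrr //; case: Wk.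
pose O := ball (f p) r; pose c x := (d \o kappa) (row_mx x (g1 p)).
have OB x : O x -> Bl (row_mx x (g1 p)).
  by move=> Ox; apply/ball_row_mx => //; split=> //; exact: ballxx.
exists O, c; split.
- exact: ball_open.
- exact: ballxx.
- have oO : open O by exact: ball_open.
  exact: (@smooth_on_comp R 'rV[R]_n (n + n) 1 n O Bl (d \o kappa)
    (fun x => row_mx x (g1 p)) oO oB OB DS (@smooth_on_row_mxl (g1 p) O)).
apply: nbhsS kn _ => q [Bq kq].
have [Oq gq] := (ball_row_mx _ _ _ _ r0).1 Bq; split=> //.
have E : row_mx (f q) (g1 q) = row_mx (f q) (g1 p) + row_mx 0 (g1 q - g1 p).
  by rewrite add_row_mx addr0 addrC subrK.
rewrite -/(d q) -{1}kq /Theta E.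
apply: (derive0_const oB DS) => [t t01|x]; last exact: D0.
rewrite scale_row_mx scaler0 add_row_mx addr0; apply/ball_row_mx => //; split=> //.
rewrite -ball_normE /= distrC; apply: ball_convex => //.
  by rewrite subrr normr0.
by move: gq; rewrite -ball_normE /= distrC.
Qed.

End local_primitives.

Lemma form_eval_antisym (R : realType) m (A : 'M[R]_m) u v : A^T = - A ->
  form_eval A u v = - form_eval A v u.
Proof.
move=> AT; rewrite /form_eval -[u *m A *m v^T]trmxK [(_^T)^T _ _]mxE.
by rewrite !trmx_mul trmxK AT mulNmx mulmxN mulmxA mxE.
Qed.

(** * Local existence of good functions *)

Section good_existence.
Variables (R : realType) (n : nat) (M : manifold R (n + n)).
Variables (w : M -> 'M[R]_(n + n)) (f : M -> 'rV[R]_n).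
Variable (X : 'I_n -> M -> 'rV[R]_(n + n)).
Hypothesis w_symplectic : symplectic w.
Hypothesis f_smooth : smooth_fun setT f.
Hypothesis f_lagrangian : forall p, lagrangian w (f @^-1` [set f p]).
Hypothesis X_hamiltonian : forall i, hamiltonian_field w (fun p => f p 0 i) (X i).
Hypothesis X_free : forall p, row_free (\matrix_(i < n) X i p).

Let trV k := @smooth_target_rV R k.
Let ker_df := kernel_df w_symplectic f_smooth f_lagrangian X_hamiltonian X_free.

Lemma form_eval_Xmx p (a : 'rV[R]_n) u :
  form_eval (w p) (a *m Xmx X p) u = (a *m (dfun p f u)^T) 0 0.
Proof.
rewrite (dfun_fE f_smooth X_hamiltonian) trmx_mul trmxK /form_eval.
by rewrite !mulmxA.
Qed.

Lemma good_exists p : exists W, exists2 g, good X W g & W p.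
Proof.
have [L [r [kappa [r0 PS kS kin [kp kn]]]]] :=
  submersion_chart w_symplectic f_smooth X_hamiltonian X_free p.
set a := chart_at p in PS kin; set Phi := (fun q => _) in PS kS kin kp kn.
have aa : atlas a by exact: atlas_at.
have oa : open (chart_dom a) by exact: chart_dom_open.
have aS : smooth_fun (chart_dom a) a by exact: smooth_fun_chart.
have aLS := smooth_fun_mulmxr oa L aS.
have fS : smooth_fun (chart_dom a) f by exact: smooth_fun_subset f_smooth.
set Bl := ball (Phi p) r in kS kin kn.
have oB : open Bl by exact: ball_open.
pose theta := pull (a \o kappa) (local_form w a).
have [[tS tA] tC] : form2_on Bl theta /\ closed2_on Bl theta.
  by apply: pull_symplectic => // z /kin[].
have thetaE z u v : Bl z ->
    form_eval (theta z) u v = form_eval (w (kappa z)) (push kappa z u) (push kappa z v).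
  by move=> Bz; have [ak _] := kin z Bz; exact: (local_form_pull w u v aa oB kS Bz ak).
have fpush z v : Bl z -> dfun (kappa z) f (push kappa z v) = lsubmx v.
  move=> Bz; have [ak _] := kin z Bz.
  have kT : \forall y \near z, Phi (kappa y) = y.
    by apply: (nbhsS (open_nbhs_nbhs (conj oB Bz))) => x /kin[].
  have vE := dfun_push v oa ak PS oB Bz kS kT.
  have E := dfun_row_mx oa (push kappa z v) ak fS aLS.
  by rewrite -[in RHS]vE [X in lsubmx X]E row_mxKl.
(* Vertical vectors are pushed into ker df, which is spanned by the [X_i] and isotropic. *)
have vv z j k : Bl z -> theta z (rshift n j) (rshift n k) = 0.
  move=> Bz; rewrite -form_eval_basis thetaE //.
  have v0 i : lsubmx (std_basis R (rshift n i)) = 0 :> 'rV[R]_n.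
    by apply/rowP => l; rewrite !mxE eq_lrshift andbF.
  have /ker_df[b ->] : dfun (kappa z) f (push kappa z (std_basis R (rshift n j))) = 0.
    by rewrite fpush.
  by rewrite form_eval_Xmx fpush // v0 trmx0 mulmx0 mxE.
pose eta i k z := theta z (lshift n i) k.
have etaS i k : smooth_on Bl (eta i k) by move/(smooth_on_mxP _ oB): tS; apply.
pose S : pred 'I_(n + n) := fun l => (n <= l)%N.
have SE l : S l -> exists j, l = rshift n j.
  by case: (split_ordP l) => j -> //; [rewrite /S /= leqNgt ltn_ord|exists j].
(* In the cyclic identity for one base and two fibre indices, the first term differentiates an entry
   that vanishes by [vv]; antisymmetry turns the other two into closedness of [eta i] along the
   fibre. *)
have closed i j k z : S j -> S k -> Bl z ->
    'D_(std_basis R j) (eta i k) z = 'D_(std_basis R k) (eta i j) z.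
  move=> /SE[j' ->] /SE[k' ->] Bz.
  have Bn : \forall y \near z, Bl y by exact: (open_nbhs_nbhs (conj oB Bz)).
  have := tC z Bz (lshift n i) (rshift n j') (rshift n k').
  rewrite [X in X + _ + _](@near_eq_derive _ _ _ _ (cst 0)); last first.
    by apply: (nbhsS Bn) => y By; rewrite vv.
  rewrite derive_cst add0r.
  rewrite [X in X + _](@near_eq_derive _ _ _ _ (- eta i (rshift n k'))); last first.
    apply: (nbhsS Bn) => y By; rewrite /eta fctE.
    by have /matrixP/(_ (lshift n i) (rshift n k')) := tA y By; rewrite !mxE.
  rewrite deriveN; last exact: smooth_on_derivable (etaS _ _) Bz.
  by rewrite addrC => /eqP; rewrite subr_eq0 => /eqP ->.
have /choice[gam gamP] : forall i, exists gam : 'rV[R]_(n + n) -> R, smooth_on Bl gam /\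
    forall j z, S j -> Bl z -> 'D_(std_basis R j) gam z = eta i j z.
  move=> i; have [gam g1 g2] := fibrewise_primitive (etaS i) (closed i).
  by exists gam.
(* Taking the interior makes [kappa] a local inverse of [Phi] around every point of [W], as
   [push_dfun] requires. *)
pose W := interior [set q | chart_dom a q /\ Bl (Phi q) /\ kappa (Phi q) = q].
have WP q : W q -> [/\ chart_dom a q, Bl (Phi q) & \forall q' \near q, kappa (Phi q') = q'].
  move=> Wq; have [? [? _]] := interior_subset Wq; split=> //.
  by apply: (nbhsS Wq) => q' [_ []].
have oW : open W by exact: open_interior.
have PSW : smooth_fun W Phi by apply: smooth_fun_subset PS => q /WP[].
pose g q : 'rV[R]_n := \row_i gam i (Phi q).
have gS i : smooth_fun W (fun q => gam i (Phi q)).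
  have [gi _] := gamP i.
  apply: (smooth_fun_comp (@smooth_targetR R) oW oB _ PSW gi).
  by move=> q /WP[].
have gE i : (fun q => g q 0 i) = (fun q => gam i (Phi q)).
  by apply/funext => q; rewrite mxE.
have gSm : smooth_fun W g.
  by apply: (smooth_fun_rowP oW) => i; rewrite gE; exact: gS.
exists W, g; last first.
  by apply: (nbhsS2 (open_nbhs_nbhs (conj oa (mem_chart_at p))) kn) => q ? [].
split; [exact: oW|exact: gSm|move=> q j Wq]; have [aq Bq kq] := WP q Wq.
have kqq := nbhs_singleton kq.
set zeta := dfun q Phi (X j q).
have zl : lsubmx zeta = 0.
  by rewrite /zeta (dfun_row_mx oa _ aq fS aLS) row_mxKl (dfun_fX ker_df).
have pz : push kappa (Phi q) zeta = X j q by exact: (push_dfun _ oa aq PS oB Bq kS kq).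
apply/rowP => i; rewrite -(dfun_coord _ _ oW Wq gSm).
rewrite gE.
have [gi giD] := gamP i.
rewrite (dfun_comp _ (@smooth_targetR R) oa oB aq Bq PS gi) -/zeta.
have gC : Ck 1 Bl (gam i) by move/smooth_onP: gi; apply.
rewrite (deriveE_sum _ (C1_differentiable oB Bq gC)).
(* Only the vertical components of [zeta] survive, and there the partial derivatives of [gam i] are
   entries of row [lshift n i] of [theta]. *)
transitivity (form_eval (theta (Phi q)) (std_basis R (lshift n i)) zeta).
  rewrite /form_eval -rowE mxE; apply: eq_bigr => k _.
  rewrite [zeta^T _ _]mxE [row _ _ _ _]mxE [RHS]mulrC.
  case: (split_ordP k) => l kE.
    have -> : zeta 0 k = 0 by have /rowP/(_ l) := zl; rewrite !mxE kE.
    by rewrite !mul0r.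
  by rewrite giD // /S kE leq_addr.
(* Antisymmetry leaves [- w(X_j, v) = - df_j(v)], where [v] is the push-forward of the i-th base
   vector. *)
rewrite (form_eval_antisym _ _ (tA _ Bq)) thetaE // pz kqq [RHS]mxE; congr (- _).
have -> : X j q = std_basis R j *m Xmx X q by rewrite -rowE rowK.
have := fpush _ (std_basis R (lshift n i)) Bq; rewrite kqq => fp.
rewrite form_eval_Xmx fp -rowE !mxE eq_lshift eq_sym.
by rewrite ?eqxx.
Qed.

End good_existence.

Lemma subr_swap (V : zmodType) (a b c d : V) : a - b = c - d -> a - c = b - d.
Proof.
move=> /(canRL (subrK b)) ->.
by rewrite addrAC [c - d]addrC addrK addrC.
Qed.

(** * Good functions over balls of the base *)

Section good_over_base.
Variables (R : realType) (n : nat) (M : manifold R (n + n)).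
Variables (f : M -> 'rV[R]_n) (X : 'I_n -> M -> 'rV[R]_(n + n)).
Hypothesis f_smooth : smooth_fun setT f.
Hypothesis ker_df : forall p v, dfun p f v = 0 <-> exists a, v = a *m Xmx X p.
Hypothesis good_cover : forall p, exists W, exists2 g, good X W g & W p.

Let oT := @openT M.
Let trV k := @smooth_target_rV R k.

Let f_cont : continuous f.
Proof. by move=> p; exact: (smooth_fun_continuous f_smooth oT). Qed.

Lemma good_local W g : open W ->
  (forall p, W p -> exists W' g', [/\ good X W' g', W' p & \forall q \near p, g q = g' q]) ->
  good X W g.
Proof.
move=> oW H; split=> // [|p i Wp]; last first.
  by have [W' [g' [[_ _ gX] W'p E]]] := H p Wp; rewrite (near_eq_dfun _ E) gX.
apply: (smooth_fun_local (trV n) oW) => p Wp.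
have [W' [g' [[oW' gS _] W'p E]]] := H p Wp.
exists (chart_at p); first exact: atlas_at.
split; first exact: mem_chart_at.
pose U := W' `&` interior [set q | g q = g' q].
have oU : open U by apply: openI => //; exact: open_interior.
exists (chart_at p @` (chart_dom (chart_at p) `&` U)).
  split; first exact: chart_image_open.
  by exists p => //; split; [exact: mem_chart_at|split].
have gSU : smooth_fun U g'.
  by apply: (smooth_fun_subset _ gS) => q [].
have : smooth_fun U g.
  by apply: (smooth_fun_eq oU _ gSU) => q [_ /interior_subset /= ->].
by apply; exact: atlas_at.
Qed.

(** A function of [f] has zero derivative along the [X_i], so subtracting it preserves goodness. *)
Lemma good_shift W g (O : set 'rV[R]_n) (c : 'rV[R]_n -> 'rV[R]_n) : good X W g -> open O ->
  smooth_on O c -> good X (W `&` f @^-1` O) (fun q => g q - c (f q)).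
Proof.
move=> [oW gS gX] oO cS; set U := W `&` _.
have oU : open U by apply: open_setI_preimage => // q _; exact: f_cont.
have gSU : smooth_fun U g by apply: (smooth_fun_subset _ gS) => q [].
have fSU : smooth_fun U f by apply: (smooth_fun_subset _ f_smooth).
have cSU : smooth_fun U (fun q => c (f q)).
  by apply: (smooth_fun_comp (trV n) oU oO _ fSU cS) => q [].
split=> [//||q i Uq]; first exact: smooth_fun_sub.
have [Wq Oq] := Uq.
rewrite (dfunB _ (trV n) oU Uq gSU cSU) gX // (dfun_comp _ (trV n) oU oO Uq Oq fSU cS).
have dc : differentiable c (f q) by have [_ td] := trV n; exact: td oO cS Oq.
by rewrite (dfun_fX ker_df) deriveE // linear0 subr0.
Qed.

(** In the coordinates [(f, g)] the fibres become affine slices of a ball, and the segment between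
    two points of a slice stays inside. *)
Lemma vertical_segment W g p : good X W g -> W p ->
  exists2 N, nbhs p N & forall q1 q2, N q1 -> N q2 -> f q1 = f q2 ->
    exists mid : R -> M, [/\ continuous mid, forall t, f (mid t) = f q1 /\ W (mid t),
      mid 0 = q1 & mid 1 = q2].
Proof.
move=> gg Wp; have [r [kappa [r0 kS kin kp kn]]] := good_chart f_smooth ker_df gg Wp.
set Theta := (fun q => row_mx (f q) (g q)) in kS kin kp kn.
exists [set q | ball (Theta p) r (Theta q) /\ kappa (Theta q) = q]; first exact: kn.
move=> q1 q2 [B1 k1] [B2 k2] f12.
pose v : 'rV[R]_(n + n) := row_mx 0 (g q2 - g q1).
have inB t : ball (Theta p) r (Theta q1 + clamp t *: v).
  rewrite /Theta /v scale_row_mx scaler0 add_row_mx addr0; apply/(ball_row_mx _ _ _ _ r0).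
  have [h1 h2] := (ball_row_mx _ _ _ _ r0).1 B1.
  have [_ h3] := (ball_row_mx _ _ _ _ r0).1 B2.
  split=> //; move: h2 h3; rewrite -!ball_normE /= => h2 h3.
  rewrite distrC; apply: (ball_convex (clamp_itv t)); rewrite distrC //.
exists (fun t => kappa (Theta q1 + clamp t *: v)); split.
- move=> t; have [ck _] := kS.
  apply: (@continuous_comp _ _ _ (fun t => Theta q1 + clamp t *: v) kappa); last exact/ck/inB.
  by apply: cvgD; [exact: cvg_cst|apply: cvgZr_tmp; exact: clamp_continuous].
- move=> t; have [Wk TE] := kin _ (inB t); split=> //.
  move/(congr1 lsubmx): TE; rewrite row_mxKl => ->.
  by rewrite /Theta /v scale_row_mx scaler0 add_row_mx addr0 row_mxKl.
- by rewrite clamp0 scale0r addr0.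
rewrite clamp1 scale1r /Theta /v add_row_mx addr0 addrC subrK f12.
exact: k2.
Qed.

Lemma fibre_potential b : simply_connected R (f @^-1` [set b]) ->
  exists G : M -> 'rV[R]_n, forall W g p, good X W g -> W p -> f p = b ->
    \forall q \near p, f q = b -> G q - g q = G p - g p.
Proof.
apply: (fibre_primitive (GG := good X)).
- by move=> W g [].
- by move=> p _; exact: good_cover.
- move=> W1 g1 W2 g2 p G1 G2 W1p W2p fp.
  have [ O [c [_ _ _ cn]]] := good_compat f_smooth ker_df G2 G1 W2p W1p.
  have [_ E] := nbhs_singleton cn.
  apply: (nbhsS cn) => q [_ E'] fq.
  by rewrite E E' [f q]fq [f p]fp.
- move=> W g p gg Wp fp; have [N Np HN] := vertical_segment gg Wp.
  apply: (nbhsS Np) => q Nq fq.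
  have fqp : f p = f q by rewrite [f q]fq.
  have [mid [cm fm m0 m1]] := HN p q (nbhs_singleton Np) Nq fqp.
  exists mid; split=> // t; have [ft Wt] := fm t; split=> //=.
  by rewrite ft.
Qed.

(** The section is a horizontal slice of [(f, g)]. Constancy of [g] on it matters later: normalising
    a potential on [sigma] then amounts to subtracting a constant from [g]. *)
Lemma local_section p : exists W g (r : R) (sigma : 'rV[R]_n -> M),
  [/\ good X W g, 0 < r, sigma (f p) = p,
      forall x, ball (f p) r x -> {for x, continuous sigma}
    & forall x, ball (f p) r x -> [/\ W (sigma x), f (sigma x) = x & g (sigma x) = g p]].
Proof.
have [W [g gg Wp]] := good_cover p.
have [r [kappa [r0 [ck kS] kin kp kn]]] := good_chart f_smooth ker_df gg Wp.
exists W, g, r, (fun x => kappa (row_mx x (g p))).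
have inB x : ball (f p) r x -> ball (row_mx (f p) (g p)) r (row_mx x (g p)).
  by move=> bx; apply/(ball_row_mx _ _ _ _ r0); split=> //; exact: ballxx.
split=> // x bx; last first.
  by have [Wk /eq_row_mx[]] := kin _ (inB x bx).
apply: (@continuous_comp _ _ _ (fun x => row_mx x (g p)) kappa); last exact/ck/inB.
have := @smooth_on_row_mxl R n (g p) setT => /smooth_on_continuous; exact.
Qed.

Lemma fibration_open p (N : set M) : nbhs p N -> \forall x \near f p, exists2 q, N q & f q = x.
Proof.
have [W [g [r [sigma [_ r0 sp cs sE]]]]] := local_section p.
have bp : ball (f p) r (f p) by exact: ballxx.
rewrite -{1}sp => /(cs _ bp) sN.
have Bn : nbhs (f p) (ball (f p) r) by exact: nbhsx_ballx.
apply: (nbhsS2 sN Bn) => x Nx Bx; exists (sigma x) => //.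
by have [] := sE x Bx.
Qed.

Section potentials.
Variable G : 'rV[R]_n -> M -> 'rV[R]_n.
Hypothesis GP : forall W g p, good X W g -> W p ->
  \forall q \near p, f q = f p -> G (f p) q - g q = G (f p) p - g p.

(** [GP] only controls [G] on each fibre separately, in a neighbourhood depending on the point.
    Following vertical segments gives one [N] that serves all nearby fibres. *)
Lemma potential_const W g p : good X W g -> W p ->
  exists2 N, nbhs p N & forall q1 q2, N q1 -> N q2 -> f q1 = f q2 ->
    G (f q1) q1 - g q1 = G (f q1) q2 - g q2.
Proof.
move=> gg Wp; have [N Np HN] := vertical_segment gg Wp; exists N => // q1 q2 N1 N2 f12.
have [mid [cm fm m0 m1]] := HN q1 q2 N1 N2 f12.
have loc t : \forall s \near t,
    G (f q1) (mid s) - g (mid s) = G (f q1) (mid t) - g (mid t).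
  have [ft Wt] := fm t; have := GP gg Wt; rewrite ft => Gt.
  by apply: (nbhsS (cm t _ Gt)) => s /=; apply; have [] := fm s.
have := @connected_clopenR R (fun t => G (f q1) (mid t) - g (mid t) = G (f q1) q1 - g q1)
  _ _ 0 1.
rewrite m0 m1 => H; rewrite H //.
  by move=> t E; apply: (nbhsS (loc t)) => s ->.
by move=> t E; apply: (nbhsS (loc t)) => s ->.
Qed.

Lemma good_over_ball p0 : (forall p, path_connected R (f @^-1` [set f p])) ->
  exists2 r : R, 0 < r & exists g, good X (f @^-1` ball (f p0) r) g.
Proof.
move=> pc; have [W0 [g0 [r [sigma [gg0 r0 sp cs sE]]]]] := local_section p0.
set U := ball (f p0) r in cs sE.
have oU : open U by exact: ball_open.
(* The potential of each fibre has an arbitrary additive constant; subtracting its value on the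
   section removes it. *)
pose gU q := G (f q) q - G (f q) (sigma (f q)).
exists r => //; exists gU.
have ofU : open (f @^-1` U).
  by have := @open_setI_preimage _ _ _ f _ oT (fun q _ => f_cont (x := q)) oU; rewrite setTI.
apply: good_local => // q Uq.
pose P q := exists W g, [/\ good X W g, W q & \forall q' \near q, gU q' = g q'].
rewrite -[exists W' g', _]/(P q).
have Pbase x : U x -> P (sigma x).
  move=> Ux; have [Wx fx gx] := sE x Ux.
  (* Near the section, [gU] is [g0] minus its constant value [g0 p0] on [sigma]. *)
  exists (W0 `&` f @^-1` setT), (fun q => g0 q - cst (g0 p0) (f q)); split=> //.
    apply: (good_shift gg0 (@openT 'rV[R]_n)).
    by apply/smooth_onP => k; exact: Ck_cst.
  have [N Nx HN] := potential_const gg0 Wx.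
  have Un : nbhs (sigma x) (f @^-1` U) by apply: open_nbhs_nbhs; split=> //=; rewrite fx.
  have sn : nbhs (sigma x) ((sigma \o f) @^-1` N).
    apply: (@continuous_comp _ _ _ f sigma); [exact: f_cont| |].
      by rewrite fx; exact: cs.
    by rewrite /= fx.
  apply: (nbhsS3 Nx Un sn) => q' Nq' Uq' Nsq'.
  have [_ fs gs] := sE _ Uq'.
  have := HN q' _ Nq' Nsq' (esym fs).
  by rewrite gs; exact: subr_swap.
(* Near [q1] the difference [gU - g] depends on [f] alone by [potential_const]. Its smoothness,
   known around [q2], therefore passes to any nearby [q3] of the same fibre, openness of [f]
   providing the points to compare with. *)
have Pstep q1 : U (f q1) -> exists2 N, nbhs q1 N & forall q2 q3, N q2 -> N q3 ->
    f q2 = f q3 -> P q2 -> P q3.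
  move=> Uq1; have [W [g gg Wq1]] := good_cover q1.
  have [N Nq1 HN] := potential_const gg Wq1.
  have oW : open W by have [] := gg.
  exists (interior N `&` W).
    by apply: filterI; [exact: nbhs_interior|exact: (open_nbhs_nbhs (conj oW Wq1))].
  move=> q2 q3 [N2 W2] [N3 W3] f23 [W' [g' [gg' W'2 E']]].
  have [ O [c [ oO Oq2 cS cn]]] := good_compat f_smooth ker_df gg gg' W2 W'2.
  exists (W `&` f @^-1` O), (fun q => g q - - c (f q)); split.
  - apply: (good_shift gg oO (c := fun x => - c x)).
    by apply/smooth_onP => k; apply: Ck_opp => //; move/smooth_onP: cS; apply.
  - by split=> //=; rewrite -f23.
  have M1 : nbhs q2 [set q' | N q' /\ gU q' - g q' = c (f q')].
    by apply: (nbhsS3 N2 E' cn) => q' Nq' /= Eq' [_ Ec];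
      split=> //; rewrite Eq'.
  have := fibration_open M1; rewrite f23 => /f_cont M2.
  apply: (nbhsS2 N3 M2) => q4 N4 [q5 [N5 E5] f5].
  have := HN q4 q5 N4 N5 (esym f5) => E6.
  have E7 : gU q4 - g q4 = gU q5 - g q5 by rewrite /gU f5 addrAC E6 addrAC.
  by rewrite /= opprK -f5 -E5 -E7 addrC subrK.
have [_ fq _] := sE _ Uq.
have [_ /(_ (sigma (f q)) q fq erefl) [gamma [[cg Fg] g0E g1E]]] := pc q.
pose delta := gamma \o @clamp R.
have cd : continuous delta.
  apply: (continuous_within_comp cg (@clamp_continuous R)) => t.
  by rewrite /= in_itv /= clamp_itv.
have fd t : f (delta t) = f q.
  by apply: Fg; rewrite /= in_itv /= clamp_itv.
have -> : q = delta 1 by rewrite /delta /= clamp1.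
apply: (@connected_clopenR R (fun t => P (delta t)) _ _ 0 1).
- move=> t Pt; have Ut : U (f (delta t)) by rewrite fd.
  have [N Nt HN] := Pstep _ Ut; apply: (nbhsS (cd t _ Nt)) => s Ns.
  by apply: (HN (delta t)) => //; [exact: nbhs_singleton|rewrite !fd].
- move=> t Pt; have Ut : U (f (delta t)) by rewrite fd.
  have [N Nt HN] := Pstep _ Ut; apply: (nbhsS (cd t _ Nt)) => s Ns Ps; apply: Pt.
  by apply: (HN (delta s)) => //; [exact: nbhs_singleton|rewrite !fd].
by rewrite /delta /= clamp0 g0E; exact: Pbase.
Qed.

End potentials.

End good_over_base.

(** * Gluing over the base *)

Section gluing.
Variables (R : realType) (n : nat) (M : manifold R (n + n)).
Variables (f : M -> 'rV[R]_n) (X : 'I_n -> M -> 'rV[R]_(n + n)).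
Hypothesis f_smooth : smooth_fun setT f.
Hypothesis ker_df : forall p v, dfun p f v = 0 <-> exists a, v = a *m Xmx X p.
Hypothesis good_cover : forall p, exists W, exists2 g, good X W g & W p.

Let f_cont : continuous f.
Proof. by move=> p; exact: (smooth_fun_continuous f_smooth (@openT M)). Qed.

Section partition.
Variables (phi : nat -> 'rV[R]_n -> R) (U : nat -> set 'rV[R]_n).
Variable G : nat -> M -> 'rV[R]_n.
Hypothesis phi_smooth : forall k, smooth_on setT (phi k).
Hypothesis G_good : forall k, good X (f @^-1` U k) (G k).
Hypothesis phi_support : forall k x, U k x \/ \forall y \near x, phi k y = 0.
Hypothesis phi_cover : forall p, exists k, \forall y \near f p, phi k y = 1.

(** The telescoping partition of unity of a sequence of cut-offs. Wherever [phi j] is 1, all weights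
    of index above [j] vanish, so sums may be truncated there. *)
Definition weight k x := phi k x * \prod_(j < k) (1 - phi j x).

Lemma sum_weight K x : \sum_(k < K) weight k x = 1 - \prod_(j < K) (1 - phi j x).
Proof.
elim: K => [|K IHK]; first by rewrite !big_ord0 subrr.
by rewrite big_ord_recr IHK [in RHS]big_ord_recr /= /weight; ring.
Qed.

Lemma weight_eq0 k j x : phi j x = 1 -> (j < k)%N -> weight k x = 0.
Proof.
by move=> pj jk; rewrite /weight (bigD1 (Ordinal jk)) //= pj subrr mul0r mulr0.
Qed.

(** The truncation index may be chosen separately at each point without changing the sum. *)
Lemma weighted_sum_stable (v : nat -> 'rV[R]_n) j k x : phi j x = 1 -> phi k x = 1 ->
  \sum_(i < j.+1) weight i x *: v i = \sum_(i < k.+1) weight i x *: v i.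
Proof.
wlog jk : j k / (j <= k)%N => [H pj pk|pj _].
  by case: (leqP j k) => [|/ltnW] jk; [exact: H|apply/esym; exact: H].
rewrite -(subnKC jk) -addSn; elim: (k - j)%N => [|l IHl]; first by rewrite addn0.
rewrite addnS [RHS]big_ord_recr /= -IHl (weight_eq0 pj) ?scale0r ?addr0 //.
by rewrite addSn ltnS leq_addr.
Qed.

Lemma weight_smooth k O : smooth_on O (weight k).
Proof.
apply: (smooth_on_subset (U' := setT)) => //; apply/smooth_onP => l.
have oT := @openT 'rV[R]_n.
have pC j : Ck l setT (phi j) by move/smooth_onP: (phi_smooth j); apply.
have qC : Ck l setT (fun x => \prod_(j < k) (1 - phi j x)).
  by apply: Ck_prod => // j _; exact: (Ck_sub oT (Ck_cst _ _ _) (pC j)).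
exact: (Ck_mul oT (pC k) qC).
Qed.

(** Either [G k] is good near [p] and differs from [g] by a function of [f], or the weight of index
    [k] vanishes near [f p]; in both cases the term is a smooth function of [f]. *)
Lemma glue_local W g p K : good X W g -> W p ->
  exists O C, [/\ open O, O (f p), smooth_on O C & \forall q \near p,
    \sum_(k < K) weight k (f q) *: (G k q - g q) = C (f q)].
Proof.
move=> gg Wp; elim: K => [|K [ O [C [ oO Op CS Cn]]]].
  exists setT, (cst 0); split=> //; first exact: openT.
    by apply/smooth_onP => k; exact: Ck_cst.
  by near=> q; rewrite big_ord0.
have [Up|p0] := phi_support K (f p); last first.
  exists O, C; split=> //; apply: (nbhsS2 Cn (f_cont p0)) => q <- /= p0q.
  by rewrite big_ord_recr /= /weight p0q mul0r scale0r addr0.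
have [ O' [c [oO' O'p cS cn]]] := good_compat f_smooth ker_df gg (G_good K) Wp Up.
have oOO : open (O `&` O') by exact: openI.
exists (O `&` O'), (fun x => C x + weight K x *: c x); split=> //.
  apply/smooth_onP => l; apply: (Ck_add oOO).
    by move: l; apply/smooth_onP; apply: smooth_on_subset CS => x [].
  have /smooth_onP wC : smooth_on (O `&` O') (weight K) by exact: weight_smooth.
  have /smooth_onP cC : smooth_on (O `&` O') c by apply: smooth_on_subset cS => x [].
  have cCc := (Ck_mxP l c oOO).1 (cC l).
  apply/(Ck_mxP _ _ oOO) => i j.
  apply: (eq_Ck oOO (f := fun x => weight K x * c x i j)) => [x _|]; first by rewrite mxE.
  exact: (Ck_mul oOO (wC l) (cCc i j)).
apply: (nbhsS2 Cn cn) => q <- /= [_ <-].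
by rewrite big_ord_recr.
Unshelve. all: by end_near. Qed.

Lemma good_glue : exists g, good X setT g.
Proof.
have /choice[K HK] := phi_cover.
exists (fun q => \sum_(k < (K q).+1) weight k (f q) *: G k q).
apply: (good_local (@openT M)) => p _.
have [W [g gg Wp]] := good_cover p.
have [ O [C [ oO Op CS Cn]]] := glue_local (K p).+1 gg Wp.
exists (W `&` f @^-1` O), (fun q => g q - - C (f q)); split.
- apply: (good_shift f_smooth ker_df gg oO (c := fun x => - C x)).
  by apply/smooth_onP => k; apply: (Ck_opp oO); move/smooth_onP: CS; apply.
- by split.
(* Near [p] all sums can be cut at [K p], where the weights add up to 1, so the glued function is
   [g] plus a function of [f]. *)
have p1 := HK p; apply: (nbhsS2 Cn (f_cont p1)) => q <- /= p1q.
have Kq : phi (K q) (f q) = 1 by exact: nbhs_singleton (HK q).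
rewrite (weighted_sum_stable (G ^~ q) Kq p1q) opprK.
under [in RHS]eq_bigr do rewrite scalerBr.
rewrite big_split /= sumrN -scaler_suml sum_weight.
have -> : \prod_(j < (K p).+1) (1 - phi j (f q)) = 0.
  by rewrite (bigD1 ord_max) //= p1q subrr mul0r.
by rewrite subr0 scale1r [RHS]addrC subrK.
Qed.

End partition.

Lemma rational_approx (x : 'rV[R]_n) e : 0 < e ->
  exists q : 'rV[rat]_n, `|x - map_mx ratr q| <= e.
Proof.
move=> e0.
have /choice[q Hq] : forall i, exists q : rat, `|x 0 i - ratr q| <= e.
  move=> i; have [|q] := @rat_in_itvoo R (x 0 i - e) (x 0 i + e).
    by rewrite ltrBlDr -addrA ltrDl addr_gt0.
  rewrite in_itv /= => /andP[h1 h2]; exists q; rewrite ler_norml; apply/andP.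
  by split; lra.
exists (\row_i q i); apply: rV_norm_le => [|i]; first exact: ltW.
by rewrite !mxE.
Qed.

(** The sequence needed by [good_glue] enumerates the balls with rational centre and radius
    [3 / (m + 1)], coded by [pickle]. *)
Lemma good_global :
  (forall p, exists2 r : R, 0 < r & exists g, good X (f @^-1` ball (f p) r) g) ->
  exists g, good X setT g.
Proof.
move=> loc.
pose d (m : nat) : R := m.+1%:R^-1.
have d0 m : 0 < d m by rewrite invr_gt0 ltr0n.
pose ctr (q : 'rV[rat]_n) : 'rV[R]_n := map_mx ratr q.
(* The bump is 1 within [d] of the centre and vanishes beyond [2 * d]; radius [3 * d] leaves a
   margin [d], so outside [V] it vanishes on a whole neighbourhood. *)
pose V (t : 'rV[rat]_n * nat) : set 'rV[R]_n := ball (ctr t.1) (3 * d t.2).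
(* Indices that code no pair, or a ball without good function, get the zero cut-off and the empty
   set. *)
have /choice[T HT] : forall k, exists t : ('rV[R]_n -> R) * set 'rV[R]_n * (M -> 'rV[R]_n),
    [/\ smooth_on setT t.1.1, good X (f @^-1` t.1.2) t.2,
     forall x, t.1.2 x \/ \forall y \near x, t.1.1 y = 0
     & forall z, unpickle k = Some z -> (exists g, good X (f @^-1` V z) g) ->
       forall x, `|x - ctr z.1| <= d z.2 -> t.1.1 x = 1].
  move=> k; case: (@unpickle ('rV[rat]_n * nat)%type k) => [z|]; last first.
    exists (cst 0, set0, cst 0); split=> //.
    - by apply/smooth_onP => l; exact: Ck_cst.
    - by split=> //=; [rewrite preimage_set0; exact: open0|move=> c _ s h x [y []]].
    - by move=> x; right; near=> y.
  have [[g gg]|ng] := pselect (exists g, good X (f @^-1` V z) g); last first.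
    exists (cst 0, set0, cst 0); split=> //.
    - by apply/smooth_onP => l; exact: Ck_cst.
    - by split=> //=; [rewrite preimage_set0; exact: open0|move=> c _ s h x [y []]].
    - by move=> x; right; near=> y.
    - by move=> _ [<-].
  have [phi [pS p1 p2]] := smooth_bump (ctr z.1) (d0 z.2).
  exists (phi, V z, g); split=> //= [x|_ [<-] _]; last exact: p1.
  have [xz|xz] := ltP (`|x - ctr z.1|) (3 * d z.2).
    by left; rewrite /V -ball_normE /= distrC.
  right; apply/nbhs_normE; exists (d z.2) => // y yx.
  apply/eqP/negP => /negP /p2 yz.
  have := ler_normB (x - y) (ctr z.1 - y).
  rewrite opprB addrA subrK distrC in yx *; rewrite [`|ctr z.1 - y|]distrC.
  by move: (d0 z.2) xz yz yx; lra.
apply: (@good_glue (fun k => (T k).1.1) (fun k => (T k).1.2) (fun k => (T k).2)).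
- by move=> k; have [] := HT k.
- by move=> k; have [] := HT k.
- by move=> k; have [] := HT k.
move=> p; have [r r0 [g gg]] := loc p.
(* With a centre within [d m / 2] of [f p], the ball of radius [3 * d m] lies in the ball of radius
   [r], and points within [d m / 2] of [f p] lie where the bump is 1. *)
have [m m4] : exists m, 4 * d m < r.
  have r4 : 0 < r / 4 by rewrite divr_gt0.
  have [m] := ltr_add_invr r4; rewrite add0r -/(d m) => H; exists m.
  by move: (d m) H => dm H; lra.
have dm := d0 m; have d2 : 0 < d m / 2 by rewrite divr_gt0.
have [q Hq] := rational_approx (f p) d2.
exists (pickle (q, m)).
have [_ _ _ /(_ (q, m) (pickleK _)) /= H1] := HT (pickle (q, m)).
have sub : V (q, m) `<=` ball (f p) r.
  move=> x; rewrite /V -!ball_normE /= => Vx.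
  have := ler_normD (f p - ctr q) (ctr q - x); rewrite addrA subrK.
  by move: Hq Vx m4 dm; rewrite -/(ctr q); lra.
have gV : exists g, good X (f @^-1` V (q, m)) g.
  exists g; have [og gS gX] := gg; split=> [||x i Vx]; last by apply: gX; exact: sub.
    have := @open_setI_preimage _ _ _ f (V (q, m)) (@openT M) (fun q _ => f_cont (x := q)).
    by rewrite setTI; apply; exact: ball_open.
  by apply: (smooth_fun_subset _ gS) => x; exact: sub.
apply/nbhs_normE; exists (d m / 2) => // y yp; apply: (H1 gV).
have := ler_normD (y - f p) (f p - ctr q); rewrite addrA subrK.
by move: Hq yp; rewrite -/(ctr q); lra.
Unshelve. all: by end_near. Qed.

End gluing.

(** * Global coordinates *)

Section global_coordinates.
Variables (R : realType) (n : nat) (M : manifold R (n + n)).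
Variables (f g : M -> 'rV[R]_n) (X : 'I_n -> M -> 'rV[R]_(n + n)).
Hypothesis f_smooth : smooth_fun setT f.
Hypothesis ker_df : forall p v, dfun p f v = 0 <-> exists a, v = a *m Xmx X p.
Hypothesis g_good : good X setT g.

Let oT := @openT M.
Let trV k := @smooth_target_rV R k.
Let Theta q := row_mx (f q) (g q).

Let g_smooth : smooth_fun setT g. Proof. by case: g_good. Qed.

Let Theta_smooth : smooth_fun setT Theta.
Proof. exact: (smooth_fun_row_mx oT f_smooth g_smooth). Qed.

Let chartT p := good_chart f_smooth ker_df g_good (p := p) Logic.I.

(** Along an integral curve, [Theta] has the constant derivative [- row_mx 0 (std_basis R k)], so it
    moves uniformly on a straight line. *)
Lemma good_flow k p : complete_field (X k) -> exists gamma : R -> M,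
  [/\ continuous gamma, gamma 0 = p &
    forall t, Theta (gamma t) = Theta p - t *: row_mx 0 (std_basis R k)].
Proof.
move=> /(_ p)[gamma [g0 [cg dg]]]; exists gamma; split=> // t.
apply/rowP => j; pose v : 'rV[R]_(n + n) := row_mx 0 (std_basis R k).
have dT (s : R) : is_derive s (1 : R) (Theta \o gamma) (- v).
  have -> : - v = dfun (gamma s) Theta (X k (gamma s)).
    rewrite (dfun_row_mx oT _ _ f_smooth g_smooth) // (dfun_fX ker_df).
    by have [_ _ ->] := g_good; rewrite // opp_row_mx oppr0.
  have [ds Ds] := dg s; rewrite -Ds.
  apply: is_derive_into; [exact: cg|exact: ds|].
  by apply: (smooth_fun_differentiable (trV _) oT _ Theta_smooth (atlas_at _) (mem_chart_at _)).
have dh (s : R) : is_derive s (1 : R) (fun s : R => Theta (gamma s) 0 j + s * v 0 j) 0.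
  have [ds Ds] := dT s.
  have dc : is_derive s (1 : R) (fun s : R => Theta (gamma s) 0 j) (- v 0 j).
    split; first by have /(derivable_mxP (Theta \o gamma))/(_ 0 j) := ds.
    by have := derive_coord 0 j ds; rewrite /= => ->; rewrite Ds mxE.
  have di : is_derive s (1 : R) (fun s : R => s * v 0 j) (v 0 j).
    have d1 := is_derive_id s (1 : R).
    have d2 := is_derive_cst (v 0 j) s (1 : R).
    apply: (is_derive_eq (is_deriveM d1 d2)).
    by rewrite scaler0 add0r [_ *: 1]mulr1.
  by apply: (is_derive_eq (is_deriveD dc di)); rewrite addNr.
have E := is_derive_0_is_cst t 0 dh; rewrite g0 mul0r addr0 in E.
have -> : (Theta p - t *: v) 0 j = Theta p 0 j - t * v 0 j by rewrite !mxE.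
by rewrite -E addrK.
Qed.

Lemma good_injective : (forall i, complete_field (X i)) ->
  (forall p, path_connected R (f @^-1` [set f p])) -> injective Theta.
Proof.
move=> cX pc p q E; have [fE gE] := eq_row_mx E.
have [_ /(_ p q erefl (esym fE)) [gamma [[cg Fg] g0 g1]]] := pc p.
pose delta := gamma \o @clamp R.
have cd : continuous delta.
  apply: (continuous_within_comp cg (@clamp_continuous R)) => t.
  by rewrite /= in_itv /= clamp_itv.
have fd t : f (delta t) = f p.
  by apply: Fg; rewrite /= in_itv /= clamp_itv.
have d0 : delta 0 = p by rewrite /delta /= clamp0.
have d1 : delta 1 = q by rewrite /delta /= clamp1.
rewrite -d0 -d1.
(* The times for which the flows must run to bring [Theta] back to its initial value; they vanish at
   both ends since [g p = g q]. *)
pose c k t := (g (delta t) - g p) 0 k.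
have gcont : continuous g by move=> x; exact: (smooth_fun_continuous g_smooth oT).
apply: (@sliding_loop R (n + n) n M Theta (fun k => row_mx 0 (std_basis R k)) _ _ _ _
  delta c) => //.
- exact: manifold_hausdorff.
- by move=> x; exact: (smooth_fun_continuous Theta_smooth oT).
- move=> x; have [r [kappa [r0 [ck kS] kin kp kn]]] := chartT x.
  exists kappa; split=> //.
    have Bn : nbhs (Theta x) (ball (Theta x) r) by exact: nbhsx_ballx.
    by apply: (nbhsS Bn) => z Bz; split; [exact: ck|have [] := kin z Bz].
  by apply: (nbhsS kn) => y [].
- by move=> k x; exact: good_flow.
- move=> k t.
  have cgd : {for t, continuous (g \o delta)}.
    by apply: continuous_comp; [exact: cd|exact: gcont].
  have cgp : {for t, continuous (fun t => g (delta t) - g p)}.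
    by apply: cvgB; [exact: cgd|exact: cvg_cst].
  exact: (@continuous_comp _ _ _ (fun t => g (delta t) - g p) (fun x : 'rV[R]_n => x 0 k)
    t cgp (@coord_continuous R 1 n 0 k _)).
- move=> t; rewrite d0 {1}/Theta fd.
  rewrite (_ : \sum_k _ = row_mx 0 (g (delta t) - g p)).
    by rewrite /Theta add_row_mx addr0 addrC subrK.
  transitivity (\sum_k row_mx (0 : 'rV[R]_n) (c k t *: std_basis R k)).
    by apply: eq_bigr => k _; rewrite scale_row_mx scaler0.
  rewrite [in RHS](row_sum_delta (g (delta t) - g p)).
  have D (x y : 'rV[R]_n) : row_mx 0 (x + y) = row_mx (0 : 'rV[R]_n) x + row_mx 0 y.
    by rewrite add_row_mx addr0.
  by rewrite (big_morph _ D (row_mx0 R 1 n n)).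
- by move=> k; rewrite /c d0 d1 gE subrr mxE.
Qed.

Lemma good_global_coordinates : (forall i, complete_field (X i)) ->
  (forall p, path_connected R (f @^-1` [set f p])) -> global_coordinates Theta.
Proof.
move=> cX pc; split=> //; first exact: good_injective.
  rewrite openE => _ [p _ <-].
  have [r [kappa [r0 _ kin _ _]]] := chartT p.
  apply: (nbhsS (nbhsx_ballx (Theta p) r r0)) => z Bz.
  by exists (kappa z) => //; have [] := kin z Bz.
move=> G GK.
(* A left inverse is forced locally: [G z = G (Theta (kappa z)) = kappa z]. *)
have loc p : exists (r : R) kappa, [/\ 0 < r, smooth_into (ball (Theta p) r) kappa &
    forall z, ball (Theta p) r z -> G z = kappa z].
  have [r [kappa [r0 kS kin _ _]]] := chartT p; exists r, kappa; split=> // z Bz.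
  by have [_ {1}<-] := kin z Bz; rewrite GK.
split=> [_ [p _ <-]|c ac].
  have [r [kappa [r0 [ck _] GE]]] := loc p.
  have pB : ball (Theta p) r (Theta p) by exact: ballxx.
  move=> N; rewrite (GE _ pB) => /(ck _ pB) kN.
  by apply: (nbhsS2 kN (nbhsx_ballx (Theta p) r r0)) => z Nz Bz; rewrite /= GE.
apply: smooth_on_local => _ [[p _ <-] cp].
have [r [kappa [r0 [ck kS] GE]]] := loc p.
have pB : ball (Theta p) r (Theta p) by exact: ballxx.
have oN : open (ball (Theta p) r `&` kappa @^-1` chart_dom c).
  by apply: open_setI_preimage => //; [exact: ball_open|exact: chart_dom_open].
exists (ball (Theta p) r `&` kappa @^-1` chart_dom c).
  by apply: open_nbhs_nbhs; split=> //; split=> //=; rewrite -GE.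
apply: (smooth_on_eq oN _ (kS c ac)) => z [Bz _].
by rewrite /= GE.
Qed.

End global_coordinates.

(** * The symplectic form in the coordinates (f, g) *)

Lemma derive_row_mxl (R : realType) n (W : normedModType R)
    (h : 'rV[R]_(n + n) -> W) (y x v : 'rV[R]_n) :
  'D_v (fun x => h (row_mx x y)) x = 'D_(row_mx v 0) h (row_mx x y).
Proof.
rewrite /derive; set F1 := (X in lim (X @ _) = _); set F2 := (X in _ = lim (X @ _)).
suff -> : F1 = F2 by [].
apply/funext => t; rewrite /F1 /F2 /= scale_row_mx scaler0.
by rewrite [X in _ = _ *: (h X - _)]add_row_mx add0r.
Qed.

Lemma std_basis_lshift (R : realType) n (i : 'I_n) :
  std_basis R (lshift n i) = row_mx (std_basis R i) 0.
Proof.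
by apply/rowP => j; case: (split_ordP j) => k ->; rewrite ?row_mxEl ?row_mxEr !mxE
  ?eq_lshift // eq_rlshift andbF.
Qed.

Lemma std_basis_rshift (R : realType) n (i : 'I_n) :
  std_basis R (rshift n i) = row_mx 0 (std_basis R i).
Proof.
by apply/rowP => j; case: (split_ordP j) => k ->; rewrite ?row_mxEl ?row_mxEr !mxE
  ?eq_rshift // eq_lrshift andbF.
Qed.

Lemma form_eval_canonical (R : realType) n (b : 'M[R]_n) (x y x' y' : 'rV[R]_n) :
  form_eval (block_mx b 1%:M (- 1%:M) 0) (row_mx x y) (row_mx x' y') =
  form_eval b x x' + (x *m y'^T) 0 0 - (y *m x'^T) 0 0.
Proof.
rewrite /form_eval mul_row_block tr_row_mx mul_row_col mulmx1 mulmx0 addr0.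
rewrite mulmxN mulmx1 mulmxDl mulNmx.
by rewrite [LHS]mxE [X in X + _ = _]mxE [X in _ + X + _ = _]mxE addrAC.
Qed.

Lemma derive_near_cst (R : realType) m (h : 'rV[R]_m -> R) (c : R) z v :
  (\forall y \near z, h y = c) -> 'D_v h z = 0.
Proof. by move=> hc; rewrite (@near_eq_derive _ _ _ _ (cst c)) ?derive_cst. Qed.

Lemma ulsubmx_coord (T : Type) n (A : 'M[T]_(n + n)) i j :
  ulsubmx A i j = A (lshift n i) (lshift n j).
Proof. by rewrite !mxE. Qed.

Section correction.
Variables (R : realType) (n : nat) (M : manifold R (n + n)).
Variables (w : M -> 'M[R]_(n + n)) (f g : M -> 'rV[R]_n).
Variable (X : 'I_n -> M -> 'rV[R]_(n + n)).
Hypothesis w_symplectic : symplectic w.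
Hypothesis f_smooth : smooth_fun setT f.
Hypothesis f_lagrangian : forall p, lagrangian w (f @^-1` [set f p]).
Hypothesis X_hamiltonian : forall i, hamiltonian_field w (fun p => f p 0 i) (X i).
Hypothesis X_free : forall p, row_free (\matrix_(i < n) X i p).
Hypothesis g_good : good X setT g.
Hypothesis f_paths : forall p, path_connected R (f @^-1` [set f p]).

Let oT := @openT M.
Let trV k := @smooth_target_rV R k.
Let ker_df := kernel_df w_symplectic f_smooth f_lagrangian X_hamiltonian X_free.
Let Theta q := row_mx (f q) (g q).
Let g_smooth : smooth_fun setT g. Proof. by case: g_good. Qed.
Let Theta_smooth : smooth_fun setT Theta.
Proof. exact: (smooth_fun_row_mx oT f_smooth g_smooth). Qed.

Let dTheta p u : dfun p Theta u = row_mx (dfun p f u) (dfun p g u).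
Proof. exact: (dfun_row_mx oT _ _ f_smooth g_smooth). Qed.

Let dTheta_inj p u v : dfun p Theta u = dfun p Theta v -> u = v.
Proof.
move=> E; apply/eqP; rewrite -subr_eq0; apply/eqP.
have H : dfun p Theta (u - v) = 0.
  have := dfun_lin v u (-1) (trV _) oT (U := setT) (p := p) Logic.I Theta_smooth.
  by rewrite !scaleN1r addrC [X in _ = X]addrC E subrr.
exact: (good_fg_inj f_smooth ker_df g_good Logic.I H).
Qed.

Lemma good_chart_at p : let a := chart_at p in
  exists (r : R) (kappa : 'rV[R]_(n + n) -> M),
   [/\ 0 < r, smooth_into (ball (Theta p) r) kappa,
       forall z, ball (Theta p) r z -> chart_dom a (kappa z) /\ Theta (kappa z) = z,
       kappa (Theta p) = p
     & \forall q \near p, ball (Theta p) r (Theta q) /\ kappa (Theta q) = q].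
Proof.
move=> a; apply: (good_chart f_smooth ker_df (X := X) (W := chart_dom a)).
  split; first exact: chart_dom_open.
    by apply: (smooth_fun_subset _ g_smooth).
  by move=> q i _; have [_ _ ->] := g_good.
exact: mem_chart_at.
Qed.

(** The rows of [E] are the coordinate vectors of [(f, g)] at [p], in the components used for the
    tangent space. *)
Lemma good_frame p : exists E : 'M[R]_(n + n), forall v, dfun p Theta (v *m E) = v.
Proof.
have [r [kappa [r0 kS kin kp kn]]] := good_chart_at p.
exists (\matrix_i push kappa (Theta p) (std_basis R i)) => v.
rewrite (dfun_sum _ _ oT (U := setT)) // [RHS](row_sum_delta v).
apply: eq_bigr => i _; rewrite rowK; congr (_ *: _).
have pB : ball (Theta p) r (Theta p) by exact: ballxx.
have Bn : \forall z \near Theta p, Theta (kappa z) = z.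
  by apply: (nbhsS (nbhsx_ballx (Theta p) r r0)) => z /kin[].
have := @dfun_push R _ M _ setT (ball (Theta p) r) Theta kappa (Theta p) (std_basis R i).
by rewrite kp; apply => //; exact: ball_open.
Qed.

Section frame.
Variable E : M -> 'M[R]_(n + n).
Hypothesis EP : forall p v, dfun p Theta (v *m E p) = v.

(** The matrix of [w] in the coordinate frame of [(f, g)]. *)
Let A p := E p *m w p *m (E p)^T.

Lemma form_eval_frame p u v :
  form_eval (w p) u v = form_eval (A p) (dfun p Theta u) (dfun p Theta v).
Proof.
rewrite /A -form_eval_mul; congr form_eval; apply: (dTheta_inj (p := p)).
  by rewrite EP.
by rewrite EP.
Qed.

(** Through a local inverse of [Theta], [A] becomes the pullback of a local expression of [w], and
    so inherits smoothness, antisymmetry and closedness. *)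
Lemma frame_chart p : exists (r : R) (kappa : 'rV[R]_(n + n) -> M) theta,
   [/\ 0 < r, form2_on (ball (Theta p) r) theta, closed2_on (ball (Theta p) r) theta,
     forall z, ball (Theta p) r z -> Theta (kappa z) = z /\ A (kappa z) = theta z
     & \forall q \near p, ball (Theta p) r (Theta q) /\ kappa (Theta q) = q].
Proof.
have [r [kappa [r0 kS kin kp kn]]] := good_chart_at p.
set a := chart_at p in kin; have aa : atlas a by exact: atlas_at.
have oB : open (ball (Theta p) r) by exact: ball_open.
have ka z : ball (Theta p) r z -> chart_dom a (kappa z) by move=> /kin[].
have [t2 tC] := pull_symplectic w_symplectic aa oB kS ka.
exists r, kappa, (pull (a \o kappa) (local_form w a)); split=> // z Bz.
have [ak kT] := kin z Bz; split=> //; apply/matrixP => i j.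
rewrite -[in RHS]form_eval_basis (local_form_pull w _ _ aa oB kS Bz ak).
have Bn : \forall y \near z, Theta (kappa y) = y.
  by apply: (nbhsS (open_nbhs_nbhs (conj oB Bz))) => y /kin[].
have pE v : push kappa z v = v *m E (kappa z).
  apply: (dTheta_inj (p := kappa z)); rewrite EP.
  exact: (dfun_push v oT Logic.I Theta_smooth oB Bz kS Bn).
by rewrite !pE form_eval_mul form_eval_basis.
Qed.

Lemma frame_antisym p : (A p)^T = - A p.
Proof.
have [r [kappa [theta [r0 [_ tA] _ kin kn]]]] := frame_chart p.
have [Bp kp] := nbhs_singleton kn; have [_ AE] := kin _ Bp.
by rewrite -kp AE; exact: tA.
Qed.

(** The vertical coordinate vector of index [j] is [- X_j], and [w(X_j, .)] is [df_j]. *)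
Lemma frame_vertical p j l : A p (rshift n j) l = - (l == lshift n j)%:R.
Proof.
have rE i : row i (E p) = std_basis R i *m E p by rewrite -rowE.
have XE : row (rshift n j) (E p) = - X j p.
  apply: (dTheta_inj (p := p)); rewrite rE EP std_basis_rshift.
  have := dfun_scale (X j p) (-1) (trV _) oT (U := setT) (p := p) Logic.I Theta_smooth.
  rewrite !scaleN1r => ->; rewrite dTheta (dfun_fX ker_df).
  by have [_ _ ->] := g_good; rewrite // opp_row_mx oppr0 opprK.
rewrite -form_eval_basis /A -form_eval_mul -!rE XE rE.
have -> : - X j p = (- std_basis R j) *m Xmx X p by rewrite mulNmx -rowE rowK.
rewrite (form_eval_Xmx f_smooth X_hamiltonian).
have /(congr1 lsubmx) := EP p (std_basis R l); rewrite dTheta row_mxKl -rowE => ->.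
by rewrite mulNmx [LHS]mxE -rowE !mxE eq_sym.
Qed.

Lemma frame_block p : A p = block_mx (ulsubmx (A p)) 1%:M (- 1%:M) 0.
Proof.
rewrite -[LHS]submxK; congr block_mx; apply/matrixP => i j.
- have /matrixP/(_ (rshift n j) (lshift n i)) := frame_antisym p.
  rewrite mxE [RHS]mxE frame_vertical opprK => H.
  by rewrite [LHS]mxE [LHS]mxE H [RHS]mxE eq_lshift.
- rewrite [LHS]mxE [LHS]mxE frame_vertical eq_lshift eq_sym.
  by rewrite [RHS]mxE [X in _ = - X]mxE.
- by rewrite [LHS]mxE [LHS]mxE frame_vertical eq_rlshift oppr0 [RHS]mxE.
Qed.

Lemma form_eval_block p u v : form_eval (w p) u v =
  form_eval (ulsubmx (A p)) (dfun p f u) (dfun p f v) +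
  (dfun p f u *m (dfun p g v)^T) 0 0 - (dfun p g u *m (dfun p f v)^T) 0 0.
Proof.
by rewrite form_eval_frame {1}frame_block !dTheta form_eval_canonical.
Qed.

(** Closedness for two base indices and one vertical index kills the vertical derivative of a base
    entry, the other two entries being constant by [frame_vertical]. Paths in the fibre make this
    global. *)
Lemma base_form_fibre p q : f q = f p -> ulsubmx (A q) = ulsubmx (A p).
Proof.
have loc p0 : \forall q0 \near p0, f q0 = f p0 -> ulsubmx (A q0) = ulsubmx (A p0).
  have [r [kappa [theta [r0 [tS tA] tC kin kn]]]] := frame_chart p0.
  have [Bp kp] := nbhs_singleton kn.
  have oB : open (ball (Theta p0) r) by exact: ball_open.
  apply: (nbhsS kn) => q0 [Bq kq] fq.
  have [_ +] := kin _ Bq; have [_ +] := kin _ Bp; rewrite kp kq => AE' AE.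
  apply/matrixP => i j; rewrite !ulsubmx_coord AE AE'.
  have -> : Theta q0 = Theta p0 + row_mx 0 (g q0 - g p0).
    by rewrite /Theta fq add_row_mx addr0 addrC subrK.
  have ijS : smooth_on (ball (Theta p0) r) (fun z => theta z (lshift n i) (lshift n j)).
    by move/(smooth_on_mxP _ oB): tS; apply.
  apply: (derive0_constR oB ijS) => [t t01|z Bz].
    have [h1 h2] := (ball_row_mx _ _ _ _ r0).1 Bq.
    rewrite scale_row_mx scaler0 add_row_mx addr0; apply/(ball_row_mx _ _ _ _ r0).
    split; first exact: ballxx.
    rewrite -ball_normE /= distrC; apply: (ball_convex t01).
      by rewrite subrr normr0.
    by move: h2; rewrite -ball_normE /= distrC.
  have ijC : Ck 1 (ball (Theta p0) r) (fun z => theta z (lshift n i) (lshift n j)).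
    by move/smooth_onP: ijS; apply.
  rewrite (deriveE_sum _ (C1_differentiable oB Bz ijC)) big1 // => k _.
  case: (split_ordP k) => l ->; first by rewrite row_mxEl mxE mul0r.
  have Bn : nbhs z (ball (Theta p0) r) by exact: (open_nbhs_nbhs (conj oB Bz)).
  have cst2 l' v : 'D_v (fun y => theta y (rshift n l) (lshift n l')) z = 0.
    apply: (@derive_near_cst R _ _ (- (lshift n l' == lshift n l)%:R)).
    by apply: (nbhsS Bn) => y /kin[_ <-]; rewrite frame_vertical.
  have cst3 l' v : 'D_v (fun y => theta y (lshift n l') (rshift n l)) z = 0.
    apply: (@derive_near_cst R _ _ ((lshift n l' == lshift n l)%:R)).
    apply: (nbhsS Bn) => y By; have /matrixP/(_ (rshift n l) (lshift n l')) := tA y By.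
    have [_ <-] := kin y By; rewrite mxE [RHS]mxE frame_vertical.
    by move=> ->; rewrite opprK.
  have := tC z Bz (lshift n i) (lshift n j) (rshift n l).
  by rewrite cst2 cst3 !add0r => ->; rewrite mulr0.
move=> fq; have [_ /(_ p q erefl fq) [gamma [[cg Fg] g0E g1E]]] := f_paths p.
pose delta := gamma \o @clamp R.
have cd : continuous delta.
  apply: (continuous_within_comp cg (@clamp_continuous R)) => t.
  by rewrite /= in_itv /= clamp_itv.
have fd t : f (delta t) = f p.
  by apply: Fg; rewrite /= in_itv /= clamp_itv.
have ld t : \forall s \near t, ulsubmx (A (delta s)) = ulsubmx (A (delta t)).
  by apply: (nbhsS (cd t _ (loc (delta t)))) => s /=; apply; rewrite !fd.
have := @connected_clopenR R (fun t => ulsubmx (A (delta t)) = ulsubmx (A (delta 0))) _ _ 0 1.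
rewrite /delta /= clamp0 clamp1 g0E g1E; apply=> //.
  by move=> t e'; apply: (nbhsS (ld t)) => s ->.
by move=> t e'; apply: (nbhsS (ld t)) => s ->.
Qed.

Lemma base_form_smooth_closed : exists beta : 'rV[R]_n -> 'M[R]_n,
  [/\ form2_on (range f) beta, closed2_on (range f) beta
    & forall p, ulsubmx (A p) = beta (f p)].
Proof.
(* The base block descends to the image of [f]; outside the image the value 0 is arbitrary. *)
have /choice[beta Hb] : forall x, exists b, forall p, f p = x -> ulsubmx (A p) = b.
  move=> x; have [[p fp]|nx] := pselect (exists p, f p = x).
    by exists (ulsubmx (A p)) => q fq; apply: base_form_fibre; rewrite fq.
  by exists 0 => p fp; case: nx; exists p.
have bE p : ulsubmx (A p) = beta (f p) by exact: Hb.
have loc p : exists (r : R) theta, [/\ 0 < r, form2_on (ball (Theta p) r) theta,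
    closed2_on (ball (Theta p) r) theta
    & forall x, ball (f p) r x -> beta x = ulsubmx (theta (row_mx x (g p)))].
  have [r [kappa [theta [r0 t2 tC kin kn]]]] := frame_chart p.
  exists r, theta; split=> // x Bx.
  have Bz : ball (Theta p) r (row_mx x (g p)).
    by apply/(ball_row_mx _ _ _ _ r0); split=> //; exact: ballxx.
  have [/eq_row_mx[fk _] <-] := kin _ Bz.
  by rewrite bE fk.
have inB p r x : 0 < r -> ball (f p) r x -> ball (Theta p) r (row_mx x (g p)).
  by move=> r0 Bx; apply/(ball_row_mx _ _ _ _ r0); split=> //; exact: ballxx.
exists beta; split=> //.
  split=> [|_ [p _ <-]]; last first.
    rewrite -bE; apply/matrixP => i j; rewrite mxE [RHS]mxE !ulsubmx_coord.
    have /matrixP/(_ (lshift n i) (lshift n j)) := frame_antisym p.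
    by rewrite mxE [RHS]mxE.
  apply: smooth_on_local => _ [p _ <-].
  have [r [theta [r0 [tS _] _ bt]]] := loc p.
  exists (ball (f p) r); first exact: nbhsx_ballx.
  have oO : open (ball (f p) r) by exact: ball_open.
  have oB : open (ball (Theta p) r) by exact: ball_open.
  have tr := @smooth_on_comp R 'rV[R]_n _ _ _ _ _ theta (fun x => row_mx x (g p))
    oO oB (fun x => inB p r x r0) tS (@smooth_on_row_mxl R n (g p) _).
  apply/(smooth_on_mxP _ oO) => i j.
  have := (smooth_on_mxP _ oO).1 tr (lshift n i) (lshift n j).
  by apply: (smooth_on_eq oO) => x Bx; rewrite bt // ulsubmx_coord.
move=> _ [p _ <-] i j k.
have [r [theta [r0 _ tC bt]]] := loc p.
have pB : ball (f p) r (f p) by exact: ballxx.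
have D v l l' : 'D_v (fun y => beta y l l') (f p) =
    'D_(row_mx v 0) (fun z => theta z (lshift n l) (lshift n l')) (row_mx (f p) (g p)).
  rewrite -derive_row_mxl; apply: near_eq_derive.
  by apply: (nbhsS (nbhsx_ballx (f p) r r0)) => x Bx; rewrite bt // ulsubmx_coord.
rewrite !D -!std_basis_lshift; apply: tC; exact: inB.
Qed.

End frame.

(** If [beta = sum_i d(alpha_i) dx_i], then [sum_i dx_i dy_i + beta = sum_i dx_i d(y_i - alpha_i)]
    by antisymmetry of the wedge product. *)
Lemma darboux_correction : H2_zero (range f) -> open (range f) ->
  exists g', good X setT g' /\ forall p u v, form_eval (w p) u v =
    (dfun p f u *m (dfun p g' v)^T) 0 0 - (dfun p f v *m (dfun p g' u)^T) 0 0.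
Proof.
move=> H2 oB; have /choice[E EP] := good_frame.
have [beta [b2 bC bE]] := base_form_smooth_closed EP.
have [alpha [aS aE]] := H2 beta b2 bC.
have fB p : range f (f p) by exists p.
exists (fun q => g q - alpha (f q)); split.
  have := good_shift f_smooth ker_df g_good oB aS.
  rewrite setTI (_ : f @^-1` range f = setT) //.
  by apply/seteqP; split=> // q _; exact: fB.
move=> p u v; rewrite (form_eval_block EP) bE.
have afS : smooth_fun setT (fun q => alpha (f q)).
  by apply: (smooth_fun_comp (trV n) oT oB _ f_smooth aS) => q _; exact: fB.
have dg' y : dfun p (fun q => g q - alpha (f q)) y =
    dfun p g y - 'D_(dfun p f y) alpha (f p).
  have -> := dfunB y (trV n) oT (I : [set: M] p) g_smooth afS.
  by have -> := dfun_comp y (trV n) oT oB (I : [set: M] p) (fB p) f_smooth aS.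
rewrite !dg'; move: (dfun p f u) (dfun p f v) (dfun p g u) (dfun p g v) => x x' y y'.
have aC : Ck 1 (range f) alpha by move/smooth_onP: aS; apply.
have da z j : ('D_z alpha (f p)) 0 j =
    \sum_i z 0 i * 'D_(std_basis R i) (fun t => alpha t 0 j) (f p).
  have ajC : Ck 1 (range f) (fun t => alpha t 0 j) by move/(Ck_mxP _ _ oB): aC; apply.
  rewrite -(deriveE_sum _ (C1_differentiable oB (fB p) ajC)) derive_coord //.
  exact: smooth_on_derivable aS (fB p).
have bxx : form_eval (beta (f p)) x x' =
    (x' *m ('D_x alpha (f p))^T) 0 0 - (x *m ('D_x' alpha (f p))^T) 0 0.
  rewrite /form_eval [LHS]mxE [X in _ = X - _]mxE [X in _ = _ - X]mxE.
  transitivity (\sum_j \sum_i (x' 0 j * (x 0 i *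
      'D_(std_basis R i) (fun t => alpha t 0 j) (f p)) -
      x 0 i * (x' 0 j * 'D_(std_basis R j) (fun t => alpha t 0 i) (f p)))).
    apply: eq_bigr => j _; rewrite [x'^T _ _]mxE [X in X * _ = _]mxE mulr_suml.
    apply: eq_bigr => i _; rewrite aE //.
    move: ('D__ _ _) ('D__ _ _) => d1 d2; ring.
  under eq_bigr do rewrite big_split /=.
  rewrite big_split /=; congr (_ + _).
    by apply: eq_bigr => j _; rewrite [X in _ = _ * X]mxE da mulr_sumr.
  rewrite exchange_big -sumrN; apply: eq_bigr => i _ /=.
  by rewrite [X in _ = - (_ * X)]mxE da mulr_sumr sumrN.
have dot (a b c : 'rV[R]_n) :
    (a *m (b - c)^T) 0 0 = (a *m b^T) 0 0 - (a *m c^T) 0 0.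
  by rewrite raddfB /= mulmxBr [LHS]mxE [X in _ + X]mxE.
have -> : (y *m x'^T) 0 0 = (x' *m y^T) 0 0.
  by rewrite !mxE; apply: eq_bigr => i _; rewrite !mxE mulrC.
move: bxx; move: ('D_x alpha (f p)) ('D_x' alpha (f p)) => d d' ->.
rewrite (dot x y' d') (dot x' y d).
move: ((x *m _) 0 0) ((x' *m _) 0 0) ((x *m _) 0 0) ((x' *m _) 0 0) => a1 a2 a3 a4.
by ring.
Qed.

End correction.

Theorem theorem3p4p5 (R : realType) (n : nat) (M : manifold R (n + n))
    (w : M -> 'M[R]_(n + n)) (B : set 'rV[R]_n) (f : M -> 'rV[R]_n)
    (X : 'I_n -> M -> 'rV[R]_(n + n)) :
  symplectic w ->
  open B -> connected B ->
  fiber_bundle B f ->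
  H2_zero B ->
  (forall b, B b -> simply_connected R (f @^-1` [set b]) /\
                    lagrangian w (f @^-1` [set b])) ->
  (forall i, hamiltonian_field w (fun p => f p 0 i) (X i)) ->
  (forall p, row_free (\matrix_(i < n) X i p)) ->
  (forall i, complete_field (X i)) ->
  exists g : M -> 'rV[R]_n, global_darboux w f g.
Proof.
move=> ws oB _ [fS rf _] H2 fibres Xh Xf Xc.
have fB p : B (f p) by rewrite -rf; exists p.
have fL p : lagrangian w (f @^-1` [set f p]) by have [] := fibres _ (fB p).
have sc p : simply_connected R (f @^-1` [set f p]) by have [] := fibres _ (fB p).
have pc p : path_connected R (f @^-1` [set f p]) by have [] := sc p.
have ker := kernel_df ws fS fL Xh Xf.
have cover := good_exists ws fS fL Xh Xf.
(* The potentials of different fibres are chosen independently, and over an empty fibre any function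
   will do. *)
have /choice[G GP] : forall b, exists G : M -> 'rV[R]_n, forall W g p, good X W g ->
    W p -> f p = b -> \forall q \near p, f q = b -> G q - g q = G p - g p.
  move=> b; have [[p fp]|nb] := pselect (exists p, f p = b).
    by have := fibre_potential fS ker cover (sc p); rewrite fp.
  by exists (cst 0) => W g p _ _ fp; case: nb; exists p.
have loc p : exists2 r : R, 0 < r & exists g, good X (f @^-1` ball (f p) r) g.
  by apply: (good_over_ball fS ker cover (G := G)) => // W g q gg Wq; exact: GP gg Wq _.
have [g gg] := good_global fS ker cover loc.
rewrite -rf in oB H2.
have [g' [gg' wE]] := darboux_correction ws fS fL Xh Xf gg pc H2 oB.
exists g'; split; first exact: (good_global_coordinates fS ker gg' Xc pc).
have [_ gS _] := gg'.
have dotE (a b : 'rV[R]_n) : (a *m b^T) 0 0 = \sum_i a 0 i * b 0 i.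
  by rewrite mxE; apply: eq_bigr => i _; rewrite [b^T _ _]mxE.
have cf p v i := dfun_coord v i (@openT M) (I : [set: M] p) fS.
have cg p v i := dfun_coord v i (@openT M) (I : [set: M] p) gS.
move=> p u v; rewrite wE.
rewrite (dotE (dfun p f u) (dfun p g' v)) (dotE (dfun p f v) (dfun p g' u)) -sumrB.
apply: eq_bigr => i _.
by rewrite !cf !cg.
Qed.
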